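(* Let $\mathsf G$ be a finite or countable graph and let $(e^{ta})_{t\ge0}$ be the semigroup on $L^2(\mathsf G)$ associated with the Laplacian on $\mathsf G$ with continuity and Kirchhoff conditions in the nodes. The following assertions are equivalent. (a) The semigroup $(e^{ta})_{t\ge0}$ is irreducible. (b) $S_{\rm fin}(\mathsf e)=\mathsf G$ for one $\mathsf e\in\mathsf E$. (c) $S_{\rm fin}(\mathsf e)=\mathsf G$ for all $\mathsf e\in\mathsf E$.
   Context: $\mathsf G$ has vertex set $\mathsf V$ and edge set $\mathsf E$ (finite or countable); each edge $\mathsf e$ is parametrised by $[0,1]$ and has endpoints $\mathsf e(0),\mathsf e(1)\in\mathsf V$. The degree $\deg(\mathsf v)\in\mathbb N_0\cup\{\infty\}$ is the number of edges incident on $\mathsf v$, loops counted twice. $L^2(\mathsf G):=\bigoplus_{\mathsf e\in\mathsf E}L^2(0,1)$ (Hilbert direct sum). The form domain is the set $V$ of all $\psi=(\psi_{\mathsf e})\in\bigoplus_{\mathsf e\in\mathsf E}H^1(0,1)$ for which there is $d^\psi\in\ell^2(\mathsf V)$ with $\psi_{\mathsf e}(0)=d^\psi_{\mathsf e(0)}$ and $\psi_{\mathsf e}(1)=d^\psi_{\mathsf e(1)}$ for all $\mathsf e$, and the form is $a(\psi,\psi')=\sum_{\mathsf e}\int_0^1\psi_{\mathsf e}'(x)\,\overline{(\psi'_{\mathsf e})'(x)}\,dx$ (in $\psi_{\mathsf e}'$ and $(\psi'_{\mathsf e})'$ the outer prime denotes the derivative). $(e^{ta})_{t\ge0}$ is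 the analytic semigroup generated by the operator $A$ associated with $a$ ($D(A)=\{\psi\in V:\exists f\in L^2(\mathsf G)\ \forall\varphi\in V: a(\psi,\varphi)=(f\mid\varphi)\}$, $A\psi=-f$). The semigroup is irreducible if $\{0\}$ and $L^2(\mathsf G)$ are its only invariant closed ideals. For edges $\mathsf e,\mathsf e'$, a path from $\mathsf e$ to $\mathsf e'$ is a finite sequence of nodes $(\mathsf v_1,\dots,\mathsf v_n)$ with $\mathsf v_1$ incident on $\mathsf e$, $\mathsf v_n$ incident on $\mathsf e'$, and consecutive nodes adjacent (undirected). The generalised distance is $d_{\mathsf E}(\mathsf e,\mathsf e'):=\min_P\sum_{\mathsf v\in P}\deg(\mathsf v)\in\mathbb N\cup\{\infty\}$, minimum over all such paths $P$ ($\infty$ if there is none). The finite span is $S_{\rm fin}(\mathsf e):=\{\mathsf e'\in\mathsf E:d_{\mathsf E}(\mathsf e,\mathsf e')<\infty\}$, identified with the subgraph it induces; $S_{\rm fin}(\mathsf e)=\mathsf G$ means that it contains all edges. *)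

(* Defs.v *)
From HB Require Import structures.
From mathcomp Require Import all_boot all_order all_algebra.
From mathcomp Require Import all_classical all_reals all_analysis.
From mathcomp Require Import complex.

Set Implicit Arguments.
Unset Strict Implicit.
Unset Printing Implicit Defensive.
Import Order.TTheory GRing.Theory Num.Theory.
Import numFieldNormedType.Exports.

Local Open Scope classical_set_scope.
Local Open Scope ring_scope.

(* A countType may be finite.  Loops and parallel edges are allowed; the edge e
   is parametrised by [0, 1] from e(0) = tail e to e(1) = head e. *)
Record graph := Graph {
  vertex : countType;
  edge : countType;
  tail : edge -> vertex;
  head : edge -> vertex }.

Section combinatorics.
Variables (R : realType) (G : graph).
Implicit Types (v w : vertex G) (e : edge G).

(* A loop at v belongs to both sets, hence is counted twice. *)
Definition deg v : \bar R :=
  (counting [set e | tail e = v] + counting [set e | head e = v])%E.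

Definition incident v e : Prop := tail e = v \/ head e = v.

Definition adjacent v w : Prop :=
  exists e, (tail e = v /\ head e = w) \/ (tail e = w /\ head e = v).

(* The nodes of the path are v :: s; in particular there is at least one. *)
Definition edge_path e e' v (s : seq (vertex G)) : Prop :=
  [/\ incident v e, incident (last v s) e'
    & path (fun x y => `[< adjacent x y >]) v s].

(* The lengths lie in N u {+oo}, so the infimum is a minimum unless there is no
   path at all, in which case it is +oo. *)
Definition edge_dist e e' : \bar R :=
  ereal_inf [set l : \bar R | exists v s,
    edge_path e e' v s /\ l = (\sum_(w <- v :: s) deg w)%E].

Definition finite_span e : set (edge G) :=
  [set e' | (edge_dist e e' < +oo)%E].

End combinatorics.

Section interval.
Variable R : realType.
Local Notation mu := (@lebesgue_measure R).
Local Notation I01 := [set` `[(0 : R), (1 : R)]].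
Implicit Types u g : R -> R[i].

Definition abs2 (z : R[i]) : R := complex.Re z ^+ 2 + complex.Im z ^+ 2.

(* Elements of L^2(0,1) are represented by functions R -> R[i], of which only
   the restriction to [0, 1] matters, up to equality almost everywhere. *)
Definition sqnorm01 u : \bar R := (\int[mu]_(x in I01) (abs2 (u x))%:E)%E.

Definition L2_01 u : Prop :=
  [/\ measurable_fun I01 (fun x => complex.Re (u x)),
      measurable_fun I01 (fun x => complex.Im (u x))
    & (sqnorm01 u < +oo)%E].

(* C^1 functions with compact support in ]0, 1[. *)
Definition test_function (phi : R -> R) : Prop :=
  [/\ forall x, derivable phi x 1,
      continuous (derive1 phi)
    & exists a b : R, [/\ 0 < a, b < 1 & forall x, ~~ (a <= x <= b) -> phi x = 0]].

Definition weak_derivative u g : Prop :=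
  forall phi, test_function phi ->
    (\int[mu]_(x in I01) (complex.Re (u x) * derive1 phi x) =
      - (\int[mu]_(x in I01) (complex.Re (g x) * phi x))) /\
    (\int[mu]_(x in I01) (complex.Im (u x) * derive1 phi x) =
      - (\int[mu]_(x in I01) (complex.Im (g x) * phi x))).

Definition H1_01 u : Prop :=
  L2_01 u /\ exists g, L2_01 g /\ weak_derivative u g.

(* For u in H^1(0,1), the weak derivative, which is unique up to equality
   almost everywhere on [0, 1]. *)
Definition wderiv u : R -> R[i] :=
  xget (fun=> 0) [set g | L2_01 g /\ weak_derivative u g].

(* The continuous representative of u takes the value c at x in [0, 1]. *)
Definition has_trace u (x : R) (c : R[i]) : Prop :=
  exists v : R -> R[i],
    [/\ {within I01, continuous (fun y => complex.Re (v y))},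
        {within I01, continuous (fun y => complex.Im (v y))},
        {ae mu, forall y, 0 <= y <= 1 -> u y = v y}
      & v x = c].

End interval.

(* Representatives of elements of L^2(G). *)
Definition edge_fun (R : realType) (G : graph) : Type := edge G -> R -> R[i].

Section form.
Variables (R : realType) (G : graph).
Local Notation mu := (@lebesgue_measure R).
Local Notation I01 := [set` `[(0 : R), (1 : R)]].
Local Notation F := (edge_fun R G).
Implicit Types f g h psi phi : F.

Definition addF f g : F := fun e x => f e x + g e x.
Definition subF f g : F := fun e x => f e x - g e x.
Definition oppF f : F := fun e x => - f e x.
Definition scaleF (c : R[i]) f : F := fun e x => c * f e x.

(* Equality in L^2(G). *)
Definition eqL2 f g : Prop :=
  forall e, {ae mu, forall x, 0 <= x <= 1 -> f e x = g e x}.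

Definition sqnormL2 f : \bar R := (\esum_(e in [set: edge G]) sqnorm01 (f e))%E.

Definition L2 f : Prop := (forall e, L2_01 (f e)) /\ (sqnormL2 f < +oo)%E.

Definition normL2 f : R := Num.sqrt (fine (sqnormL2 f)).

(* Sum of an absolutely summable real family. *)
Definition sumE (u : edge G -> R) : R :=
  fine (\esum_(e in [set: edge G]) (EFin \o u)^\+ e -
        \esum_(e in [set: edge G]) (EFin \o u)^\- e)%E.

(* The scalar product (f | g), linear in f. *)
Definition dotL2 f g : R[i] :=
  Complex
    (sumE (fun e => \int[mu]_(x in I01) complex.Re (f e x * conjc (g e x))))
    (sumE (fun e => \int[mu]_(x in I01) complex.Im (f e x * conjc (g e x)))).

Definition derivF psi : F := fun e => wderiv (psi e).

(* The Hilbert direct sum of the spaces H^1(0,1). *)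
Definition H1 psi : Prop :=
  [/\ forall e, H1_01 (psi e), L2 psi & L2 (derivF psi)].

Definition form_dom psi : Prop :=
  H1 psi /\
  exists d : vertex G -> R[i],
    (\esum_(v in [set: vertex G]) (abs2 (d v))%:E < +oo)%E /\
    forall e, has_trace (psi e) 0 (d (tail e)) /\
              has_trace (psi e) 1 (d (head e)).

Definition form psi phi : R[i] := dotL2 (derivF psi) (derivF phi).

(* The graph of the operator A associated with the form: psi is in D(A) and
   A psi = g. *)
Definition form_operator psi g : Prop :=
  form_dom psi /\
  exists f, [/\ L2 f,
    forall phi, form_dom phi -> form psi phi = dotL2 f phi
    & eqL2 g (oppF f)].

(* Strongly continuous semigroup of bounded linear operators on L^2(G); the
   operators act on representatives and respect equality in L^2(G). *)
Record C0_semigroup (T : R -> F -> F) : Prop := {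
  semigroup_L2 : forall (t : R) f, 0 <= t -> L2 f -> L2 (T t f);
  semigroup_eqL2 : forall (t : R) f g, 0 <= t -> L2 f -> L2 g ->
    eqL2 f g -> eqL2 (T t f) (T t g);
  semigroup_linear : forall (t : R) (c : R[i]) f g, 0 <= t -> L2 f -> L2 g ->
    eqL2 (T t (addF (scaleF c f) g)) (addF (scaleF c (T t f)) (T t g));
  semigroup_bounded : forall t : R, 0 <= t ->
    exists M : R, forall f, L2 f -> normL2 (T t f) <= M * normL2 f;
  semigroup0 : forall f, L2 f -> eqL2 (T 0 f) f;
  semigroupD : forall (s t : R) f, 0 <= s -> 0 <= t -> L2 f ->
    eqL2 (T (s + t) f) (T s (T t f));
  semigroup_cvg : forall f, L2 f ->
    normL2 (subF (T t f) f) @[t --> 0^'+] --> (0 : R) }.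

(* T is the semigroup (e^{tB}) for the operator with graph B: f lies in the
   domain and B f = g exactly when (T t f - f) / t --> g in L^2(G). *)
Definition generates (B : F -> F -> Prop) (T : R -> F -> F) : Prop :=
  C0_semigroup T /\
  forall f g, L2 f -> L2 g ->
    (B f g <->
     normL2 (subF (scaleF (real_complex R t^-1) (subF (T t f) f)) g)
       @[t --> 0^'+] --> (0 : R)).

(* Closed ideals of the complex Banach lattice L^2(G), as sets of
   representatives saturated for eqL2. *)
Record closed_ideal (I : set F) : Prop := {
  ideal_L2 : forall f, I f -> L2 f;
  ideal0 : I (fun _ _ => 0);
  idealD : forall f g, I f -> I g -> I (addF f g);
  idealZ : forall (c : R[i]) f, I f -> I (scaleF c f);
  ideal_solid : forall f g, I f -> L2 g ->
    (forall e, {ae mu, forall x, 0 <= x <= 1 -> `|g e x| <= `|f e x|}) -> I g;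
  ideal_closed : forall f, L2 f ->
    (forall eps : R, 0 < eps -> exists2 g, I g & normL2 (subF f g) < eps) -> I f }.

Definition invariant (T : R -> F -> F) (I : set F) : Prop :=
  forall (t : R) f, 0 <= t -> I f -> I (T t f).

Definition irreducible (T : R -> F -> F) : Prop :=
  forall I : set F, closed_ideal I -> invariant T I ->
    I = [set f | L2 f /\ eqL2 f (fun _ _ => 0)] \/ I = [set f | L2 f].

End form.

(* Main.v *)
From HB Require Import structures.
From mathcomp Require Import all_boot all_order all_algebra.
From mathcomp Require Import all_classical all_reals all_analysis.
From mathcomp Require Import measurable_realfun complex ring lra.
Require Import Defs.

(* (a) => (b).  Let S consist of an edge e and its finite span.  A function in
   the form domain vanishes at every node of infinite degree: otherwise each of
   the infinitely many edges there would carry a fixed amount of H^1 energy.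
   Hence restriction to S preserves the form domain and so commutes with the
   semigroup, that is, the ideal of the functions supported in S is invariant;
   being nonzero it is all of L^2(G).

   (b) => (a).  The projection P of L^2(G) onto a closed ideal I is
   multiplication by the indicator function of a measurable set U.  If I is
   invariant, then P commutes with the self-adjoint semigroup and maps the
   domain of the generator into the form domain.  Applied to functions supported
   inside one edge, the continuity of 1_U psi shows that U is null or conull in
   each edge; applied to functions equal to 1 near one node of finite degree,
   the continuity of P psi in this node shows that the alternative is the same
   for all edges incident on it.  So U is null or conull if all edges are linked
   by paths through nodes of finite degree.

   Both parts use the symmetry of e^{ta}, obtained by differentiating
   s |-> (T_{t-s} f | Q T_s g); orbits are differentiable because a strongly
   continuous semigroup is locally bounded, by Baire's argument. *)

Set Implicit Arguments.
Unset Strict Implicit.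
Unset Printing Implicit Defensive.
Import Order.TTheory GRing.Theory Num.Theory.
Import numFieldNormedType.Exports HBSimple HBNNSimple.
Local Open Scope classical_set_scope.
Local Open Scope ring_scope.

(** * Strongly continuous semigroups in inner product spaces *)

(** The semigroup is known only through its generator, and no resolvent or spectral calculus is
    used. Everything is drawn from two facts: scalar products of orbits can be differentiated in
    time, and the domain of the generator is dense because it contains the $C^2$ functions with
    compact support inside one edge. Elements of L^2(G) are represented by functions, so the
    operators are linear, and satisfy the semigroup law, only up to functions vanishing almost
    everywhere. The abstract part therefore works with a seminorm N and writes equality of f and g
    as [N (f - g) = 0]. Scalars are real there and [ip] becomes the real part of the scalar product.
    This loses nothing: the projections to be compared with the semigroup are symmetric for the real
    part already, and the imaginary part of (f | g) is the real part of (f | i g). *)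

Lemma cvg_dist_squeeze (R : realType) (T : Type) (G : set_system T)
    {FG : Filter G} (f E : T -> R) (l : R) :
  (\forall s \near G, `|f s - l| <= E s) -> E s @[s --> G] --> 0 ->
  f s @[s --> G] --> l.
Proof.
move=> fE E0; apply/cvgrPdist_lt => e e0; near=> s; rewrite distrC.
rewrite (@le_lt_trans _ _ (E s))//; first by near: s.
by rewrite (le_lt_trans (ler_norm _))//; near: s; exact: cvgr0_norm_lt.
Unshelve. all: by end_near. Qed.

Lemma near0_norm_lt (R : realType) (d : R) : 0 < d ->
  \forall k \near nbhs (0 : R), `|k| < d.
Proof.
by move=> d0; apply/nbhs_normP; exists d => // k /=; rewrite sub0r normrN.
Qed.

Section prehilbert.
Variables (R : realType) (F : lmodType R) (D : F -> Prop) (ip : F -> F -> R).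

(** D singles out the representatives of elements of the space inside a larger space of functions.
    [ip] is only positive semidefinite, since functions equal almost everywhere have distance 0. *)
Record semi_inner : Prop := {
  si_D : forall f g, D f -> D g -> D (f + g);
  si_Z : forall c f, D f -> D (c *: f);
  si_ipC : forall f g, D f -> D g -> ip f g = ip g f;
  si_ipD : forall f g h, D f -> D g -> D h -> ip (f + g) h = ip f h + ip g h;
  si_ipZ : forall c f h, D f -> D h -> ip (c *: f) h = c * ip f h;
  si_ge0 : forall f, D f -> 0 <= ip f f }.

Definition snorm f := Num.sqrt (ip f f).

Hypothesis P : semi_inner.
Let DD := si_D P.
Let DZ := si_Z P.
Let ipC := si_ipC P.
Let ipDl := si_ipD P.
Let ipZl := si_ipZ P.
Local Notation N := snorm.

Lemma si_N f : D f -> D (- f).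
Proof. by move=> Df; rewrite -scaleN1r; apply: DZ. Qed.

Lemma si_B f g : D f -> D g -> D (f - g).
Proof. by move=> Df Dg; apply: DD => //; apply: si_N. Qed.

Let DN := si_N.
Let DB := si_B.
#[local] Hint Resolve DD DZ DN DB : core.

Lemma ipBl f g h : D f -> D g -> D h -> ip (f - g) h = ip f h - ip g h.
Proof.
move=> Df Dg Dh; rewrite ipDl//; last exact: DN.
by rewrite -scaleN1r ipZl// mulN1r.
Qed.

Lemma ipDr f g h : D f -> D g -> D h -> ip h (f + g) = ip h f + ip h g.
Proof. by move=> Df Dg Dh; rewrite (ipC Dh Df) (ipC Dh Dg) -ipDl//; apply: ipC; auto 9. Qed.

Lemma ipBr f g h : D f -> D g -> D h -> ip h (f - g) = ip h f - ip h g.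
Proof. by move=> Df Dg Dh; rewrite (ipC Dh Df) (ipC Dh Dg) -ipBl//; apply: ipC; auto 9. Qed.

Lemma ipZr c f h : D f -> D h -> ip h (c *: f) = c * ip h f.
Proof. by move=> Df Dh; rewrite (ipC Dh Df) -ipZl//; apply: ipC; auto 9. Qed.

Lemma snorm_ge0 f : 0 <= N f. Proof. exact: sqrtr_ge0. Qed.

Lemma snorm_sq f : D f -> N f ^+ 2 = ip f f.
Proof. by move=> Df; rewrite sqr_sqrtr// (si_ge0 P). Qed.

Lemma cauchy_schwarz f g : D f -> D g -> `|ip f g| <= N f * N g.
Proof.
move=> Df Dg.
have key t : 0 <= ip f f + 2 * t * ip f g + t ^+ 2 * ip g g.
  have := si_ge0 P (DD Df (DZ t Dg)).
  rewrite ipDl ?ipDr ?ipZl ?ipZr; auto 9.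
  rewrite (ipC Dg Df) => H; apply: le_trans H _; rewrite le_eqVlt; apply/orP; left.
  by apply/eqP; ring.
have H : ip f g ^+ 2 <= ip f f * ip g g.
  have ff := si_ge0 P Df; have gg := si_ge0 P Dg.
  have [g0|g0] := eqVneq (ip g g) 0.
    have [->|n0] := eqVneq (ip f g) 0; first by rewrite expr0n/= mulr_ge0.
    (* In the degenerate case the quadratic polynomial is affine in t; this t gives it the value
       -1. *)
    have := key (- (ip f f + 1) / (2 * ip f g)).
    rewrite g0 mulr0 addr0.
    rewrite (_ : 2 * _ * ip f g = - (ip f f + 1)); last by field.
    by lra.
  have g1 : 0 < ip g g by rewrite lt_neqAle eq_sym g0.
  have := key (- ip f g / ip g g).
  rewrite -(@pmulr_rge0 _ (ip g g))//.
  rewrite (_ : ip g g * _ = ip f f * ip g g - ip f g ^+ 2); last by field.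
  by rewrite subr_ge0.
by rewrite -sqrtrM ?(si_ge0 P)// -sqrtr_sqr; apply: ler_wsqrtr.
Qed.

Lemma snormZ c f : D f -> N (c *: f) = `|c| * N f.
Proof.
move=> Df; rewrite /snorm ipZl ?ipZr; auto 9.
by rewrite mulrA -expr2 sqrtrM ?sqr_ge0// sqrtr_sqr.
Qed.

Lemma snormD f g : D f -> D g -> N (f + g) <= N f + N g.
Proof.
move=> Df Dg; rewrite -(@ler_pXn2r _ 2)// ?nnegrE ?addr_ge0 ?snorm_ge0//.
rewrite snorm_sq; auto 9.
rewrite ipDl ?ipDr; auto 9.
rewrite (ipC Dg Df) sqrrD !snorm_sq//.
have := le_trans (ler_norm _) (cauchy_schwarz Df Dg).
by rewrite mulr2n; lra.
Qed.

Lemma snormN f : D f -> N (- f) = N f.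
Proof. by move=> Df; rewrite -scaleN1r snormZ// normrN1 mul1r. Qed.

Lemma snorm_distC f g : D f -> D g -> N (f - g) = N (g - f).
Proof. by move=> Df Dg; rewrite -snormN; auto 9; rewrite opprB. Qed.

Lemma snorm_tri h f g : D h -> D f -> D g -> N (f - g) <= N (f - h) + N (h - g).
Proof.
move=> Dh Df Dg; have -> : f - g = (f - h) + (h - g) by rewrite addrA subrK.
by apply: snormD; auto 9.
Qed.

Lemma snorm_le f g : D f -> D g -> N f <= N (f - g) + N g.
Proof. by move=> Df Dg; rewrite -{1}(subrK g f); apply: snormD; auto 9. Qed.

Lemma snorm0 : D 0 -> N 0 = 0.
Proof. by move=> D0; rewrite -(scale0r (0 : F)) snormZ// normr0 mul0r. Qed.

Lemma eqv_snorm f g : D f -> D g -> N (f - g) = 0 -> N f = N g.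
Proof.
move=> Df Dg fg; apply/eqP; rewrite eq_le.
rewrite (le_trans (snorm_le Df Dg)) ?fg ?add0r//=.
by rewrite (le_trans (snorm_le Dg Df))// snorm_distC// fg add0r.
Qed.

Lemma eqv_ip f g h : D f -> D g -> D h -> N (f - g) = 0 -> ip f h = ip g h.
Proof.
move=> Df Dg Dh fg; apply/eqP; rewrite -subr_eq0 -ipBl// -normr_le0.
by rewrite (le_trans (cauchy_schwarz _ _))//; auto 9; rewrite fg mul0r.
Qed.

Lemma eqvT f g h : D f -> D g -> D h ->
  N (f - g) = 0 -> N (g - h) = 0 -> N (f - h) = 0.
Proof.
move=> Df Dg Dh fg gh; apply/eqP; rewrite eq_le snorm_ge0 andbT.
by rewrite (le_trans (@snorm_tri g _ _ _ _ _))// fg gh addr0.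
Qed.

Lemma eqvC f g : D f -> D g -> N (f - g) = 0 -> N (g - f) = 0.
Proof. by move=> Df Dg fg; rewrite snorm_distC. Qed.

Lemma eqvB f g f' g' : D f -> D g -> D f' -> D g' ->
  N (f - f') = 0 -> N (g - g') = 0 -> N ((f - g) - (f' - g')) = 0.
Proof.
move=> Df Dg Df' Dg' ff gg; apply/eqP; rewrite eq_le snorm_ge0 andbT.
have -> : (f - g) - (f' - g') = (f - f') - (g - g').
  by rewrite !opprB addrACA [RHS]addrACA; congr (_ + _); rewrite addrC.
rewrite (le_trans (snormD _ _))//; auto 9.
by rewrite snormN; auto 9; rewrite ff gg addr0.
Qed.

Lemma cvg_ip (G : set_system R) {FG : Filter G} (x y : R -> F) x' y' :
  (forall s, D (x s)) -> (forall s, D (y s)) -> D x' -> D y' ->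
  N (x s - x') @[s --> G] --> 0 -> N (y s - y') @[s --> G] --> 0 ->
  ip (x s) (y s) @[s --> G] --> ip x' y'.
Proof.
move=> Dx Dy Dx' Dy' cx cy.
apply: (@cvg_dist_squeeze _ _ _ _ _
  (fun s => N (x s - x') * (N (y s - y') + N y') + N x' * N (y s - y'))).
  near=> s; rewrite (_ : _ - _ = ip (x s - x') (y s) + ip x' (y s - y')).
    rewrite (le_trans (ler_normD _ _))// lerD//; last first.
      by apply: cauchy_schwarz; auto 9.
    rewrite (le_trans (cauchy_schwarz _ _))//; auto 9.
    by rewrite ler_wpM2l ?snorm_ge0// snorm_le.
  by rewrite ipBl// ipBr// addrA subrK.
rewrite (_ : 0 = 0 * (0 + N y') + N x' * 0); last by rewrite mul0r mulr0 addr0.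
apply: cvgD; last by apply: cvgM => //; exact: cvg_cst.
by apply: cvgM => //; apply: cvgD => //; exact: cvg_cst.
Unshelve. all: by end_near. Qed.

Lemma is_derive_ip (x y : R -> F) (s : R) x' y' :
  (forall s, D (x s)) -> (forall s, D (y s)) -> D x' -> D y' ->
  N (k^-1 *: (x (k + s) - x s) - x') @[k --> 0^'] --> 0 ->
  N (k^-1 *: (y (k + s) - y s) - y') @[k --> 0^'] --> 0 ->
  N (y (k + s) - y s) @[k --> 0^'] --> 0 ->
  is_derive s 1 (fun s => ip (x s) (y s)) (ip x' (y s) + ip (x s) y').
Proof.
move=> Dx Dy Dx' Dy' cx cy c.
have cv : k^-1 *: (((fun s => ip (x s) (y s)) \o shift s) (k *: 1) -
    ip (x s) (y s)) @[k --> 0^'] --> (ip x' (y s) + ip (x s) y' : R).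
  rewrite (_ : (fun k => _) = fun k =>
      ip (k^-1 *: (x (k + s) - x s)) (y (k + s)) +
      ip (x s) (k^-1 *: (y (k + s) - y s))).
    apply: cvgD; apply: cvg_ip => //; auto 9.
    have D0 : D 0 by rewrite -(subrr (x s)); auto 9.
    by rewrite subrr (snorm0 D0); exact: cvg_cst.
  apply/funext => k /=.
  rewrite ipZl ?ipZr; auto 9.
  by rewrite ipBl// ipBr// /GRing.scale/= mulr1 -mulrDr addrA subrK.
split; last exact: cvg_lim.
by apply/cvg_ex; exists (ip x' (y s) + ip (x s) y').
Qed.

(** * Orbits of a strongly continuous semigroup *)

Record semigroup (T : R -> F -> F) : Prop := {
  sg_D : forall (t : R) f, 0 <= t -> D f -> D (T t f);
  sg_lin : forall (t : R) c f g, 0 <= t -> D f -> D g ->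
    N (T t (c *: f + g) - (c *: T t f + T t g)) = 0;
  sg_bounded : forall t : R, 0 <= t ->
    exists M, forall f, D f -> N (T t f) <= M * N f;
  sg_0 : forall f, D f -> N (T 0 f - f) = 0;
  sg_add : forall (s t : R) f, 0 <= s -> 0 <= t -> D f ->
    N (T (s + t) f - T s (T t f)) = 0;
  sg_cvg : forall f, D f -> N (T t f - f) @[t --> 0^'+] --> 0 }.

Variable T : R -> F -> F.
Hypothesis S : semigroup T.
Let TD := sg_D S.
#[local] Hint Resolve TD : core.

Lemma semigroupB (t : R) f g : 0 <= t -> D f -> D g ->
  N (T t (f - g) - (T t f - T t g)) = 0.
Proof.
move=> t0 Df Dg; have := sg_lin S (-1) t0 Dg Df.
by rewrite !scaleN1r [- g + f]addrC [- T t g + _]addrC.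
Qed.

Lemma semigroup_normB (t : R) f g : 0 <= t -> D f -> D g ->
  N (T t f - T t g) = N (T t (f - g)).
Proof. by move=> t0 Df Dg; symmetry; apply: eqv_snorm; auto 9 using semigroupB. Qed.

Lemma semigroupZ (t c : R) f : 0 <= t -> D f -> N (T t (c *: f) - c *: T t f) = 0.
Proof.
move=> t0 Df; have D0 : D 0 by rewrite -(subrr f); auto 9.
have [M TM] := sg_bounded S t0.
have T00 : N (T t 0) = 0.
  by apply/eqP; rewrite eq_le snorm_ge0 (le_trans (TM _ D0)) ?snorm0 ?mulr0.
have := sg_lin S c t0 Df D0; rewrite addr0 => H.
apply: (@eqvT _ (c *: T t f + T t 0)) => //; auto 9.
by rewrite addrAC subrr add0r.
Qed.

Lemma semigroup_shift (s h : R) f : 0 <= s -> 0 <= h -> D f ->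
  N (T (s + h) f - T s f) = N (T s (T h f - f)).
Proof.
move=> s0 h0 Df; rewrite -semigroup_normB; auto 9.
have sh0 : 0 <= s + h by rewrite addr_ge0.
have D0 : D 0 by rewrite -(subrr f); auto 9.
apply: eqv_snorm; auto 9.
apply: eqvB; auto 9; first exact: (sg_add S).
by rewrite subrr snorm0.
Qed.

Definition bounded_at (M s : R) := forall f, D f -> N (T s f) <= M * N f.

(* Baire's argument in the Sorgenfrey topology: the times at which the operators
   are bounded by n are closed under limits from the right. *)
Lemma bounded_on_interval (tau : R) : 0 < tau ->
  exists a b M : R, [/\ 0 <= a, a < b, b <= tau &
    forall s, a <= s -> s < b -> bounded_at M s].
Proof.
move=> tau0; apply: contrapT => /forallNP H.
pose bad (n : nat) s := ~ bounded_at n%:R s.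
pose ok (p : R * R) := [/\ 0 <= p.1, p.1 < p.2 & p.2 <= tau].
have step (np : nat * (R * R)) : exists q : R * R, ok np.2 ->
    [/\ ok q, np.2.1 <= q.1, q.2 <= np.2.2 &
      forall s, q.1 <= s -> s <= q.2 -> bad np.1 s].
  case: np => n [a b] /=.
  have [/= [a0 ab bt]|nok] := pselect (ok (a, b)); last by exists (0, 0) => /nok.
  have [s0 [as0 s0b bads0]] : exists s, [/\ a <= s, s < b & bad n s].
    apply: contrapT => ns; apply: (H a); exists b, n%:R; split=> // s sa sb.
    by apply: contrapT => ?; apply: ns; exists s.
  have s00 : 0 <= s0 := le_trans a0 as0.
  have [f [Df Nf]] : exists f, D f /\ n%:R * N f < N (T s0 f).
    apply: contrapT => nf; apply: bads0 => f Df; rewrite leNgt; apply/negP => ?.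
    by apply: nf; exists f.
  have [M TM] := sg_bounded S s00.
  pose e := N (T s0 f) - n%:R * N f.
  have e0 : 0 < e by rewrite subr_gt0.
  have M0 : 0 < `|M| + 1 by rewrite ltr_wpDl.
  have /cvgr0_norm_lt/(_ (e / (`|M| + 1)) (divr_gt0 e0 M0)) := sg_cvg S Df.
  move=> [d /= d0 Hd].
  pose r := Num.min (d / 2) ((b - s0) / 2).
  have r0 : 0 < r by rewrite lt_min !divr_gt0// subr_gt0.
  have rb : s0 + r < b.
    have : r <= (b - s0) / 2 by rewrite ge_min lexx orbT.
    by lra.
  have rd : r < d.
    have : r <= d / 2 by rewrite ge_min lexx.
    by lra.
  exists (s0, s0 + r) => /= _; split => //=; last first.
  - move=> s s0s sr /(_ f Df) Nsf.
    have [hs|hs] := leP s s0.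
      have ss : s = s0 by apply/eqP; rewrite eq_le hs.
      by move: Nsf; rewrite ss leNgt Nf.
    have h0 : 0 < s - s0 by rewrite subr_gt0.
    have := Hd (s - s0).
    have sd : s - s0 < d by lra.
    rewrite /= sub0r normrN gtr0_norm// => /(_ sd h0).
    rewrite ger0_norm ?snorm_ge0// => Hs.
    have ss0 : 0 <= s by exact: le_trans s00 s0s.
    have := snorm_le (TD s00 Df) (TD ss0 Df).
    rewrite snorm_distC; auto 9.
    have := semigroup_shift s00 (ltW h0) Df.
    rewrite [s0 + _]addrC subrK => ->.
    have D1 : D (T (s - s0) f - f) by auto 9 using ltW.
    have := TM _ D1.
    have : M * N (T (s - s0) f - f) < e.
      rewrite (@le_lt_trans _ _ ((`|M| + 1) * N (T (s - s0) f - f)))//.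
        rewrite ler_wpM2r ?snorm_ge0// (le_trans (ler_norm _))//.
        by rewrite lerDl.
      by rewrite mulrC -ltr_pdivlMr.
    by rewrite /e; lra.
  - exact: ltW.
  - by split=> //=; [rewrite ltrDl|rewrite (le_trans (ltW rb))].
have [g Hg] := choice step.
pose u := fix u (n : nat) := if n is m.+1 then g (m, u m) else (0, tau).
have oku n : ok (u n).
  elim: n => [|n IH]; first by split.
  by have [] := Hg (n, u n) IH.
have mono n : (u n).1 <= (u n.+1).1 /\ (u n.+1).2 <= (u n).2.
  by have [] := Hg (n, u n) (oku n).
have incr m n : (m <= n)%N -> (u m).1 <= (u n).1.
  move=> /subnK <-; elim: (n - m)%N => // k IH.
  by rewrite (le_trans IH)// addSn; case: (mono (k + m)%N).
have decr m n : (m <= n)%N -> (u n).2 <= (u m).2.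
  move=> /subnK <-; elim: (n - m)%N => // k IH.
  by rewrite (le_trans _ IH)// addSn; case: (mono (k + m)%N).
have ub m n : (u m).1 <= (u n).2.
  have [_ + _] := oku (maxn m n) => /ltW H2.
  rewrite (le_trans (incr _ _ (leq_maxl m n)))// (le_trans H2)//.
  exact: decr (leq_maxr m n).
pose A := range (fun n => (u n).1).
have supA : has_sup A.
  by split; [exists (u 0%N).1; exists 0%N|exists (u 0%N).2 => _ [n _ <-]].
(* This time lies in all the nested intervals, so T_s violates the bound n for every n, although it
   is a bounded operator. *)
pose s := sup A.
have us n : (u n).1 <= s by apply: sup_ubound; [case: supA|exists n].
have su n : s <= (u n).2 by apply: ge_sup; [case: supA|move=> _ [m _ <-]].
have bads n : bad n s.
  by have [_ _ _] := Hg (n, u n) (oku n); apply; [exact: us n.+1|exact: su n.+1].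
have s0 : 0 <= s := us 0%N.
have [M TM] := sg_bounded S s0.
apply: (bads (Num.truncn `|M|).+1) => f Df; rewrite (le_trans (TM _ Df))//.
rewrite ler_wpM2r ?snorm_ge0// (le_trans (ler_norm _))// ltW//.
exact: truncnS_gt.
Qed.

(** Translation of the interval just found: for |s - t| < (b - a) / 2 one has s = (t - (a + b) / 2)
    + r with r between a and b, so T_s is a uniformly bounded operator followed by a fixed one. *)
Lemma bounded_near (t : R) : 0 < t -> exists d M : R, [/\ 0 < d, d <= t, 0 <= M &
  forall s, `|s - t| < d -> bounded_at M s].
Proof.
move=> t0; have [a [b [M [a0 ab bt HM]]]] := bounded_on_interval t0.
have c0 : 0 <= t - (a + b) / 2 by lra.
have [M' HM'] := sg_bounded S c0.
exists ((b - a) / 2), (`|M'| * `|M|); split; [lra|lra|by rewrite mulr_ge0|].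
move=> s; rewrite ltr_distl => /andP[s1 s2] f Df.
pose r := s - t + (a + b) / 2.
have r0 : 0 <= r by rewrite /r; lra.
have := sg_add S c0 r0 Df.
rewrite (_ : _ + r = s); last by rewrite /r; lra.
move=> /eqv_snorm -> //; auto 9; last by apply: TD => //; lra.
rewrite (le_trans (HM' _ _))//; auto 9.
rewrite -mulrA (@le_trans _ _ (`|M'| * N (T r f)))//.
  by rewrite ler_wpM2r ?snorm_ge0// ler_norm.
rewrite ler_wpM2l// (le_trans (HM r _ _ _ _))//; try by rewrite /r; lra.
by rewrite ler_wpM2r ?snorm_ge0// ler_norm.
Qed.

Lemma cvg_normr0 (u : R -> R) : u 0 = 0 -> u t @[t --> 0^'+] --> 0 ->
  u `|k| @[k --> (0 : R)] --> 0.
Proof.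
move=> u0 cu; apply/cvgr0Pnorm_lt => e e0.
have [d /= d0 Hd] := cvgr0_norm_lt _ cu e e0.
apply/nbhs_normP; exists d => // k /=; rewrite sub0r normrN => kd.
have [->|k0] := eqVneq k 0; first by rewrite normr0 u0 normr0.
by apply: Hd; rewrite /= ?sub0r ?normrN ?normr_id ?normr_gt0.
Qed.

(* Absolute values extend the orbit to an even continuous function of time. *)
Lemma orbit_continuous (t : R) f : 0 <= t -> D f ->
  N (T `|k + t| f - T t f) @[k --> 0] --> 0.
Proof.
move=> t0 Df; have c := cvg_normr0 (sg_0 S Df) (sg_cvg S Df).
move: t0; rewrite le_eqVlt => /predU1P[<-|t0].
  apply: (@cvg_dist_squeeze _ _ (nbhs (0 : R)) _ _ _ _ _ c); near=> k.
  rewrite subr0 addr0 ger0_norm ?snorm_ge0//.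
  rewrite (le_trans (@snorm_tri f _ _ _ _ _))//; auto 9.
  by rewrite [X in _ + X]snorm_distC; auto 9; rewrite (sg_0 S)// addr0.
have [d [M [d0 dt M0 HM]]] := bounded_near t0.
apply: (@cvg_dist_squeeze _ _ (nbhs (0 : R)) _ _ (fun k => M * N (T `|k| f - f))); last first.
  by rewrite -[X in _ --> X](mulr0 M); apply: cvgM => //; exact: cvg_cst.
near=> k; have kd : `|k| < d by near: k; exact: near0_norm_lt.
have kt : 0 < k + t by move: kd; rewrite ltr_norml => /andP[]; lra.
rewrite subr0 ger0_norm ?snorm_ge0// gtr0_norm//.
have D1 : D (T `|k| f - f) by auto 9.
have [k0|k0] := leP 0 k.
  rewrite [k + t]addrC semigroup_shift ?(ltW t0)// -{1}(ger0_norm k0).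
  by apply: HM => //; rewrite subrr normr0.
(* From the left, T_t f - T_(t + k) f has the norm of T_(t + k) (T_(-k) f - f). The outer operator
   varies with k, so a bound uniform in k is needed. *)
have k'0 : 0 <= - k by lra.
have := semigroup_shift (ltW kt) k'0 Df.
have t0' := ltW t0; have kt' := ltW kt.
rewrite addrAC subrr add0r snorm_distC; auto 9; move=> ->.
rewrite (ltr0_norm k0); rewrite (ltr0_norm k0) in D1.
by apply: HM => //; rewrite addrK.
Unshelve. all: by end_near. Qed.

(** The hypothesis concerns right quotients at time 0 only. A left quotient at t is T_(t + k)
    applied to the quotient at 0 with step -k; it converges because these operators are uniformly
    bounded and T_(t + k) g tends to T_t g. *)
Lemma orbit_differentiable (t : R) f g : 0 < t -> D f -> D g ->
  N (h^-1 *: (T h f - f) - g) @[h --> 0^'+] --> 0 ->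
  N (k^-1 *: (T `|k + t| f - T t f) - T t g) @[k --> 0^'] --> 0.
Proof.
move=> t0 Df Dg cf; have [d [M [d0 dt M0 HM]]] := bounded_near t0.
have c1 : N (`|k|^-1 *: (T `|k| f - f) - g) @[k --> (0 : R)^'] --> 0.
  apply/cvgr0Pnorm_lt => e e0.
  have [r /= r0 Hr] := cvgr0_norm_lt _ cf e e0.
  apply/nbhs_normP; exists r => // k /=; rewrite sub0r normrN => kr k0.
  by apply: Hr; rewrite /= ?sub0r ?normrN ?normr_id ?normr_gt0.
have c2 : N (T `|k + t| g - T t g) @[k --> 0^'] --> 0.
  exact: cvg_within_filter (orbit_continuous (ltW t0) Dg).
apply: (@cvg_dist_squeeze _ _ ((0 : R)^') _ _ (fun k =>
  M * N (`|k|^-1 *: (T `|k| f - f) - g) + N (T `|k + t| g - T t g))); last first.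
  rewrite -[X in _ --> X]addr0; apply: cvgD => //.
  by rewrite -[X in _ --> X](mulr0 M); apply: cvgM => //; exact: cvg_cst.
near=> k; have kd : `|k| < d by near: k; apply: nbhs_dnbhs; exact: near0_norm_lt.
have kt : 0 < k + t by move: kd; rewrite ltr_norml => /andP[]; lra.
have kN0 : k != 0 by near: k; exact: nbhs_dnbhs_neq.
rewrite subr0 ger0_norm ?snorm_ge0// (gtr0_norm kt).
have t0' := ltW t0; have kt' := ltW kt.
have D1 : D (T `|k| f - f) by auto 9.
have D2 : D (`|k|^-1 *: (T `|k| f - f)) by auto 9.
have D3 : D (`|k|^-1 *: (T `|k| f - f) - g) by auto 9.
have shift_quotient (s h : R) : 0 <= s -> 0 < h -> `|s - t| < d ->
    N (h^-1 *: (T (s + h) f - T s f) - T s g) <= M * N (h^-1 *: (T h f - f) - g).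
  move=> s0 h0 sd; have h0' := ltW h0; have sh0 : 0 <= s + h by rewrite addr_ge0.
  have E : N (T (s + h) f - T s f - T s (T h f - f)) = 0.
    apply: (@eqvT _ (T s (T h f) - T s f)); auto 9.
      apply: eqvB; auto 9; first exact: (sg_add S).
      by rewrite subrr snorm0// -(subrr f); auto 9.
    by apply: eqvC; auto 9; apply: semigroupB; auto 9.
  have E2 : N (h^-1 *: (T (s + h) f - T s f) - T s (h^-1 *: (T h f - f))) = 0.
    apply: (@eqvT _ (h^-1 *: T s (T h f - f))); auto 9.
      by rewrite -scalerBr snormZ; auto 9; rewrite E mulr0.
    by apply: eqvC; auto 9; apply: semigroupZ; auto 9.
  have D0 : D 0 by rewrite -(subrr f); auto 9.
  rewrite (@eqv_snorm _ (T s (h^-1 *: (T h f - f)) - T s g)); auto 9; last first.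
    by apply: eqvB; auto 9; rewrite subrr snorm0.
  rewrite semigroup_normB; auto 9.
  by apply: HM; auto 9.
have [k0|k0] := leP 0 k.
  have kp : 0 < k by rewrite lt_neqAle eq_sym kN0.
  rewrite (ger0_norm k0) ler_wpDr ?snorm_ge0// [k + t]addrC.
  by apply: shift_quotient => //; rewrite subrr normr0.
rewrite (ltr0_norm k0) (le_trans (@snorm_tri (T (k + t) g) _ _ _ _ _))//; auto 9.
rewrite lerD2r; have k'0 : 0 < - k by lra.
have := shift_quotient _ _ kt' k'0; rewrite addrK => /(_ kd).
rewrite addrAC subrr add0r invrN scaleNr -scalerN opprB.
by [].
Unshelve. all: by end_near. Qed.

Definition generator f g := N (h^-1 *: (T h f - f) - g) @[h --> 0^'+] --> 0.

Lemma cvg_dnbhsN (u : R -> R) : u k @[k --> (0 : R)^'] --> 0 ->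
  u (- k) @[k --> (0 : R)^'] --> 0.
Proof.
move=> cu; apply/cvgr0Pnorm_lt => e e0.
have [d /= d0 Hd] := cvgr0_norm_lt _ cu e e0.
apply/nbhs_normP; exists d => // k /=; rewrite sub0r normrN => kd k0.
by apply: Hd; rewrite /= ?sub0r ?opprK ?oppr_eq0.
Qed.

Lemma cvg_dnbhs_right (u : R -> R) : u k @[k --> (0 : R)^'] --> 0 ->
  u k @[k --> (0 : R)^'+] --> 0.
Proof.
move=> cu; apply/cvgr0Pnorm_lt => e e0.
have [d /= d0 Hd] := cvgr0_norm_lt _ cu e e0.
apply/nbhs_normP; exists d => // k /= kd k0.
by apply: Hd => //; rewrite gt_eqF.
Qed.

Lemma cvg_opp0 (u : R -> R) : u k @[k --> (0 : R)] --> 0 ->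
  u (- k) @[k --> (0 : R)] --> 0.
Proof.
move=> cu; apply/cvgr0Pnorm_lt => e e0.
have [d /= d0 Hd] := cvgr0_norm_lt _ cu e e0.
apply/nbhs_normP; exists d => // k /=; rewrite sub0r normrN => kd.
by apply: Hd; rewrite /= sub0r opprK.
Qed.

Lemma cvg_shift0 (u : R -> R) (t : R) : u k @[k --> (0 : R)] --> 0 ->
  u (s - t) @[s --> t] --> 0.
Proof.
move=> cu; apply/cvgr0Pnorm_lt => e e0.
have [d /= d0 Hd] := cvgr0_norm_lt _ cu e e0.
apply/nbhs_normP; exists d => // s /= sd.
by apply: Hd; rewrite /= sub0r normrN distrC.
Qed.

Lemma generator_semigroup (t : R) f g : 0 < t -> D f -> D g ->
  generator f g -> generator (T t f) (T t g).
Proof.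
move=> t0 Df Dg /(orbit_differentiable t0 Df Dg)/cvg_dnbhs_right.
apply: cvg_trans; apply: near_eq_cvg; near=> h.
have h0 : 0 < h by near: h; exact: nbhs_right_gt.
have t0' := ltW t0; have h0' := ltW h0.
have ht0 : 0 <= h + t by rewrite addr_ge0.
have D0 : D 0 by rewrite -(subrr f); auto 9.
rewrite ger0_norm//; apply: eqv_snorm; auto 9.
apply: eqvB; auto 9; last by rewrite subrr snorm0.
rewrite -scalerBr snormZ; auto 9.
rewrite (_ : N _ = 0) ?mulr0//; apply: eqvB; auto 9; last by rewrite subrr snorm0.
exact: (sg_add S).
Unshelve. all: by end_near. Qed.

Lemma generatorD f g f' g' : D f -> D g -> D f' -> D g' ->
  generator f f' -> generator g g' -> generator (f + g) (f' + g').
Proof.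
move=> Df Dg Df' Dg' cf cg.
apply: (@cvg_dist_squeeze _ _ ((0 : R)^'+) _ _
  (fun h => N (h^-1 *: (T h f - f) - f') + N (h^-1 *: (T h g - g) - g'))).
  near=> h; have h0 : 0 < h by near: h; exact: nbhs_right_gt.
  have h0' := ltW h0; rewrite subr0 ger0_norm ?snorm_ge0//.
  have D1 : D (T h (f + g) - (T h f + T h g)) by auto 9.
  have D2 : D (h^-1 *: (T h f - f) - f') by auto 9.
  have D3 : D (h^-1 *: (T h g - g) - g') by auto 9.
  have z : N (T h (f + g) - (T h f + T h g)) = 0.
    by have := sg_lin S 1 h0' Df Dg; rewrite !scale1r.
  have -> : h^-1 *: (T h (f + g) - (f + g)) - (f' + g') =
      h^-1 *: (T h (f + g) - (T h f + T h g)) +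
      ((h^-1 *: (T h f - f) - f') + (h^-1 *: (T h g - g) - g')).
    rewrite [h^-1 *: (T h f - f) - f' + _]addrACA -opprD addrA; congr (_ - _).
    rewrite -!scalerDr; congr (_ *: _).
    by rewrite [T h f - f + _]addrACA -opprD addrA subrK.
  rewrite (le_trans (snormD (DZ _ D1) (DD D2 D3)))//.
  by rewrite snormZ// z mulr0 add0r snormD.
by rewrite -[X in _ --> X]addr0; apply: cvgD.
Unshelve. all: by end_near. Qed.

Lemma generatorZ c f f' : D f -> D f' ->
  generator f f' -> generator (c *: f) (c *: f').
Proof.
move=> Df Df' cf.
apply: (@cvg_dist_squeeze _ _ ((0 : R)^'+) _ _
  (fun h => `|c| * N (h^-1 *: (T h f - f) - f'))).
  near=> h; have h0 : 0 < h by near: h; exact: nbhs_right_gt.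
  have h0' := ltW h0; rewrite subr0 ger0_norm ?snorm_ge0//.
  have D1 : D (T h (c *: f) - c *: T h f) by auto 9.
  have D2 : D (h^-1 *: (T h f - f) - f') by auto 9.
  have -> : h^-1 *: (T h (c *: f) - c *: f) - c *: f' =
      h^-1 *: (T h (c *: f) - c *: T h f) + c *: (h^-1 *: (T h f - f) - f').
    rewrite [c *: (_ - f')]scalerBr addrA; congr (_ - _).
    rewrite scalerA mulrC -scalerA -scalerDr; congr (_ *: _).
    by rewrite [c *: (_ - f)]scalerBr addrA subrK.
  rewrite (le_trans (snormD (DZ _ D1) (DZ _ D2)))//.
  by rewrite !snormZ// semigroupZ// mulr0 add0r.
by rewrite -[X in _ --> X](mulr0 `|c|); apply: cvgM => //; exact: cvg_cst.
Unshelve. all: by end_near. Qed.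

Record closed_subspace (W : F -> Prop) : Prop := {
  cs_0 : W 0;
  cs_D : forall f g, W f -> W g -> W (f + g);
  cs_Z : forall c f, W f -> W (c *: f);
  cs_closed : forall f, D f ->
    (forall eps : R, 0 < eps -> exists2 g, W g /\ D g & N (f - g) < eps) -> W f }.

Lemma closed_orthogonal k : D k -> closed_subspace (fun f => D f /\ ip f k = 0).
Proof.
move=> Dk; have D0 : D 0 by rewrite -(subrr k); auto.
split=> [|f g [Df f0] [Dg g0]|c f [Df f0]|f Df H].
- by split=> //; rewrite -(scale0r k) ipZl// mul0r.
- by split; [exact: DD|rewrite ipDl// f0 g0 addr0].
- by split; [exact: DZ|rewrite ipZl// f0 mulr0].
- split=> //; apply/eqP; rewrite -normr_le0.
  apply/ler_addgt0Pr => eps eps0; rewrite add0r.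
  have c0 : 0 < N k + 1 by rewrite ltr_wpDl ?snorm_ge0.
  have [g [[Dg g0] _] Ng] := H _ (divr_gt0 eps0 c0).
  rewrite (_ : ip f _ = ip (f - g) k); last by rewrite ipBl// g0 subr0.
  rewrite (le_trans (cauchy_schwarz _ _))//; auto.
  rewrite -[leRHS](divfK (lt0r_neq0 c0)).
  rewrite ler_pM ?snorm_ge0//; first exact: ltW.
  by rewrite lerDl.
Qed.

Definition domain f := D f /\ exists2 f', D f' & generator f f'.

(** Reduces density of the domain to a generating family. The element f0 is there to obtain
    [D 0]. *)
Lemma domain_closure (f0 : F) : D f0 ->
  closed_subspace (fun f => D f /\ forall eps : R, 0 < eps ->
    exists2 g, domain g & N (f - g) < eps).
Proof.
move=> Df0; have D0 : D 0 by rewrite -(subrr f0); auto.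
split=> [|f g [Df Wf] [Dg Wg]|c f [Df Wf]|f Df Wf].
- split=> // e e0; exists 0; last by rewrite subrr snorm0.
  split=> //; exists 0 => //; apply: (@cvg_dist_squeeze _ _ ((0 : R)^'+) _ _ (fun=> 0)).
    near=> h; have h0 : 0 < h by near: h; exact: nbhs_right_gt.
    have := semigroupZ 0 (ltW h0) D0; rewrite !scale0r !subr0 => T0.
    by rewrite snormZ ?T0 ?mulr0 ?normr0//; apply: TD => //; exact: ltW.
  exact: cvg_cst.
- split; first exact: DD.
  move=> e e0; have e20 : 0 < e / 2 by rewrite divr_gt0.
  have [f1 [Df1 [f1' Df1' ff]] Nf] := Wf _ e20.
  have [g1 [Dg1 [g1' Dg1' gg]] Ng] := Wg _ e20.
  exists (f1 + g1).
    split; first exact: DD.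
    by exists (f1' + g1'); [exact: DD|exact: generatorD].
  rewrite opprD addrACA (le_lt_trans (snormD _ _))//; auto.
  by rewrite (splitr e) ltrD.
- split; first exact: DZ.
  move=> e e0; have c0 : 0 < `|c| + 1 by rewrite ltr_wpDl.
  have [f1 [Df1 [f1' Df1' ff]] Nf] := Wf _ (divr_gt0 e0 c0).
  exists (c *: f1).
    split; first exact: DZ.
    by exists (c *: f1'); [exact: DZ|exact: generatorZ].
  rewrite -scalerBr snormZ; auto.
  rewrite (@le_lt_trans _ _ ((`|c| + 1) * N (f - f1)))//.
    by rewrite ler_wpM2r ?snorm_ge0// lerDl.
  by rewrite mulrC -ltr_pdivlMr.
- split=> // e e0; have e20 : 0 < e / 2 by rewrite divr_gt0.
  have [g [[_ Wg] Dg] Ng] := Wf _ e20.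
  have [h [Dh domh] Nh] := Wg _ e20.
  exists h => //; rewrite (le_lt_trans (snorm_tri Dg Df Dh))//.
  by rewrite (splitr e) ltrD.
Unshelve. all: by end_near. Qed.

(** * Symmetry of the semigroup relative to a contraction *)

Section symmetry.
(** Q stands for the restriction to a set of edges, and [Qsym] reads (A f | Q g) = (f | Q A g). The
    set of all edges will give self-adjointness of the semigroup, the complement of a span the
    invariance of an ideal. *)
Variable Q : F -> F.
Hypothesis QD : forall f, D f -> D (Q f).
Hypothesis QB : forall f g, Q (f - g) = Q f - Q g.
Hypothesis QZ : forall c f, Q (c *: f) = c *: Q f.
Hypothesis QN : forall f, D f -> N (Q f) <= N f.
Hypothesis Qsym : forall f g f' g', D f -> D g -> D f' -> D g' ->
  generator f f' -> generator g g' -> ip f' (Q g) = ip f (Q g').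
#[local] Hint Resolve QD : core.

(** Both orbits stay in the domain, so by [Qsym] the two terms of the derivative cancel on ]0, t[,
    and the mean value theorem equates the values at the ends. The absolute values make x and y
    defined on the whole line, as the two-sided limits require. *)
Lemma semigroup_symmetric_domain (t : R) f g f' g' : 0 < t ->
  D f -> D g -> D f' -> D g' -> generator f f' -> generator g g' ->
  ip (T t f) (Q g) = ip f (Q (T t g)).
Proof.
move=> t0 Df Dg Df' Dg' ff gg; have t0' := ltW t0.
pose x (s : R) := T `|t - s| f; pose y (s : R) := Q (T `|s| g).
have Dx s : D (x s) by rewrite /x; auto 9.
have Dy s : D (y s) by rewrite /y; auto 9.
have cx0 s : s <= t -> N (x (k + s) - x s) @[k --> (0 : R)] --> 0.
  move=> st; have ts0 : 0 <= t - s by rewrite subr_ge0.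
  have := cvg_opp0 (orbit_continuous ts0 Df).
  apply: cvg_trans; apply: near_eq_cvg; near=> k.
  by rewrite /x opprD addrCA addrC addrAC (ger0_norm ts0).
have cy0 s : 0 <= s -> N (y (k + s) - y s) @[k --> (0 : R)] --> 0.
  move=> s0; apply: cvg_dist_squeeze (orbit_continuous s0 Dg); near=> k.
  rewrite subr0 ger0_norm ?snorm_ge0// /y -QB (ger0_norm s0).
  by apply: QN; auto 9.
have dx s : 0 < s -> s < t ->
    N (k^-1 *: (x (k + s) - x s) - - T (t - s) f') @[k --> (0 : R)^'] --> 0.
  move=> s0 st; have ts0 : 0 < t - s by rewrite subr_gt0.
  have := cvg_dnbhsN (orbit_differentiable ts0 Df Df' ff).
  apply: cvg_trans; apply: near_eq_cvg; near=> k.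
  rewrite /x opprD addrCA (gtr0_norm ts0).
  rewrite -[in RHS]snormN; last by auto 9 using ltW.
  by rewrite invrN scaleNr opprD opprK.
have dy s : 0 < s ->
    N (k^-1 *: (y (k + s) - y s) - Q (T s g')) @[k --> (0 : R)^'] --> 0.
  move=> s0; apply: cvg_dist_squeeze (orbit_differentiable s0 Dg Dg' gg).
  near=> k; rewrite subr0 ger0_norm ?snorm_ge0// /y (gtr0_norm s0).
  by rewrite -QB -QZ -QB; apply: QN; auto 9 using ltW.
have cont : {in [set` `[0, t]], continuous (fun s => ip (x s) (y s))}.
  move=> s; rewrite inE/= in_itv/= => /andP[s0 st].
  apply: cvg_ip => //.
    by have := cvg_shift0 s (cx0 _ st); under eq_fun do rewrite subrK.
  by have := cvg_shift0 s (cy0 _ s0); under eq_fun do rewrite subrK.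
have [s||c _] := @MVT _ (fun s => ip (x s) (y s)) (fun=> 0) 0 t t0.
- rewrite in_itv/= => /andP[s0 st]; have s0' := ltW s0.
  have ts0 : 0 < t - s by rewrite subr_gt0.
  have ts0' := ltW ts0.
  have cy : N (y (k + s) - y s) @[k --> (0 : R)^'] --> 0.
    by apply: cvg_within_filter; exact: cy0.
  have := is_derive_ip Dx Dy (DN (TD ts0' Df')) (QD (TD s0' Dg'))
    (dx _ s0 st) (dy _ s0) cy.
  rewrite -scaleN1r ipZl; auto 9.
  rewrite mulN1r /x /y (gtr0_norm ts0) (gtr0_norm s0).
  rewrite (@Qsym (T (t - s) f) (T s g) (T (t - s) f') (T s g')); auto 9.
  + by rewrite addNr.
  + exact: generator_semigroup.
  + exact: generator_semigroup.
- exact: (continuous_in_subspaceT cont).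
rewrite mul0r => /eqP; rewrite subr_eq0 /x /y subrr subr0 normr0 gtr0_norm//.
move=> /eqP E.
have -> : ip (T t f) (Q g) = ip (T t f) (Q (T 0 g)).
  rewrite ipC; auto 9; rewrite [RHS]ipC; auto 9; apply: eqv_ip; auto 9.
  rewrite -QB; apply/eqP; rewrite eq_le snorm_ge0 andbT (le_trans (QN _))//; auto 9.
  by rewrite snorm_distC; auto 9; rewrite (sg_0 S).
by rewrite -E; apply: eqv_ip; auto 9; rewrite (sg_0 S).
Unshelve. all: by end_near. Qed.

Hypothesis dense : forall f (e : R), D f -> 0 < e ->
  exists2 g, domain g & N (f - g) < e.

Lemma semigroup_symmetric (t : R) f g : 0 <= t -> D f -> D g ->
  ip (T t f) (Q g) = ip f (Q (T t g)).
Proof.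
rewrite le_eqVlt => /predU1P[<-|t0] Df Dg.
  rewrite (@eqv_ip _ f); auto 9; last exact: (sg_0 S).
  rewrite ipC; auto 9; rewrite [RHS]ipC; auto 9; apply: eqv_ip; auto 9.
  rewrite -QB; apply/eqP; rewrite eq_le snorm_ge0 andbT (le_trans (QN _))//; auto 9.
  by rewrite snorm_distC; auto 9; rewrite (sg_0 S).
have t0' := ltW t0; have [M TM] := sg_bounded S t0'.
have TM' h : D h -> N (T t h) <= `|M| * N h.
  move=> Dh; rewrite (le_trans (TM _ Dh))// ler_wpM2r ?snorm_ge0//.
  exact: ler_norm.
(* The defect of symmetry is a bounded form vanishing on the domain. *)
have bd (f1 f2 g1 : F) : D f1 -> D f2 -> D g1 ->
    `|(ip (T t f1) (Q g1) - ip f1 (Q (T t g1))) -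
      (ip (T t f2) (Q g1) - ip f2 (Q (T t g1)))| <=
    2 * `|M| * (N (f1 - f2) * N g1).
  move=> D1 D2 D3.
  rewrite (_ : _ - _ = ip (T t f1 - T t f2) (Q g1) - ip (f1 - f2) (Q (T t g1)));
    last by rewrite !ipBl; auto 9; ring.
  rewrite (le_trans (ler_normB _ _))//.
  rewrite (_ : 2 * _ * _ =
    `|M| * N (f1 - f2) * N g1 + N (f1 - f2) * (`|M| * N g1)); last by ring.
  rewrite lerD// (le_trans (cauchy_schwarz _ _))//; auto 9.
    rewrite ler_pM ?snorm_ge0 ?QN// semigroup_normB//.
    by apply: TM'; auto 9.
  by rewrite ler_wpM2l ?snorm_ge0// (le_trans (QN _))//; auto 9.
have bd' (f1 g1 g2 : F) : D f1 -> D g1 -> D g2 ->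
    `|(ip (T t f1) (Q g1) - ip f1 (Q (T t g1))) -
      (ip (T t f1) (Q g2) - ip f1 (Q (T t g2)))| <=
    2 * `|M| * (N f1 * N (g1 - g2)).
  move=> D1 D2 D3.
  rewrite (_ : _ - _ = ip (T t f1) (Q (g1 - g2)) - ip f1 (Q (T t g1 - T t g2)));
    last by rewrite !QB !ipBr; auto 9; ring.
  rewrite (le_trans (ler_normB _ _))//.
  rewrite (_ : 2 * _ * _ =
    `|M| * N f1 * N (g1 - g2) + N f1 * (`|M| * N (g1 - g2))); last by ring.
  rewrite lerD// (le_trans (cauchy_schwarz _ _))//; auto 9.
    by rewrite ler_pM ?snorm_ge0 ?QN//; auto 9.
  rewrite ler_wpM2l ?snorm_ge0// (le_trans (QN _))//; auto 9.
  by rewrite semigroup_normB//; apply: TM'; auto 9.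
apply/eqP; rewrite -subr_eq0 -normr_le0; apply/ler_addgt0Pr => e e0.
rewrite add0r.
(* The inner 1 allows for N f1 <= N f + 1, which is why the approximation error is also kept below
   1; the outer 1 makes C positive. *)
pose C := 2 * `|M| * (N f + N g + 1) + 1.
have C0 : 0 < C by rewrite /C ltr_wpDl// mulr_ge0// addr_ge0// addr_ge0 ?snorm_ge0.
have d0 : 0 < Num.min 1 (e / C) by rewrite lt_min ltr01 divr_gt0.
have [f1 [Df1 [f1' Df1' ff1]] nf] := dense Df d0.
have [g1 [Dg1 [g1' Dg1' gg1]] ng] := dense Dg d0.
have := semigroup_symmetric_domain t0 Df1 Dg1 Df1' Dg1' ff1 gg1.
move=> /eqP; rewrite -subr_eq0 => /eqP E.
have := bd _ _ _ Df Df1 Dg; have := bd' _ _ _ Df1 Dg Dg1.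
rewrite E subr0 => b1 b2.
have := le_trans (ler_normD _ _) (lerD b2 b1); rewrite subrK => /le_trans; apply.
rewrite -mulrDr.
have nf1 : N f1 <= N f + 1.
  rewrite (le_trans (snorm_le Df1 Df))// addrC lerD2l snorm_distC//.
  by rewrite ltW// (lt_le_trans nf)// ge_min lexx.
have [nfe nge] : N (f - f1) <= e / C /\ N (g - g1) <= e / C.
  by split; apply: ltW; [apply: (lt_le_trans nf)|apply: (lt_le_trans ng)];
    rewrite ge_min lexx orbT.
have eC : 0 <= e / C by rewrite divr_ge0 ?ltW.
apply: (@le_trans _ _ (2 * `|M| * ((N f + N g + 1) * (e / C)))).
  rewrite ler_wpM2l ?mulr_ge0//.
  rewrite (_ : (N f + N g + 1) * _ = e / C * N g + (N f + 1) * (e / C)); last by ring.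
  by rewrite lerD// ler_pM ?snorm_ge0.
rewrite (_ : _ * _ = (C - 1) / C * e); last by rewrite /C; field; rewrite gt_eqF.
by rewrite ger_pMl// ler_pdivrMr// mul1r gerBl.
Qed.

End symmetry.
End prehilbert.

(** * Smooth steps *)

Section splines.
Variable R : realType.
Implicit Types (f g : R -> R) (x : R).

Definition pospow n x := Num.max x 0 ^+ n.

Lemma continuous_pospow n : continuous (pospow n).
Proof.
move=> x; apply: (@continuous_comp _ _ _ (fun x => Num.max x 0) (fun y => y ^+ n)).
  by apply: continuous_max; [exact: cvg_id|exact: cvg_cst].
exact: exprn_continuous.
Qed.

Lemma is_derive_pospow n x :
  is_derive x 1 (pospow n.+2) (n.+2%:R * pospow n.+1 x).
Proof.
have [x0|x0|->] := ltgtP x 0.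
- apply: (@near_eq_is_derive _ _ _ (cst 0)).
    near=> y; rewrite /pospow max_r ?expr0n//.
    by near: y; apply: filterS (lt_nbhsl x0) => y /ltW.
  by rewrite /pospow max_r ?ltW// expr0n/= mulr0; exact: is_derive_cst.
- apply: (@near_eq_is_derive _ _ _ (@GRing.exp R ^~ n.+2)).
    near=> y; rewrite /pospow max_l //.
    by near: y; apply: filterS (lt_nbhsr x0) => y /ltW.
  rewrite /pospow max_l ?ltW//.
  apply: DeriveDef; first exact: exprn_derivable.
  by rewrite exp_derive /GRing.scale/= mulr1.
(* At the breakpoint 0 the slope function is explicit: the truncated power of one degree less. *)
- apply/is_derive1_caratheodory; exists (pospow n.+1); split.
  + move=> z; rewrite /pospow maxxx (expr0n _ n.+2)/= !subr0.
    have [z0|z0] := leP z 0; first by rewrite !expr0n/= mul0r.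
    by rewrite -exprSr.
  + exact: continuous_pospow.
  + by rewrite /pospow maxxx expr0n/= mulr0.
Unshelve. all: by end_near. Qed.

Lemma is_derive_add f g x (a b : R) : is_derive x 1 f a -> is_derive x 1 g b ->
  is_derive x 1 (fun x => f x + g x) (a + b).
Proof. by move=> df dg; exact: (@is_deriveD _ _ _ f g). Qed.

Lemma is_derive_scale f x (a k : R) : is_derive x 1 f a ->
  is_derive x 1 (fun x => k * f x) (k * a).
Proof. by move=> df; exact: (@is_deriveZ _ _ _ f k). Qed.

Lemma is_derive_mul f g x (a b : R) : is_derive x 1 f a -> is_derive x 1 g b ->
  is_derive x 1 (fun x => f x * g x) (f x * b + g x * a).
Proof. by move=> df dg; exact: (@is_deriveM _ _ f g). Qed.

(** Carrying the derivatives as explicit functions lets sums, products and affine substitutions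
    produce them by formula; continuity has to be required of the last one only. *)
Record C2 (f f1 f2 : R -> R) : Prop := {
  C2_f : forall x, is_derive x 1 f (f1 x);
  C2_f1 : forall x, is_derive x 1 f1 (f2 x);
  C2_f2 : continuous f2 }.

Lemma is_derive_continuous f (f1 : R -> R) :
  (forall x, is_derive x 1 f (f1 x)) -> continuous f.
Proof.
by move=> df x; apply/differentiable_continuous/derivable1_diffP; case: (df x).
Qed.

Lemma C2_cont f f1 f2 : C2 f f1 f2 -> continuous f /\ continuous f1.
Proof. by case=> df df1 _; split; exact: is_derive_continuous. Qed.

Lemma C2_affine f f1 f2 (a b : R) : C2 f f1 f2 ->
  C2 (fun x => f (a * x + b)) (fun x => a * f1 (a * x + b))
     (fun x => a ^+ 2 * f2 (a * x + b)).
Proof.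
case=> df df1 cf2.
have da x : is_derive x 1 (fun x => a * x + b) a.
  have := is_derive_add (is_derive_scale a (is_derive_id x 1)) (is_derive_cst b x 1).
  by rewrite addr0 mulr1.
have dc (h h1 : R -> R) : (forall x, is_derive x 1 h (h1 x)) ->
    forall x, is_derive x 1 (fun x => h (a * x + b)) (a * h1 (a * x + b)).
  move=> dh x; rewrite mulrC.
  exact: (@is_derive1_comp _ h (fun x => a * x + b)).
split; first exact: dc.
  move=> x; rewrite expr2 -mulrA.
  by apply: is_derive_scale; exact: dc.
move=> x; apply: cvgM; first exact: cvg_cst.
apply: (@continuous_comp _ _ _ (fun x => a * x + b) f2); last exact: cf2.
by apply: cvgD; [apply: cvgM; [exact: cvg_cst|exact: cvg_id]|exact: cvg_cst].
Qed.

Lemma C2D f f1 f2 g g1 g2 : C2 f f1 f2 -> C2 g g1 g2 ->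
  C2 (fun x => f x + g x) (fun x => f1 x + g1 x) (fun x => f2 x + g2 x).
Proof.
case=> df df1 cf2 [dg dg1 cg2]; split=> x.
- exact: is_derive_add.
- exact: is_derive_add.
- by apply: cvgD; [exact: cf2|exact: cg2].
Qed.

Lemma C2Z (a : R) f f1 f2 : C2 f f1 f2 ->
  C2 (fun x => a * f x) (fun x => a * f1 x) (fun x => a * f2 x).
Proof.
case=> df df1 cf2; split=> x.
- exact: is_derive_scale.
- exact: is_derive_scale.
- by apply: cvgM; [exact: cvg_cst|exact: cf2].
Qed.

Lemma C2M f f1 f2 g g1 g2 : C2 f f1 f2 -> C2 g g1 g2 ->
  C2 (fun x => f x * g x) (fun x => f x * g1 x + g x * f1 x)
     (fun x => (f x * g2 x + g1 x * f1 x) + (g x * f2 x + f1 x * g1 x)).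
Proof.
move=> Cf Cg; have [cf cf1] := C2_cont Cf; have [cg cg1] := C2_cont Cg.
case: Cf Cg => df df1 cf2 [dg dg1 cg2]; split=> x.
- exact: is_derive_mul.
- by apply: is_derive_add; exact: is_derive_mul.
- apply: cvgD; (apply: cvgD; apply: cvgM).
  + exact: cf. + exact: cg2. + exact: cg1. + exact: cf1.
  + exact: cg. + exact: cf2. + exact: cf1. + exact: cg1.
Qed.

Lemma C2_cst (a : R) : C2 (fun=> a) (fun=> 0) (fun=> 0).
Proof. by split=> x; [exact: is_derive_cst|exact: is_derive_cst|exact: cvg_cst]. Qed.

Lemma C2_pospow : C2 (pospow 3) (fun x => 3 * pospow 2 x)
  (fun x => 3 * (2 * pospow 1 x)).
Proof.
split=> x; first exact: is_derive_pospow.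
  by apply: is_derive_scale; exact: is_derive_pospow.
by do 2 (apply: cvgM; first exact: cvg_cst); exact: continuous_pospow.
Qed.

(* The third difference of the truncated cube: an antiderivative of the
   quadratic B-spline. *)
Lemma smooth_step01 : exists s s1 s2 : R -> R, [/\ C2 s s1 s2,
  forall x, x <= 0 -> s x = 0, forall x, 3 <= x -> s x = 1 &
  forall x, 0 <= s1 x].
Proof.
have c k := C2_affine 1 (- k) C2_pospow.
have := C2Z 6^-1 (C2D (C2D (c 0) (C2Z (-3) (c 1))) (C2D (C2Z 3 (c 2)) (C2Z (-1) (c 3)))).
set s := (X in C2 X _ _); set s1 := (X in C2 _ X _); set s2 := (X in C2 _ _ X).
move=> C; exists s, s1, s2; split=> // x.
- rewrite /s /pospow => x0.
  by rewrite !max_r ?expr0n/=; lra.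
- by rewrite /s /pospow => x0; rewrite !max_l; lra.
- rewrite /s1 /pospow !mul1r.
  have [x0|x0] := leP x 0; first by rewrite !max_r ?expr0n/=; lra.
  have [x1|x1] := leP x 1.
    by rewrite max_l ?[Num.max (_ - 1) 0]max_r ?[Num.max (_ - 2) 0]max_r
      ?[Num.max (_ - 3) 0]max_r; nra.
  have [x2|x2] := leP x 2.
    by rewrite max_l ?[Num.max (_ - 1) 0]max_l ?[Num.max (_ - 2) 0]max_r
      ?[Num.max (_ - 3) 0]max_r; nra.
  have [x3|x3] := leP x 3.
    by rewrite max_l ?[Num.max (_ - 1) 0]max_l ?[Num.max (_ - 2) 0]max_l
      ?[Num.max (_ - 3) 0]max_r; nra.
  by rewrite !max_l; lra.
Qed.

Lemma smooth_step (a b : R) : a < b -> exists s s1 s2 : R -> R,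
  [/\ C2 s s1 s2, forall x, x <= a -> s x = 0, forall x, b <= x -> s x = 1,
   forall x, 0 <= s1 x & [/\ forall x, 0 <= s x <= 1,
   forall x, x <= a -> s1 x = 0 & forall x, b <= x -> s1 x = 0]].
Proof.
move=> ab; have ba0 : 0 < b - a by rewrite subr_gt0.
have [s [s1 [s2 [C s0 s31 s10]]]] := smooth_step01.
pose k := 3 / (b - a); have k0 : 0 < k by rewrite divr_gt0.
have := C2_affine k (- (k * a)) C.
set t := (X in C2 X _ _); set t1 := (X in C2 _ X _); set t2 := (X in C2 _ _ X).
move=> Ct.
have t0 x : x <= a -> t x = 0.
  by move=> xa; apply: s0; rewrite -mulrBr pmulr_rle0// subr_le0.
have tb x : b <= x -> t x = 1.
  move=> bx; apply: s31; rewrite -mulrBr /k -mulrA ler_pMr//.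
  by rewrite mulrC ler_pdivlMr// mul1r lerD2r.
have t10 x : 0 <= t1 x by rewrite mulr_ge0// ltW.
have tmono : {homo t : x y / x <= y}.
  move=> x y xy; move: (xy); rewrite le_eqVlt => /predU1P[->//|xy'].
  have ctw : {within `[x, y], continuous t}.
    by apply: continuous_subspaceT; exact: (C2_cont Ct).1.
  have [c _ E] := MVT xy' (fun z _ => C2_f Ct z) ctw.
  by rewrite -subr_ge0 E mulr_ge0// subr_ge0.
have cst0 (u v : R) x : (forall y, u < y < v -> t y = t x) -> u < x < v ->
    t1 x = 0.
  move=> H /andP[ux xv]; have := C2_f Ct x => /@derive_val <-.
  have : is_derive x 1 t 0.
    apply: (near_eq_is_derive _ (is_derive_cst (t x) x 1)).
    near=> y; symmetry; apply: H; apply/andP; split; near: y.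
      exact: lt_nbhsr.
    exact: lt_nbhsl.
  by move=> /@derive_val.
have ct1 := (C2_cont Ct).2.
exists t, t1, t2; split=> //; split=> x.
- have [xa|ax] := leP x a; first by rewrite t0// lexx ler01.
  have [bx|xb] := leP b x; first by rewrite tb// ler01 lexx.
  have := tmono _ _ (ltW ax); have := tmono _ _ (ltW xb).
  by rewrite (t0 a)// (tb b)// => -> ->.
- rewrite le_eqVlt => /predU1P[->|xa]; last first.
    apply: (cst0 (x - 1) a) => [y /andP[_ ya]|]; last by rewrite xa gtrBl ltr01.
    by rewrite !t0// ltW.
  (* At the breakpoint itself [cst0] does not apply. If [t1 a] were positive, then by continuity
     [t1] would be positive slightly to the left of a, where t is constant. *)
  apply/eqP; rewrite eq_le t10 andbT leNgt; apply/negP => t1a.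
  have : \forall y \near a, 0 < t1 y.
    exact: (cvgr_gt _ (ct1 a) _ t1a).
  move=> /nbhs_normP[e /= e0 /(_ (a - e / 2))].
  rewrite /= opprB addrCA subrr addr0 gtr0_norm ?divr_gt0// => H.
  have : 0 < t1 (a - e / 2) by apply: H; lra.
  rewrite (cst0 (a - e) a) ?ltxx//; last by lra.
  by move=> y /andP[_ ya]; rewrite !t0 ?ltW//; lra.
- rewrite le_eqVlt => /predU1P[<-|xa]; last first.
    apply: (cst0 b (x + 1)) => [y /andP[ya _]|]; last by rewrite xa ltrDl ltr01.
    by rewrite !tb// ltW.
  apply/eqP; rewrite eq_le t10 andbT leNgt; apply/negP => t1a.
  have : \forall y \near b, 0 < t1 y.
    exact: (cvgr_gt _ (ct1 b) _ t1a).
  move=> /nbhs_normP[e /= e0 /(_ (b + e / 2))].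
  rewrite /= opprD addrA subrr sub0r normrN gtr0_norm ?divr_gt0// => H.
  have : 0 < t1 (b + e / 2) by apply: H; lra.
  rewrite (cst0 b (b + e)) ?ltxx//; last by lra.
  by move=> y /andP[ya _]; rewrite !tb ?ltW//; lra.
Unshelve. all: by end_near. Qed.

End splines.

(** * Real square-integrable functions on the unit interval *)

Section real_L2.
Variable R : realType.
Local Notation mu := (@lebesgue_measure R).
Local Notation I01 := [set` `[(0 : R), (1 : R)]].
Implicit Types (f g : R -> R) (x : R).

Lemma measurable_I01 : measurable (I01 : set (measurableTypeR R)). Proof. exact: measurable_itv. Qed.
#[local] Hint Resolve measurable_I01 : core.

Lemma mu_I01 : mu I01 = 1%E.
Proof. by rewrite lebesgue_measure_itv/= lte_fin ltr01 oppr0 adde0. Qed.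

Definition L2r f : Prop :=
  measurable_fun I01 f /\ mu.-integrable I01 (fun x => (f x ^+ 2)%:E).

Lemma le_integrable_real f g : measurable_fun I01 f ->
  (forall x, 0 <= x <= 1 -> `|f x| <= g x) ->
  mu.-integrable I01 (EFin \o g) -> mu.-integrable I01 (EFin \o f).
Proof.
move=> mf fg ig; apply: le_integrable ig => //.
  exact/measurable_EFinP.
move=> x; rewrite /= in_itv/= => x01; rewrite lee_fin.
by rewrite (le_trans (fg _ x01))// ler_norm.
Qed.

Lemma L2r_mul f g : L2r f -> L2r g ->
  mu.-integrable I01 (EFin \o (fun x => f x * g x)).
Proof.
case=> mf f2 [mg g2].
apply: (@le_integrable_real _ (fun x => f x ^+ 2 + g x ^+ 2)).
- exact: measurable_funM.
- move=> x _; rewrite normrM.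
  rewrite -(real_normK (num_real (f x))) -(real_normK (num_real (g x))).
  have := normr_ge0 (f x); have := normr_ge0 (g x).
  set a := `|f x|; set b := `|g x| => b0 a0.
  have : 0 <= (a - b) ^+ 2 by apply: sqr_ge0.
  nra.
- by have := integrableD measurable_I01 f2 g2.
Qed.

Lemma L2rD f g : L2r f -> L2r g -> L2r (fun x => f x + g x).
Proof.
move=> Lf Lg; split; first exact: (measurable_funD Lf.1 Lg.1).
have := integrableD measurable_I01 (integrableD measurable_I01 Lf.2 Lg.2)
  (integrableZl measurable_I01 2 (L2r_mul Lf Lg)).
apply: eq_integrable => // x _ /=; rewrite -!EFinM -!EFinD; congr (_%:E); ring.
Qed.

Lemma L2rZ (c : R) f : L2r f -> L2r (fun x => c * f x).
Proof.
move=> [mf f2]; split; first by apply: measurable_funM => //; exact: measurable_cst.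
have := integrableZl measurable_I01 (c ^+ 2) f2.
by apply: eq_integrable => // x _ /=; rewrite -EFinM exprMn.
Qed.

Lemma L2rN f : L2r f -> L2r (fun x => - f x).
Proof.
by move=> /(L2rZ (-1)); under eq_fun do rewrite mulN1r.
Qed.

Lemma L2rB f g : L2r f -> L2r g -> L2r (fun x => f x - g x).
Proof. by move=> Lf Lg; exact: (L2rD Lf (L2rN Lg)). Qed.

Lemma L2r_le f g : measurable_fun I01 f -> L2r g ->
  (forall x, 0 <= x <= 1 -> `|f x| <= `|g x|) -> L2r f.
Proof.
move=> mf [mg g2] fg; split=> //.
apply: (@le_integrable_real (fun x => f x ^+ 2) _ _ _ g2).
  exact: measurable_funX.
by move=> x x01; rewrite normrX -[leRHS]real_normK ?num_real// lerXn2r ?nnegrE// fg.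
Qed.

Lemma L2r_cst (c : R) : L2r (fun=> c).
Proof.
split; first exact: measurable_cst.
apply: (@continuous_compact_integrable R (fun=> c ^+ 2) I01).
  exact: segment_compact.
exact: cst_continuous.
Qed.

Lemma L2r_bounded (M : R) f : measurable_fun I01 f ->
  (forall x, 0 <= x <= 1 -> `|f x| <= M) -> L2r f.
Proof.
move=> mf fM; apply: (L2r_le mf (L2r_cst M)) => x x01.
exact: le_trans (fM _ x01) (ler_norm _).
Qed.

Lemma L2r_integrable f : L2r f -> mu.-integrable I01 (EFin \o f).
Proof.
move=> Lf; have := L2r_mul Lf (L2r_cst 1).
by apply: eq_integrable => // x _ /=; rewrite mulr1.
Qed.

Lemma L2r_continuous f : {within I01, continuous f} -> L2r f.
Proof.
move=> cf; split; first exact: subspace_continuous_measurable_fun.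
apply: (@continuous_compact_integrable R (fun x => f x ^+ 2) I01).
  exact: segment_compact.
move=> x; apply: (@continuous_comp (subspace I01) R R f (fun y => y ^+ 2)).
  exact: cf.
exact: exprn_continuous.
Qed.

Definition C2c f := (exists f1 f2, C2 f f1 f2) /\
  exists a b : R, [/\ 0 < a, b < 1 & forall x, ~~ (a <= x <= b) -> f x = 0].

(** The function rises after the larger of a and 0 and falls before 1. As h tends to 0 it tends to
    the indicator of ]a, +oo[ on ]0, 1[, while for each h its support stays inside ]0, 1[. *)
Lemma ray_approx (a h : R) : 0 < h -> exists f, [/\ C2c f,
  forall x, `|f x| <= 1, forall x, x <= a -> f x = 0 &
  forall x, Num.max a 0 + 2 * h <= x -> x <= 1 - 2 * h -> f x = 1].
Proof.
move=> h0; pose c := Num.max a 0 + h.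
have ch : c < Num.max a 0 + 2 * h by rewrite /c; lra.
have [s [s1 [s2 [Cs sa sb _ [s01 _ _]]]]] := smooth_step ch.
have dh : 1 - 2 * h < 1 - h by lra.
have [t [t1 [t2 [Ct ta tb _ [t01 _ _]]]]] := smooth_step dh.
exists (fun x => s x * (1 + -1 * t x)); split.
- split.
    do 2 eexists; apply: C2M Cs _; apply: C2D; first exact: C2_cst.
    exact: C2Z Ct.
  exists c, (1 - h); split; rewrite /c.
  + by rewrite ltr_wpDl// le_max lexx orbT.
  + by lra.
  + move=> x; rewrite negb_and -!ltNge => /orP[/ltW/sa->|/ltW/tb->].
      by rewrite mul0r.
    by rewrite mulr1 subrr mulr0.
- move=> x; have /andP[s0 s1'] := s01 x; have /andP[t0 t1'] := t01 x.
  by rewrite ger0_norm mulN1r ?mulr_ge0 ?subr_ge0// mulr_ile1 ?subr_ge0// gerBl.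
- move=> x xa; rewrite sa ?mul0r// (le_trans xa)// /c ler_wpDr ?(ltW h0)//.
  by rewrite le_max lexx.
- by move=> x xs xt; rewrite sb// ta// mulr0 addr0 mulr1.
Qed.

Lemma L2r_indic (E : set R) : measurable E -> L2r \1_E.
Proof.
move=> mE; apply: (@L2r_bounded 1); first exact: measurable_indic.
by move=> x _; rewrite indicE; case: (_ \in _); rewrite ?normr1 ?normr0.
Qed.

(** * Density of compactly supported $C^2$ functions by a monotone class argument *)

Section dense.
Variable V : (R -> R) -> Prop.
Hypothesis VD : forall f g, V f -> V g -> V (fun x => f x + g x).
Hypothesis VZ : forall (c : R) f, V f -> V (fun x => c * f x).
Hypothesis V_dominated : forall (f_ : nat -> R -> R) f g,
  (forall n, V (f_ n)) -> (forall n, L2r (f_ n)) -> L2r f -> L2r g ->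
  (forall x, 0 < x < 1 -> f_ n x @[n --> \oo] --> f x) ->
  (forall n x, 0 <= x <= 1 -> `|f_ n x| <= g x) -> V f.
Hypothesis VC2c : forall f, C2c f -> V f.

Let indic_le1 (E : set R) x : `|\1_E x| <= 1 :> R.
Proof. by rewrite indicE; case: (_ \in _); rewrite ?normr1 ?normr0. Qed.

Let V_ray (a : R) : V \1_(`]a, +oo[).
Proof.
have h0 (n : nat) : 0 < n.+1%:R^-1 :> R by rewrite invr_gt0.
have [f Hf] := choice (fun n => ray_approx a (h0 n)).
apply: (@V_dominated f _ (cst 1)).
- by move=> n; have [/VC2c] := Hf n.
- move=> n; have [[[f1 [f2 C]] _] fb _ _] := Hf n.
  apply: (@L2r_bounded 1) => // .
  apply: measurable_funTS; apply: continuous_measurable_fun.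
  exact: (C2_cont C).1.
- exact: L2r_indic.
- exact: L2r_cst.
- move=> x /andP[x0 x1]; rewrite indicE.
  have [ax|xa] := ltP a x; last first.
    rewrite memNset/=; last by rewrite in_itv/= andbT ltNge xa.
    rewrite (_ : f^~ x = cst 0); first exact: cvg_cst.
    by apply/funext => n; have [_ _ ->] := Hf n.
  rewrite mem_set/=; last by rewrite in_itv/= andbT.
  pose d := Num.min (x - Num.max a 0) (1 - x).
  have d0 : 0 < d by rewrite lt_min !subr_gt0 x1 gt_max ax x0.
  apply: cvg_near_cst; near=> n.
  have : n.+1%:R^-1 < d / 2 by near: n; apply: near_infty_natSinv_lt (PosNum _); rewrite divr_gt0.
  have [dx d1] : d <= x - Num.max a 0 /\ d <= 1 - x by rewrite !ge_min !lexx ?orbT.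
  have [_ _ _ Hfn] := Hf n; move: dx d1 Hfn; clearbody d.
  move: (n.+1%:R^-1) (Num.max a 0) => h m dx d1 Hfn hd.
  by apply: Hfn; lra.
- by move=> n x _; have [_ ->] := Hf n.
Unshelve. all: by end_near. Qed.

Let V_cst1 : V (cst 1).
Proof.
(* A constant sequence: [V_dominated] asks for convergence on ]0, 1[ only, and there this indicator
   is 1. *)
apply: (@V_dominated (fun=> \1_(`]-1, +oo[)) _ (cst 1)) => //.
- by move=> n; exact: L2r_indic.
- exact: L2r_cst.
- exact: L2r_cst.
- move=> x /andP[x0 x1]; rewrite indicE mem_set/=; first exact: cvg_cst.
  by rewrite in_itv/= andbT (lt_trans _ x0)// ltrN10.
Qed.

Let V0 : V (fun=> 0).
Proof. by have := VZ 0 V_cst1; congr V; apply/funext => x; rewrite mul0r. Qed.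

Let V_indic (E : set R) : measurable E -> V \1_E.
Proof.
move=> mE; have {mE} : <<s @RGenOInfty.G R >> E.
  by have /seteqP[GE _] := @RGenOInfty.measurableE R; exact: GE mE.
move: E; apply: (@dynkin_induction _ (measurableTypeR R) (@RGenOInfty.G R)
  (fun E => V \1_E)).
- exact: RGenOInfty.measurableE.
- move=> _ _ [a ->] [b ->]; exists (Num.max a b).
  by apply/seteqP; split => x; rewrite /= !in_itv/= !andbT gt_max => /andP.
- by rewrite indicT; exact: V_cst1.
- by move=> _ [a ->]; exact: V_ray.
- move=> E mE VE; have := VD V_cst1 (VZ (-1) VE).
  congr V; apply/funext => x; rewrite !indicE in_setC.
  by case: (x \in E); rewrite /= ?mulr1 ?mulr0 ?addr0 ?subrr.
- move=> F mF tF VF.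
  pose f_ n x := \sum_(i < n) \1_(F i) x : R.
  have Vf n : V (f_ n).
    elim: n => [|n IH]; rewrite /f_.
      by under eq_fun do rewrite big_ord0.
    by under eq_fun do rewrite big_ord_recr/=; exact: VD.
  have fE n : f_ n = \1_(\big[setU/set0]_(i < n) F i).
    elim: n => [|n IH]; apply/funext => x; rewrite /f_.
      by rewrite !big_ord0 indicE in_set0.
    rewrite !big_ord_recr/= -[X in X + _]/(f_ n x) IH !indicE in_setU.
    case: (boolP (x \in F n)) => [/set_mem xF|]; last by rewrite orbF addr0.
    rewrite memNset ?add0r// -bigcup_mkord => -[i /= ni xFi].
    have /= := tF i n I I (ex_intro _ x (conj xFi xF)).
    by move=> E; rewrite E ltnn in ni.
  have mfn n : measurable (\big[setU/set0]_(i < n) F i : set (measurableTypeR R)).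
    exact: bigsetU_measurable.
  apply: (@V_dominated f_ _ (cst 1)) => //.
  + by move=> n; rewrite fE; exact: (L2r_indic (mfn n)).
  + exact: (L2r_indic (bigcup_measurable (fun k _ => mF k))).
  + exact: L2r_cst.
  + move=> x _; apply: cvg_near_cst.
    have [[i _ Fix]|nF] := pselect ((\bigcup_k F k) x).
      near=> n; have ni : (i < n)%N by near: n; exact: nbhs_infty_gt.
      rewrite fE !indicE !mem_set//; first by exists i.
      by rewrite -bigcup_mkord; exists i.
    near=> n; rewrite fE !indicE !memNset// -bigcup_mkord => -[i _ Fix].
    by apply: nF; exists i.
  + by move=> n x _; rewrite fE.
Unshelve. all: by end_near. Qed.

Let V_sum (I : Type) (r : seq I) (F : I -> R -> R) :
  (forall i, V (F i)) -> V (fun x => \sum_(i <- r) F i x).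
Proof.
move=> VF; elim: r => [|i r IH].
  by under eq_fun do rewrite big_nil.
by under eq_fun do rewrite big_cons; exact: VD.
Qed.

Let V_nneg g : L2r g -> (forall x, 0 <= g x) -> V g.
Proof.
move=> Lg g0; have mg := (measurable_EFinP _ _).2 Lg.1.
pose h := nnsfun_approx measurable_I01 mg.
have ch x : 0 <= x <= 1 -> h n x @[n --> \oo] --> g x.
  move=> x01; have : I01 x by rewrite /= in_itv.
  move=> /(cvg_nnsfun_approx measurable_I01 mg (fun x _ => g0 x)).
  by move=> /fine_cvgP[].
have hg n x : 0 <= x <= 1 -> `|h n x| <= g x.
  move=> x01; rewrite ger0_norm ?fun_ge0//.
  rewrite -(cvg_lim _ (ch _ x01))//; apply: (@nondecreasing_cvgn_le _ (h ^~ x)).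
    by move=> m k mk; have := nd_nnsfun_approx measurable_I01 mg mk; move/lefP.
  by apply/cvg_ex; exists (g x); exact: ch.
apply: (@V_dominated (fun n => h n : R -> R) _ g) => //.
- move=> n; rewrite (_ : (h n : R -> R) = fun x => \sum_(y \in range (h n))
    y * \1_(h n @^-1` [set y]) x); last by apply/funext => x; exact: fimfunE.
  under eq_fun do rewrite fsbig_finite//.
  apply: V_sum => y; apply: VZ.
  by exact: (V_indic (measurable_sfunP (h n) (measurable_set1 y))).
- move=> n; apply: (L2r_le _ Lg); first exact: (measurable_funTS (measurable_funPT (h n))).
  by move=> x x01; rewrite (le_trans (hg n _ x01))// ler_norm.
- by move=> x /andP[x0 x1]; apply: ch; rewrite !ltW.
Qed.

(** Open rays form a pi-system generating the Borel sets, so they yield all indicators, then simple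
    functions, then by monotone approximation the nonnegative functions. Keeping V abstract, closed
    under dominated limits, lets the argument serve every closed subspace of L^2(G). *)
Lemma real_dense f : L2r f -> V f.
Proof.
move=> Lf.
have pos g : L2r g -> V (fun x => Num.max (g x) 0).
  move=> Lg; apply: V_nneg => [|x]; last by rewrite le_max lexx orbT.
  apply: (L2r_le _ Lg) => [|x _].
    by apply: measurable_maxr => //; exact: Lg.1.
  rewrite ger0_norm ?le_max ?lexx ?orbT// ge_max normr_ge0 andbT.
  exact: ler_norm.
have := VD (pos _ Lf) (VZ (-1) (pos _ (L2rN Lf))); congr V; apply/funext => x.
have [f0|f0] := lerP 0 (f x).
  by rewrite max_r ?oppr_le0// mulr0 addr0.
by rewrite max_l ?oppr_ge0 ?ltW// mulN1r opprK add0r.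
Qed.

End dense.
End real_L2.

(** * The spaces L^2(0,1) and l^1(E) *)

Section L2_edge.
Variable R : realType.
Local Notation mu := (@lebesgue_measure R).
Local Notation I01 := [set` `[(0 : R), (1 : R)]].
Local Notation Re := (@complex.Re R).
Local Notation Im := (@complex.Im R).
Implicit Types u v w : R -> R[i].

Lemma ae_imp (P Q : R -> Prop) : (forall x, P x -> Q x) ->
  {ae mu, forall x, P x} -> {ae mu, forall x, Q x}.
Proof. exact: (@filterS _ _ (ae_filter_ringOfSetsType mu) P Q). Qed.

Lemma ae_imp2 (P Q S : R -> Prop) : (forall x, P x -> Q x -> S x) ->
  {ae mu, forall x, P x} -> {ae mu, forall x, Q x} -> {ae mu, forall x, S x}.
Proof. exact: (@filterS2 _ _ (ae_filter_ringOfSetsType mu) P Q S). Qed.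

Lemma Re_add (z w : R[i]) : Re (z + w) = Re z + Re w.
Proof. by case: z w => ? ? []. Qed.
Lemma Im_add (z w : R[i]) : Im (z + w) = Im z + Im w.
Proof. by case: z w => ? ? []. Qed.
Lemma Re_opp (z : R[i]) : Re (- z) = - Re z. Proof. by case: z. Qed.
Lemma Im_opp (z : R[i]) : Im (- z) = - Im z. Proof. by case: z. Qed.
Lemma Re_scale (c : R) (z : R[i]) : Re (real_complex R c * z) = c * Re z.
Proof. by case: z => a b /=; rewrite mul0r subr0. Qed.
Lemma Im_scale (c : R) (z : R[i]) : Im (real_complex R c * z) = c * Im z.
Proof. by case: z => a b /=; rewrite mul0r addr0. Qed.
Lemma Re_conj_mul (z w : R[i]) :
  Re (z * conjc w) = Re z * Re w + Im z * Im w.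
Proof. by case: z w => a b [c d] /=; rewrite mulrN opprK. Qed.
Lemma Im_conj_mul (z w : R[i]) :
  Im (z * conjc w) = Im z * Re w - Re z * Im w.
Proof. by case: z w => a b [c d] /=; ring. Qed.
Lemma complex_ext (z w : R[i]) : Re z = Re w -> Im z = Im w -> z = w.
Proof. by case: z w => ? ? [? ?] /= -> ->. Qed.

Lemma L2_01P u : L2_01 u <-> L2r (Re \o u) /\ L2r (Im \o u).
Proof.
have abs2E x : abs2 (u x) = (Re \o u) x ^+ 2 + (Im \o u) x ^+ 2 by [].
split=> [[mre mim su]|[[mre ire] [mim iim]]].
  have iu : mu.-integrable I01 (EFin \o (fun x => abs2 (u x))).
    apply/integrableP; split.
      apply/measurable_EFinP; apply: measurable_funD; exact: measurable_funX.
    move: su; rewrite /sqnorm01; congr (_ < _)%E; apply: eq_integral => x _.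
    by rewrite /= ger0_norm// addr_ge0 ?sqr_ge0.
  split; split=> //.
    apply: (@le_integrable_real _ _ _ _ _ iu); first exact: measurable_funX.
    by move=> x _; rewrite ger0_norm ?sqr_ge0// lerDl sqr_ge0.
  apply: (@le_integrable_real _ _ _ _ _ iu); first exact: measurable_funX.
  by move=> x _; rewrite ger0_norm ?sqr_ge0// lerDr sqr_ge0.
split=> //.
have /integrableP[_] := integrableD (@measurable_I01 R) ire iim.
congr (_ < _)%E; apply: eq_integral => x _.
by rewrite /= ger0_norm// addr_ge0 ?sqr_ge0.
Qed.

(** The real part of the scalar product of L^2(0,1). *)
Definition ip01 u v : R :=
  \int[mu]_(x in I01) (Re (u x) * Re (v x) + Im (u x) * Im (v x)).

Lemma ip01_integrable u v : L2_01 u -> L2_01 v ->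
  mu.-integrable I01 (EFin \o (fun x => Re (u x) * Re (v x) + Im (u x) * Im (v x))).
Proof.
move=> /L2_01P[ur ui] /L2_01P[vr vi].
exact: (integrableD (@measurable_I01 R) (L2r_mul ur vr) (L2r_mul ui vi)).
Qed.

Lemma L2_01D u v : L2_01 u -> L2_01 v -> L2_01 (fun x => u x + v x).
Proof.
move=> /L2_01P[ur ui] /L2_01P[vr vi]; apply/L2_01P; split.
  by have := L2rD ur vr; congr L2r; apply/funext => x /=; rewrite Re_add.
by have := L2rD ui vi; congr L2r; apply/funext => x /=; rewrite Im_add.
Qed.

Lemma L2_01Z (c : R) u : L2_01 u -> L2_01 (fun x => real_complex R c * u x).
Proof.
move=> /L2_01P[ur ui]; apply/L2_01P; split.
  by have := L2rZ c ur; congr L2r; apply/funext => x /=; rewrite Re_scale.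
by have := L2rZ c ui; congr L2r; apply/funext => x /=; rewrite Im_scale.
Qed.

Lemma ip01C u v : ip01 u v = ip01 v u.
Proof. by apply: eq_Rintegral => x _; rewrite mulrC [X in _ + X]mulrC. Qed.

Lemma ip01D u v w : L2_01 u -> L2_01 v -> L2_01 w ->
  ip01 (fun x => u x + v x) w = ip01 u w + ip01 v w.
Proof.
move=> Lu Lv Lw; rewrite /ip01 -RintegralD//; [|exact: ip01_integrable..].
by apply: eq_Rintegral => x _; rewrite Re_add Im_add; ring.
Qed.

Lemma ip01Z (c : R) u w : L2_01 u -> L2_01 w ->
  ip01 (fun x => real_complex R c * u x) w = c * ip01 u w.
Proof.
move=> Lu Lw; rewrite /ip01 -RintegralZl//; last exact: ip01_integrable.
by apply: eq_Rintegral => x _; rewrite Re_scale Im_scale; ring.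
Qed.

Lemma ip01_ge0 u : 0 <= ip01 u u.
Proof. by apply: Rintegral_ge0 => x _; rewrite -!expr2 addr_ge0 ?sqr_ge0. Qed.

Lemma sqnorm01E u : L2_01 u -> sqnorm01 u = (ip01 u u)%:E.
Proof.
move=> Lu; rewrite /ip01 /Rintegral fineK//.
exact: integrable_fin_num (ip01_integrable Lu Lu).
Qed.

(** Cruder than the Cauchy-Schwarz inequality, but additive, so that it gives a summable majorant
    when taken over all edges. *)
Lemma ip01_le u v : L2_01 u -> L2_01 v -> `|ip01 u v| <= ip01 u u + ip01 v v.
Proof.
move=> Lu Lv; rewrite (le_trans (le_normr_Rintegral _ (ip01_integrable Lu Lv)))//.
rewrite /ip01 -RintegralD//; [|exact: ip01_integrable..].
apply: le_Rintegral => //.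
- exact: integrable_norm (ip01_integrable Lu Lv).
- exact: integrableD (ip01_integrable Lu Lu) (ip01_integrable Lv Lv).
- move=> x _; move: (Re (u x)) (Re (v x)) (Im (u x)) (Im (v x)) => a b c d.
  have := sqr_ge0 (a - b); have := sqr_ge0 (c - d).
  have := sqr_ge0 (a + b); have := sqr_ge0 (c + d).
  by rewrite ler_norml => *; apply/andP; split; nra.
Qed.

Lemma ip01_eq0 u : L2_01 u ->
  ip01 u u = 0 <-> {ae mu, forall x, 0 <= x <= 1 -> u x = 0}.
Proof.
move=> Lu; have iu := ip01_integrable Lu Lu.
have E : (\int[mu]_(x in I01)
    `|(Re (u x) * Re (u x) + Im (u x) * Im (u x))%:E| = (ip01 u u)%:E)%E.
  rewrite -sqnorm01E//; apply: eq_integral => x _.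
  by rewrite gee0_abs ?lee_fin -!expr2// addr_ge0 ?sqr_ge0.
have := ae_eq_integral_abs mu (@measurable_I01 R) (measurable_int _ iu).
rewrite E => -[H1 H2]; split.
  move=> u0; have := H1 (congr1 EFin u0).
  apply: filterS => x + x01; rewrite /= in_itv/= => /(_ x01)[] /eqP.
  rewrite -!expr2 paddr_eq0 ?sqr_ge0// !sqrf_eq0 => /andP[/eqP a /eqP b].
  exact: complex_ext.
move=> u0; apply: EFin_inj; apply: H2.
apply: (ae_imp _ u0) => x + /=; by rewrite in_itv/= => + x01 => /(_ x01)->/=; rewrite mul0r addr0.
Qed.

Lemma ip01_ae u u' v : L2_01 u -> L2_01 u' -> L2_01 v ->
  {ae mu, forall x, 0 <= x <= 1 -> u x = u' x} -> ip01 u v = ip01 u' v.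
Proof.
move=> Lu Lu' Lv uu; rewrite /ip01 /Rintegral; congr fine.
apply: ae_eq_integral => //; try by apply: measurable_int; exact: ip01_integrable.
by apply: (ae_imp _ uu) => x + /=; rewrite in_itv/= => + x01 => /(_ x01)->.
Qed.

End L2_edge.

(** * Absolutely summable real families indexed by the edges *)

Section summation.
Variables (R : realType) (G : graph).
Implicit Types a b u v : edge G -> R.

Definition asum u := summable [set: edge G] (EFin \o u).

Lemma asum_le u v : (forall e, `|u e| <= v e) -> asum v -> asum u.
Proof.
move=> uv; rewrite /asum /summable; apply: le_lt_trans; apply: le_esum => e _.
by rewrite /= lee_fin (le_trans (uv e))// ler_norm.
Qed.

Lemma asumD u v : asum u -> asum v -> asum (fun e => u e + v e).
Proof. exact: summableD. Qed.

Lemma asum_fin a : (forall e, 0 <= a e) -> asum a <->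
  (\esum_(e in [set: edge G]) (a e)%:E < +oo)%E.
Proof.
move=> a0; rewrite /asum /summable.
by under eq_esum do rewrite /= ger0_norm//.
Qed.

Lemma asum_fin_num a : (forall e, 0 <= a e) -> asum a ->
  (\esum_(e in [set: edge G]) (a e)%:E)%E \is a fin_num.
Proof.
move=> a0 /(asum_fin a0) H; rewrite ge0_fin_numE//.
by apply: esum_ge0 => e _; rewrite lee_fin.
Qed.

Definition psum a : R := fine (\esum_(e in [set: edge G]) (a e)%:E)%E.

Lemma psumK a : (forall e, 0 <= a e) -> asum a ->
  (\esum_(e in [set: edge G]) (a e)%:E)%E = (psum a)%:E.
Proof. by move=> a0 sa; rewrite fineK// asum_fin_num. Qed.

Lemma psumD a b : (forall e, 0 <= a e) -> (forall e, 0 <= b e) ->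
  asum a -> asum b -> psum (fun e => a e + b e) = psum a + psum b.
Proof.
move=> a0 b0 sa sb; rewrite /psum; under eq_esum do rewrite EFinD.
by rewrite esumD ?fineD ?asum_fin_num// => e _; rewrite lee_fin.
Qed.

(** The inequality [le], checked on finite partial sums, suffices: applied to c^-1 and the family c
    * a it gives its own converse. *)
Lemma psumZ (c : R) a : 0 <= c -> (forall e, 0 <= a e) -> asum a ->
  asum (fun e => c * a e) /\ psum (fun e => c * a e) = c * psum a.
Proof.
have le (d : R) f : 0 <= d -> (forall e, 0 <= f e) -> asum f ->
    (\esum_(e in [set: edge G]) (d * f e)%:E <= (d * psum f)%:E)%E.
  move=> d0 f0 sf; apply: ge_ereal_sup => _ [A [fA _] <-].
  rewrite fsbig_finite//= sumEFin -mulr_sumr lee_fin ler_wpM2l//.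
  rewrite -lee_fin -psumK// -sumEFin.
  by apply: ereal_sup_ubound; exists A => //; rewrite fsbig_finite.
move=> c0 a0 sa; have ca0 e : 0 <= c * a e by rewrite mulr_ge0.
have sca : asum (fun e => c * a e).
  by apply/(asum_fin ca0); rewrite (le_lt_trans (le _ _ c0 a0 sa))// ltry.
split=> //; apply/eqP; rewrite eq_le -!lee_fin -psumK// le//=.
move: c0; rewrite le_eqVlt => /predU1P[<-|c0].
  by rewrite mul0r esum_ge0// => e _; rewrite mul0r.
rewrite psumK// lee_fin -ler_pdivlMl// -lee_fin.
have ci0 : 0 <= c^-1 by rewrite invr_ge0 ltW.
have := le _ _ ci0 ca0 sca; under eq_esum do rewrite mulKf ?gt_eqF//.
by rewrite psumK.
Qed.

(** [sumE] is defined by the positive and negative parts, which are not additive. That any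
    decomposition into nonnegative summable families gives the same value is what makes it
    linear. *)
Lemma sumE_sub a b : (forall e, 0 <= a e) -> (forall e, 0 <= b e) ->
  asum a -> asum b -> sumE (fun e => a e - b e) = psum a - psum b.
Proof.
move=> a0 b0 sa sb; rewrite /sumE.
rewrite (_ : EFin \o _ = (EFin \o a) \- (EFin \o b))%E; last exact/funext.
rewrite esumB//; try by move=> e _; rewrite lee_fin.
by rewrite fineB ?asum_fin_num.
Qed.

Lemma sumE_psum a : (forall e, 0 <= a e) -> asum a -> sumE a = psum a.
Proof.
move=> a0 sa; have z0 (e : edge G) : 0 <= (0 : R) by [].
have s0 : asum (fun=> 0) by apply: (asum_le _ sa) => e; rewrite normr0.
have := sumE_sub a0 z0 sa s0; under eq_fun do rewrite subr0.
by rewrite /psum [X in _ - fine X]esum1// subr0.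
Qed.

Let pos u e := Num.max (u e) 0.
Let neg u e := Num.max (- u e) 0.

Let pos0 u e : 0 <= pos u e. Proof. by rewrite le_max lexx orbT. Qed.
Let neg0 u e : 0 <= neg u e. Proof. by rewrite le_max lexx orbT. Qed.

Let posneg u e : u e = pos u e - neg u e.
Proof.
rewrite /pos /neg; have [u0|u0] := lerP 0 (u e).
  by rewrite max_r ?oppr_le0// subr0.
by rewrite max_l ?oppr_ge0 ?ltW// opprK add0r.
Qed.

Let asum_pos u : asum u -> asum (pos u).
Proof.
move=> su; have sn : asum (fun e => `|u e|).
  by move: su; rewrite /asum /summable; under [in X in _ -> X]eq_esum do rewrite /= normr_id.
apply: (asum_le _ sn) => e; rewrite ger0_norm// ge_max normr_ge0 andbT.
exact: ler_norm.
Qed.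

Let asum_neg u : asum u -> asum (neg u).
Proof.
move=> su; have : asum (fun e => - u e).
  by move: su; rewrite /asum /summable; under [in X in _ -> X]eq_esum do rewrite /= normrN.
exact: asum_pos.
Qed.

Lemma sumED u v : asum u -> asum v ->
  sumE (fun e => u e + v e) = sumE u + sumE v.
Proof.
move=> su sv.
rewrite (_ : (fun e => _) = fun e => (pos u e + pos v e) - (neg u e + neg v e)).
  rewrite sumE_sub ?psumD//; try (by move=> e; rewrite addr_ge0);
    auto using asumD, asum_pos, asum_neg.
  rewrite [in sumE u](funext (posneg u)) [in sumE v](funext (posneg v)).
  rewrite !sumE_sub//; auto using asum_pos, asum_neg; ring.
by apply/funext => e; rewrite {1}(posneg u e) {1}(posneg v e); ring.
Qed.

Lemma asumZ (c : R) u : asum u -> asum (fun e => c * u e).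
Proof.
move=> su; have sn : asum (fun e => `|u e|).
  by move: su; rewrite /asum /summable; under [in X in _ -> X]eq_esum do rewrite /= normr_id.
have [H _] := psumZ (normr_ge0 c) (fun e => normr_ge0 (u e)) sn.
by apply: asum_le H => e; rewrite normrM.
Qed.

Lemma sumEZ (c : R) u : asum u -> sumE (fun e => c * u e) = c * sumE u.
Proof.
have key (d : R) v : 0 <= d -> asum v -> sumE (fun e => d * v e) = d * sumE v.
  move=> d0 sv; have sp := asum_pos sv; have sn := asum_neg sv.
  rewrite (_ : (fun e => _) = fun e => d * pos v e - d * neg v e); last first.
    by apply/funext => e; rewrite {1}(posneg v e) mulrBr.
  have [s1 e1] := psumZ d0 (pos0 v) sp; have [s2 e2] := psumZ d0 (neg0 v) sn.
  rewrite sumE_sub//; try by move=> e; rewrite mulr_ge0.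
  by rewrite e1 e2 -mulrBr [in sumE v](funext (posneg v)) sumE_sub.
move=> su; have [c0|c0] := lerP 0 c; first exact: key.
have nc0 : 0 <= - c by rewrite oppr_ge0 ltW.
have sN v : asum v -> sumE (fun e => - v e) = - sumE v.
  move=> sv; have sp := asum_pos sv; have sn := asum_neg sv.
  rewrite (_ : (fun e => _) = fun e => neg v e - pos v e); last first.
    by apply/funext => e; rewrite {1}(posneg v e) opprB.
  by rewrite sumE_sub// [in sumE v](funext (posneg v)) sumE_sub// opprB.
rewrite -[RHS]opprK -mulNr -key// -sN; last exact: asumZ.
by congr sumE; apply/funext => e; rewrite mulNr opprK.
Qed.

Lemma esum_single (a : edge G -> \bar R) e0 : (0 <= a e0)%E ->
  (forall e, e != e0 -> a e = 0%E) -> (\esum_(e in [set: edge G]) a e = a e0)%E.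
Proof.
move=> a0 ae; rewrite -(esum_set1 a0) (esum_mkcond [set e0]).
apply: eq_esum => e _; case: (eqVneq e e0) => [->|ee0]; first by rewrite mem_set.
by rewrite memNset ?ae// => /= E; rewrite E eqxx in ee0.
Qed.

Lemma asum_single u e0 : (forall e, e != e0 -> u e = 0) -> asum u.
Proof.
move=> ue; rewrite /asum /summable (@esum_single _ e0) ?ltry//.
by move=> e /ue /= ->; rewrite normr0.
Qed.

Lemma sumE_single u e0 : (forall e, e != e0 -> u e = 0) -> sumE u = u e0.
Proof.
move=> ue; rewrite {1}(funext (posneg u)) sumE_sub//;
  [|exact/asum_pos/(asum_single ue)|exact/asum_neg/(asum_single ue)].
rewrite /psum !(@esum_single _ e0) /=; first by rewrite -posneg.
- by rewrite lee_fin.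
- by move=> e /ue; rewrite /neg => ->; rewrite oppr0 maxxx.
- by rewrite lee_fin.
- by move=> e /ue; rewrite /pos => ->; rewrite maxxx.
Qed.

End summation.

(** * The space L^2(G) *)

Section edge_fun_lmod.
Variables (R : realType) (G : graph).

HB.instance Definition _ :=
  GRing.Zmodule.copy (edge_fun R G) (edge G -> R -> R[i]).

Definition edge_scale (c : R) (f : edge_fun R G) : edge_fun R G :=
  scaleF (real_complex R c) f.

Let edge_scaleA (a b : R) (f : edge_fun R G) :
  edge_scale a (edge_scale b f) = edge_scale (a * b) f.
Proof.
by apply/funext => e; apply/funext => x; rewrite /edge_scale /scaleF mulrA -rmorphM.
Qed.

Let edge_scale1 : left_id 1 edge_scale.
Proof.
by move=> f; apply/funext => e; apply/funext => x; rewrite /edge_scale /scaleF rmorph1 mul1r.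
Qed.

Let edge_scaleDr : right_distributive edge_scale +%R.
Proof.
move=> c f g; apply/funext => e; apply/funext => x.
exact: (mulrDr (real_complex R c) (f e x) (g e x)).
Qed.

Let edge_scaleDl (f : edge_fun R G) : {morph edge_scale^~ f : a b / a + b}.
Proof.
move=> a b; apply/funext => e; apply/funext => x.
by rewrite /edge_scale /scaleF rmorphD mulrDl.
Qed.

HB.instance Definition _ := GRing.Zmodule_isLmodule.Build R (edge_fun R G)
  edge_scaleA edge_scale1 edge_scaleDr edge_scaleDl.

End edge_fun_lmod.

Section L2_graph.
Variables (R : realType) (G : graph).
Local Notation mu := (@lebesgue_measure R).
Local Notation I01 := [set` `[(0 : R), (1 : R)]].
Local Notation Re := (@complex.Re R).
Local Notation Im := (@complex.Im R).
Local Notation F := (edge_fun R G).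
Implicit Types f g h : F.

Lemma addFE f g e x : (f + g) e x = f e x + g e x. Proof. by []. Qed.
Lemma subFE f g e x : (f - g) e x = f e x - g e x. Proof. by []. Qed.
Lemma scaleFE (c : R) f e x : (c *: f) e x = real_complex R c * f e x.
Proof. by []. Qed.

Definition ipF f g : R := sumE (fun e => ip01 (f e) (g e)).

Lemma Re_dotL2 f g : Re (dotL2 f g) = ipF f g.
Proof.
rewrite /dotL2/=; congr sumE; apply/funext => e; apply: eq_Rintegral => x _.
exact: Re_conj_mul.
Qed.

Lemma L2E f : L2 f <->
  (forall e, L2_01 (f e)) /\ asum (fun e => ip01 (f e) (f e)).
Proof.
split=> -[Lf sf]; split=> //.
  apply/asum_fin => [e|]; first exact: ip01_ge0.
  by move: sf; rewrite /sqnormL2; under eq_esum do rewrite sqnorm01E//.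
move/asum_fin : sf => /(_ (fun e => ip01_ge0 (f e))).
by rewrite /sqnormL2; under [in X in _ -> X]eq_esum do rewrite sqnorm01E//.
Qed.

Lemma ip01_asum f g : L2 f -> L2 g -> asum (fun e => ip01 (f e) (g e)).
Proof.
move=> /L2E[Lf sf] /L2E[Lg sg]; apply: asum_le (asumD sf sg) => e.
exact: ip01_le.
Qed.

Lemma L2_semi_inner : semi_inner (@L2 R G) ipF.
Proof.
split.
- move=> f g /L2E[Lf sf] /L2E[Lg sg]; apply/L2E; split.
    by move=> e; exact: L2_01D.
  apply: asum_le (asumZ 3 (asumD sf sg)) => e.
  have ee := ip01D (Lf e) (Lg e) (L2_01D (Lf e) (Lg e)).
  rewrite ger0_norm ?ip01_ge0// ee ip01C ip01D// [X in _ + X]ip01C ip01D//.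
  have := le_trans (ler_norm _) (ip01_le (Lf e) (Lg e)).
  by rewrite [ip01 (g e) (f e)]ip01C; lra.
- move=> c f /L2E[Lf sf]; apply/L2E; split.
    by move=> e; exact: L2_01Z.
  apply: asum_le (asumZ (c ^+ 2) sf) => e; rewrite ger0_norm ?ip01_ge0//.
  rewrite ip01Z//; last exact: L2_01Z.
  by rewrite ip01C ip01Z// mulrA.
- by move=> f g _ _; congr sumE; apply/funext => e; exact: ip01C.
- move=> f g h Lf Lg Lh; rewrite /ipF -sumED; [|exact: ip01_asum..].
  move/L2E : Lf => [Lf _]; move/L2E : Lg => [Lg _]; move/L2E : Lh => [Lh _].
  by congr sumE; apply/funext => e; exact: ip01D.
- move=> c f h Lf Lh; rewrite /ipF -sumEZ; last exact: ip01_asum.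
  move/L2E : Lf => [Lf _]; move/L2E : Lh => [Lh _].
  by congr sumE; apply/funext => e; exact: ip01Z.
- move=> f Lf; rewrite /ipF sumE_psum; last exact: ip01_asum.
    by apply/fine_ge0/esum_ge0 => e _; rewrite lee_fin ip01_ge0.
  by move=> e; exact: ip01_ge0.
Qed.

Local Notation N := (snorm ipF).
Local Notation P := L2_semi_inner.

Lemma ipF_psum f : L2 f -> ipF f f = psum (fun e => ip01 (f e) (f e)).
Proof.
by move=> Lf; apply: sumE_psum; [move=> e; exact: ip01_ge0|exact: ip01_asum].
Qed.

Lemma normL2E f : L2 f -> normL2 f = N f.
Proof.
move=> Lf; rewrite /normL2 /snorm ipF_psum//; congr (Num.sqrt (fine _)).
by apply: eq_esum => e _; rewrite sqnorm01E//; case: Lf.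
Qed.

Lemma ip01_le_ipF f e : L2 f -> ip01 (f e) (f e) <= ipF f f.
Proof.
move=> Lf; rewrite ipF_psum// -lee_fin -psumK//; last 2 first.
- by move=> e'; exact: ip01_ge0.
- exact: ip01_asum.
rewrite -(@esum_set1 _ _ e (fun e => (ip01 (f e) (f e))%:E)); last first.
  by rewrite lee_fin ip01_ge0.
rewrite esum_mkcond; apply: le_esum => e' _.
by case: ifP => _//; rewrite lee_fin ip01_ge0.
Qed.

Lemma snorm0_eqL2 f : L2 f -> N f = 0 <-> eqL2 f (fun _ _ => 0).
Proof.
move=> Lf; have [Lf1 _] := Lf; split=> [f0 e|f0].
  apply/ip01_eq0 => //; apply/eqP; rewrite eq_le ip01_ge0 andbT.
  by rewrite (le_trans (ip01_le_ipF e Lf))// -(snorm_sq P Lf) f0 expr0n.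
rewrite /snorm (_ : ipF f f = 0) ?sqrtr0//.
rewrite /ipF (_ : (fun e => _) = fun=> 0).
  rewrite sumE_psum//; last by have := asumZ 0 (ip01_asum Lf Lf);
    under eq_fun do rewrite mul0r.
  by rewrite /psum esum1.
by apply/funext => e; apply/ip01_eq0.
Qed.

Lemma eqL2_snorm f g : L2 f -> L2 g -> eqL2 f g <-> N (f - g) = 0.
Proof.
move=> Lf Lg; have Lfg := si_B P Lf Lg; split.
  move=> fg; apply/(snorm0_eqL2 Lfg) => e; apply: ae_imp (fg e) => x fgx x01.
  by rewrite subFE fgx// subrr.
move=> /(snorm0_eqL2 Lfg) fg e; apply: ae_imp (fg e) => x fgx x01.
by apply/eqP; rewrite -subr_eq0 -subFE; apply/eqP; exact: fgx.
Qed.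

Lemma ae_interior (Q : R -> Prop) : (forall x, 0 < x < 1 -> Q x) ->
  {ae mu, forall x, 0 <= x <= 1 -> Q x}.
Proof.
move=> HQ; have N01 : mu.-negligible ([set 0] `|` [set 1] : set R).
  apply: negligibleU; (eexists; split; last exact: subset_refl).
  - exact: measurable_set1.
  - exact: lebesgue_measure_set1.
  - exact: measurable_set1.
  - exact: lebesgue_measure_set1.
apply: negligibleS N01.
move=> x /= nQ; apply: contrapT => /not_orP[x0 x1]; apply: nQ => /andP[x0' x1'].
by apply: HQ; rewrite !lt_neqAle x0' x1' !andbT eq_sym; apply/andP; split; apply/eqP.
Qed.

Definition emb (e0 : edge G) (u : R -> R[i]) : F :=
  fun e => if e == e0 then u else fun=> 0.

Lemma L2_01_0 : L2_01 (fun=> 0 : R[i]).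
Proof. by apply/L2_01P; split; exact: (L2r_cst (0 : R)). Qed.

Lemma ip01_0 u : ip01 (fun=> 0) u = 0 :> R.
Proof.
rewrite /ip01; under eq_Rintegral do rewrite /= !mul0r addr0.
by rewrite Rintegral_cst ?mul0r//; exact: measurable_I01.
Qed.

Lemma L2_emb e0 u : L2_01 u -> L2 (emb e0 u).
Proof.
move=> Lu; apply/L2E; split=> [e|].
  by rewrite /emb; case: ifP => // _; exact: L2_01_0.
by apply: (@asum_single _ _ _ e0) => e /negbTE ee0; rewrite /emb ee0 ip01_0.
Qed.

Lemma ipF_emb e0 u f : ipF (emb e0 u) f = ip01 u (f e0).
Proof.
rewrite /ipF (@sumE_single _ _ _ e0) /emb ?eqxx//.
by move=> e /negbTE ->; rewrite ip01_0.
Qed.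

Lemma embD e0 u v : emb e0 (fun x => u x + v x) = emb e0 u + emb e0 v.
Proof.
apply/funext => e; apply/funext => x; rewrite addFE /emb.
by case: ifP => _ //; rewrite addr0.
Qed.

Lemma embB e0 u v : emb e0 (fun x => u x - v x) = emb e0 u - emb e0 v.
Proof.
apply/funext => e; apply/funext => x; rewrite subFE /emb.
by case: ifP => _ //; rewrite subrr.
Qed.

Lemma embZ e0 (c : R) u :
  emb e0 (fun x => real_complex R c * u x) = c *: emb e0 u.
Proof.
apply/funext => e; apply/funext => x; rewrite scaleFE /emb.
by case: ifP => _ //; rewrite mulr0.
Qed.

(** This is phi for b = false and i phi for b = true. Over the reals the two kinds span all complex
    functions, so that work on an edge reduces to real functions. *)
Definition axis (b : bool) (phi : R -> R) (x : R) : R[i] :=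
  if b then Complex 0 (phi x) else Complex (phi x) 0.

Lemma L2_01_axis b phi : L2r phi -> L2_01 (axis b phi).
Proof.
by move=> Lp; apply/L2_01P; case: b; split=> //; exact: (L2r_cst (0 : R)).
Qed.

Lemma axis0 b : axis b (fun=> 0) = fun=> 0.
Proof. by apply/funext => x; rewrite /axis; case: b. Qed.

Lemma axisD b p q : axis b (fun x => p x + q x) = fun x => axis b p x + axis b q x.
Proof.
by apply/funext => x; apply: complex_ext; rewrite ?Re_add ?Im_add; case: b => /=;
  rewrite ?addr0.
Qed.

Lemma axisZ b (c : R) p :
  axis b (fun x => c * p x) = fun x => real_complex R c * axis b p x.
Proof.
by apply/funext => x; apply: complex_ext; rewrite ?Re_scale ?Im_scale; case: b => /=;
  rewrite ?mulr0.
Qed.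

Lemma ip01_axis b p :
  ip01 (axis b p) (axis b p) = \int[mu]_(x in I01) (p x ^+ 2).
Proof.
apply: eq_Rintegral => x _; rewrite /axis expr2; case: b => /=.
  by rewrite mulr0 add0r.
by rewrite mulr0 addr0.
Qed.

Lemma snorm_emb e0 u : N (emb e0 u) = Num.sqrt (ip01 u u).
Proof. by rewrite /snorm ipF_emb /emb eqxx. Qed.

(** The list s consists of the edges of a finite partial sum missing the total squared norm by less
    than eps^2; the squared norm of the remainder is exactly what is missing. *)
Lemma L2_truncation f (eps : R) : L2 f -> 0 < eps ->
  exists s : seq (edge G), uniq s /\
    L2 (f - \sum_(e <- s) emb e (f e)) /\
    N (f - \sum_(e <- s) emb e (f e)) < eps.
Proof.
move=> Lf eps0; have [Lf1 _] := Lf.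
pose a e := ip01 (f e) (f e).
have a0 e : 0 <= a e by exact: ip01_ge0.
have sa : asum a by exact: ip01_asum.
have e20 : 0 < eps ^+ 2 by rewrite exprn_gt0.
have := @ub_ereal_sup_adherent R
  [set \sum_(x \in A) (a x)%:E | A in fsets [set: edge G]]%E _ e20.
rewrite -/(esum _ _) psumK// => /(_ isT)[_ [A [fA _] <-]].
rewrite fsbig_finite//= sumEFin -EFinB lte_fin => HA.
pose s := finmap.enum_fset (fset_set A); have us : uniq s by exact: finmap.fset_uniq.
exists s; split=> //.
have sumE' e : (\sum_(e0 <- s) emb e0 (f e0)) e = if e \in s then f e else fun=> 0.
  have -> : (\sum_(e0 <- s) emb e0 (f e0)) e = \sum_(e0 <- s) emb e0 (f e0) e.
    elim: s {us HA} => [|e1 s IH]; first by rewrite !big_nil.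
    by rewrite !big_cons -IH.
  case: ifPn => es.
    rewrite (bigD1_seq e)//= /emb eqxx big1 ?addr0// => e1 /negbTE.
    by rewrite eq_sym => ->.
  rewrite big_seq big1// => e1 e1s; rewrite /emb; case: eqP => // ee1.
  by rewrite ee1 e1s in es.
have Ls : L2 (\sum_(e <- s) emb e (f e)).
  elim: s {us HA sumE'} => [|e1 s IH].
    rewrite big_nil (_ : 0 = 0 *: f); last by rewrite scale0r.
    exact: (si_Z P).
  by rewrite big_cons; apply: (si_D P) => //; exact: L2_emb.
have Lfs := si_B P Lf Ls; split=> //.
rewrite -(@ltr_pXn2r _ 2)// ?nnegrE ?snorm_ge0 ?ltW// (snorm_sq P Lfs) ipF_psum//.
have sA e : (e \in s) = (e \in A) by exact: (in_fset_set fA).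
pose b e := if e \in A then a e else 0.
have b0 e : 0 <= b e by rewrite /b; case: ifP.
have sb : asum b.
  by apply: asum_le sa => e; rewrite ger0_norm// /b; case: ifP.
have sab : asum (fun e => a e - b e).
  apply: asum_le sa => e; rewrite ger0_norm /b; case: ifP => _;
    by rewrite ?subrr ?subr0.
have ab0 e : 0 <= a e - b e by rewrite /b; case: ifP => _; rewrite ?subrr ?subr0.
have -> : (fun e => ip01 ((f - \sum_(e <- s) emb e (f e)) e)
    ((f - \sum_(e <- s) emb e (f e)) e)) = fun e => a e - b e.
  apply/funext => e.
  have -> : (f - \sum_(e0 <- s) emb e0 (f e0)) e = f e - (\sum_(e0 <- s) emb e0 (f e0)) e.
    by [].
  rewrite sumE' sA /b; case: ifP => _.
    by rewrite !subrr; exact: ip01_0.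
  by rewrite !subr0.
have pb : psum b = \sum_(e <- s) a e.
  rewrite /psum (_ : (fun e => _) = fun e => if e \in A then (a e)%:E else 0%E).
    rewrite -esum_mkcond esum_fset//; last by move=> e _; rewrite lee_fin.
    by rewrite fsbig_finite//= sumEFin.
  by apply/funext => e; rewrite /b; case: ifP.
have := psumD ab0 b0 sab sb; under eq_fun do rewrite subrK.
by rewrite pb; move: HA; rewrite -/s; lra.
Qed.

Section generation.
Variable W : F -> Prop.
Hypothesis cW : closed_subspace (@L2 R G) ipF W.

Lemma closed_subspace_emb : (forall e u, L2_01 u -> W (emb e u)) ->
  forall f, L2 f -> W f.
Proof.
move=> We f Lf; apply: (cs_closed cW) => // eps eps0.
have [s [_ [Ls Ns]]] := L2_truncation Lf eps0.
exists (\sum_(e <- s) emb e (f e)) => //; split; last first.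
  by have := si_B P Lf Ls; rewrite opprB addrC subrK.
have [Lf1 _] := Lf; elim: s {Ls Ns} => [|e s IH].
  by rewrite big_nil; exact: (cs_0 cW).
by rewrite big_cons; apply: (cs_D cW) => //; exact: We.
Qed.

(** Dominated convergence with a square-integrable bound is convergence in norm, so membership in a
    closed subspace has the closure property that [real_dense] asks for. Real and imaginary parts
    are treated separately. *)
Lemma closed_subspace_dense :
  (forall e b phi, C2c phi -> W (emb e (axis b phi))) ->
  forall f, L2 f -> W f.
Proof.
move=> WC; apply: closed_subspace_emb => e u /L2_01P[ur ui].
have Wb b phi : L2r phi -> W (emb e (axis b phi)).
  move: phi; apply: (@real_dense _ (fun phi => W (emb e (axis b phi)))).
  - by move=> p q Wp Wq; rewrite axisD embD; exact: (cs_D cW).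
  - by move=> c p Wp; rewrite axisZ embZ; exact: (cs_Z cW).
  - move=> p_ p q Wp Lp_ Lp Lq cp pq; apply: (cs_closed cW).
      exact/L2_emb/L2_01_axis.
    move=> eps eps0.
    pose h n x := (p x - p_ n x) ^+ 2.
    have Lh n : L2r (fun x => p x - p_ n x) by exact: L2rB.
    have m0 : measurable_fun I01 (cst 0%E : R -> \bar R) by exact: measurable_cst.
    have mh n : measurable_fun I01 (fun x => (h n x)%:E).
      by apply/measurable_EFinP/measurable_funX; case: (Lh n).
    have ch : {ae mu, forall x, I01 x -> (h n x)%:E @[n --> \oo] --> 0%E}.
      have := ae_interior (Q := fun x => (h n x)%:E @[n --> \oo] --> 0%E).
      move=> /(_ _)H; apply: ae_imp (H _) => [x + |x x01].
        by rewrite /= in_itv.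
      apply: cvg_EFin; first by near=> n.
      rewrite (_ : 0 = (p x - p x) ^+ 2); last by rewrite subrr expr0n.
      apply: (@cvg_comp _ _ _ _ (fun y => y ^+ 2)); last exact: exprn_continuous.
      by apply: cvgB; [exact: cvg_cst|exact: cp].
    have ig : mu.-integrable I01 (fun x => (2 * p x ^+ 2 + 2 * q x ^+ 2)%:E).
      have := integrableD (@measurable_I01 R)
        (integrableZl (@measurable_I01 R) 2 Lp.2)
        (integrableZl (@measurable_I01 R) 2 Lq.2).
      by apply: eq_integrable => //; exact: measurable_I01.
    have dom : {ae mu, forall x n, I01 x ->
        (`|(h n x)%:E| <= (2 * p x ^+ 2 + 2 * q x ^+ 2)%:E)%E}.
      apply/aeW => x n; rewrite /= in_itv/= => x01; rewrite lee_fin.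
      rewrite ger0_norm ?sqr_ge0// /h.
      have : p_ n x ^+ 2 <= q x ^+ 2.
        by rewrite -(real_normK (num_real (p_ n x))) lerXn2r ?nnegrE// ?pq//
          (le_trans _ (pq n _ x01)).
      by have := sqr_ge0 (p x + p_ n x); nra.
    have [_ + _] := dominated_convergence (@measurable_I01 R) mh m0 ch ig dom.
    move=> /fine_cvgP[_ /cvgr0_norm_lt/(_ _ (exprn_gt0 2 eps0))[n _ /(_ n (leqnn n))]].
    rewrite /= => Hn; exists (emb e (axis b (p_ n))).
      by split=> //; exact/L2_emb/L2_01_axis.
    have Lpn := L2_emb e (L2_01_axis b (Lh n)).
    rewrite -embB (_ : (fun x => _ - _) = axis b (fun x => p x - p_ n x)); last first.
      apply/funext => x; apply: complex_ext;
        by rewrite ?Re_add ?Im_add ?Re_opp ?Im_opp; case: b {Lpn Wp} => /=; rewrite ?subrr.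
    rewrite -(@ltr_pXn2r _ 2)// ?nnegrE ?snorm_ge0 ?ltW// (snorm_sq P Lpn).
    rewrite ipF_emb /emb eqxx ip01_axis.
    apply: le_lt_trans Hn; rewrite (le_trans (ler_norm _))// /Rintegral.
    rewrite le_eqVlt; apply/orP; left; apply/eqP; congr (`|fine _|).
    by apply: eq_integral => x _; rewrite subr0 ger0_norm ?sqr_ge0.
  - exact: WC.
have := cs_D cW (Wb false _ ur) (Wb true _ ui); rewrite -embD; congr (W (emb e _)).
apply/funext => x; apply: complex_ext; rewrite ?Re_add ?Im_add /=.
  by rewrite addr0.
by rewrite add0r.
Unshelve. all: by end_near. Qed.

End generation.
End L2_graph.

(** * Sobolev functions on an edge *)

Section sobolev.
Variable R : realType.
Local Notation mu := (@lebesgue_measure R).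
Local Notation I01 := [set` `[(0 : R), (1 : R)]].
Local Notation Re := (@complex.Re R).
Local Notation Im := (@complex.Im R).
Implicit Types (u w : R -> R[i]) (phi a : R -> R) (x y : R).

Lemma is_derive_derive1 (f f1 : R -> R) :
  (forall x, is_derive x 1 f (f1 x)) -> derive1 f = f1.
Proof.
by move=> df; apply/funext => x; rewrite derive1E; have /@derive_val := df x.
Qed.

Lemma test_functionP phi phi1 : (forall x, is_derive x 1 phi (phi1 x)) ->
  continuous phi1 -> (exists c d : R, [/\ 0 < c, d < 1 &
    forall x, ~~ (c <= x <= d) -> phi x = 0]) -> test_function phi.
Proof.
by move=> dphi cphi supp; split=> //; rewrite (is_derive_derive1 dphi).
Qed.

Lemma C2c_test phi : C2c phi -> test_function phi.
Proof.
move=> [[phi1 [phi2 C]] supp]; apply: (test_functionP (C2_f C)) => //.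
exact: (C2_cont C).2.
Qed.

Lemma L2r_cont (f : R -> R) : continuous f -> L2r f.
Proof. by move=> cf; apply: L2r_continuous; exact: continuous_subspaceT. Qed.

Lemma test_L2r phi : test_function phi -> L2r phi /\ L2r (derive1 phi).
Proof.
move=> [dphi cphi _]; split; apply: L2r_cont => //.
by move=> x; apply/differentiable_continuous/derivable1_diffP.
Qed.

(** Multiplication by i, which turns imaginary parts of scalar products into real parts. *)
Definition mulI u : R -> R[i] := fun x => Complex (- Im (u x)) (Re (u x)).

Lemma L2_01_mulI u : L2_01 u -> L2_01 (mulI u).
Proof. by move=> /L2_01P[ur ui]; apply/L2_01P; split=> //; exact: L2rN. Qed.

Lemma Im_conj_ip01 u w :
  \int[mu]_(x in I01) Im (u x * conjc (w x)) = ip01 u (mulI w).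
Proof.
by apply: eq_Rintegral => x _; rewrite Im_conj_mul /=; ring.
Qed.

Lemma weak_derivative_mulI u w : L2_01 u -> L2_01 w ->
  weak_derivative u w -> weak_derivative (mulI u) (mulI w).
Proof.
move=> /L2_01P[ur ui] /L2_01P[wr wi] uw phi Tphi; have [H1 H2] := uw phi Tphi.
split => //=; have [Lp Lp1] := test_L2r Tphi.
have iu := L2r_mul ui Lp1; have iw := L2r_mul wi Lp.
under eq_Rintegral do rewrite mulNr -mulN1r.
under [in RHS]eq_Rintegral do rewrite mulNr -mulN1r.
by rewrite !RintegralZl// H2 !mulN1r.
Qed.

Lemma weak_derivative_unique u w w' : L2_01 w -> L2_01 w' ->
  weak_derivative u w -> weak_derivative u w' ->
  {ae mu, forall x, 0 <= x <= 1 -> w x = w' x}.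
Proof.
(* A graph with one loop transfers the density result from L^2(G) to L^2(0,1): the difference w - w'
   is orthogonal to all compactly supported $C^2$ functions, hence to itself. *)
move=> Lw Lw' uw uw'; pose G := @Graph unit unit id id.
pose h x := w x - w' x.
have Lh : L2_01 h.
  have := L2_01D Lw (L2_01Z (-1) Lw'); congr L2_01; apply/funext => x.
  by rewrite rmorphN1 mulN1r.
have Lk := @L2_emb R G tt _ Lh.
have P := @L2_semi_inner R G.
have cW := closed_orthogonal P Lk.
have dense := closed_subspace_dense cW.
have [|_] := dense _ (emb (G := G) tt h) Lk.
  move=> [] b phi Cphi; have Tphi := C2c_test Cphi.
  have [Lphi _] := test_L2r Tphi.
  split; first exact/L2_emb/L2_01_axis.
  rewrite ipF_emb /emb eqxx.
  have [w1 w2] := uw _ Tphi; have [w1' w2'] := uw' _ Tphi.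
  move/L2_01P : Lw => [wr wi]; move/L2_01P : Lw' => [wr' wi'].
  rewrite /ip01 /axis; case: b => /=.
    rewrite (_ : Rintegral _ _ _ = \int[mu]_(x in I01)
        (Im (w x) * phi x - Im (w' x) * phi x)); last first.
      by apply: eq_Rintegral => x _; rewrite Im_add Im_opp; ring.
    rewrite RintegralB//; try exact: L2r_mul.
    by apply/eqP; rewrite subr_eq0; apply/eqP/oppr_inj; rewrite -w2 -w2'.
  rewrite (_ : Rintegral _ _ _ = \int[mu]_(x in I01)
      (Re (w x) * phi x - Re (w' x) * phi x)); last first.
    by apply: eq_Rintegral => x _; rewrite Re_add Re_opp; ring.
  rewrite RintegralB//; try exact: L2r_mul.
  by apply/eqP; rewrite subr_eq0; apply/eqP/oppr_inj; rewrite -w1 -w1'.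
rewrite ipF_emb /emb eqxx => /(ip01_eq0 Lh); apply: ae_imp => x /[apply] /eqP.
by rewrite subr_eq0 => /eqP.
Qed.

Lemma wderivP u : H1_01 u -> L2_01 (wderiv u) /\ weak_derivative u (wderiv u).
Proof.
move=> [_ ex].
exact: (@xgetPex _ (fun=> 0) [set g | L2_01 g /\ weak_derivative u g] ex). Qed.

Lemma wderiv_ae u g : L2_01 u -> L2_01 g -> weak_derivative u g ->
  {ae mu, forall x, 0 <= x <= 1 -> wderiv u x = g x}.
Proof.
move=> Lu Lg ug; have [|Lw uw] := @wderivP u; first by split=> //; exists g.
exact: weak_derivative_unique uw ug.
Qed.

Lemma weak_derivative_C1 a a1 phi : (forall x, is_derive x 1 a (a1 x)) ->
  continuous a1 -> test_function phi ->
  \int[mu]_(x in I01) (a x * derive1 phi x) = - \int[mu]_(x in I01) (a1 x * phi x).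
Proof.
move=> da ca1 [dphi cphi [c [d [c0 d1 supp]]]].
have ca := is_derive_continuous da.
have cp : continuous phi.
  by move=> x; apply/differentiable_continuous/derivable1_diffP.
have LR (f : R -> R) : (forall x, derivable f x 1) -> continuous f ->
    derivable_oo_LRcontinuous f 0 1.
  move=> df cf; split=> // .
    exact/cvg_at_right_filter/cf.
  exact/cvg_at_left_filter/cf.
rewrite (@Rintegration_by_parts _ a phi a1 (derive1 phi) 0 1)//.
- rewrite !supp; first by rewrite !mulr0 subrr sub0r.
    by rewrite negb_and -!ltNge c0.
  by rewrite negb_and -!ltNge d1 orbT.
- exact: continuous_subspaceT.
- by apply: LR => // x; case: (da x).
- by move=> x _; rewrite (is_derive_derive1 da).
- exact: continuous_subspaceT.
- exact: LR.
Qed.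

Lemma weak_derivative_axis b a a1 : (forall x, is_derive x 1 a (a1 x)) ->
  continuous a1 -> weak_derivative (axis b a) (axis b a1).
Proof.
move=> da ca1 phi Tphi; have H := weak_derivative_C1 da ca1 Tphi.
have z (f g : R -> R) : \int[mu]_(x in I01) (0 * f x) =
    - (\int[mu]_(x in I01) (0 * g x)).
  have i0 (k : R -> R) : \int[mu]_(x in I01) (0 * k x) = 0.
    under eq_Rintegral do rewrite mul0r.
    by rewrite Rintegral_cst ?mul0r//; exact: measurable_I01.
  by rewrite !i0 oppr0.
by case: b; split => //=; exact: z.
Qed.

(** [a1] will be the derivative of a function that is constant near both ends of the edge. Being
    itself a test function, it leaves no boundary term, although u may have nonzero end values. *)
Lemma ip01_axis_parts b a1 u w : test_function a1 -> L2_01 u -> L2_01 w ->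
  weak_derivative u w ->
  ip01 (axis b a1) w = ip01 (axis b (fun x => - derive1 a1 x)) u.
Proof.
move=> Ta1 /L2_01P[ur ui] /L2_01P[wr wi] /(_ _ Ta1)[H1 H2].
have [La1 La2] := test_L2r Ta1.
have key (f g : R -> R) : L2r f ->
    \int[mu]_(x in I01) (f x * derive1 a1 x) =
      - (\int[mu]_(x in I01) (g x * a1 x)) ->
    \int[mu]_(x in I01) (a1 x * g x) =
      \int[mu]_(x in I01) (- derive1 a1 x * f x).
  move=> Lf H; under [RHS]eq_Rintegral do rewrite mulNr -mulN1r.
  rewrite RintegralZl//; last exact: (L2r_mul La2 Lf).
  under [in RHS]eq_Rintegral do rewrite mulrC.
  by rewrite H mulrN mulN1r opprK; apply: eq_Rintegral => x _; rewrite mulrC.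
rewrite /ip01 /axis; case: b => /=.
  under eq_Rintegral do rewrite mul0r add0r.
  by under [in RHS]eq_Rintegral do rewrite mul0r add0r; exact: key.
under eq_Rintegral do rewrite mul0r addr0.
by under [in RHS]eq_Rintegral do rewrite mul0r addr0; exact: key.
Qed.

Lemma continuous_ae_eq (v v' : R -> R) : {within I01, continuous v} ->
  {within I01, continuous v'} ->
  {ae mu, forall x, 0 <= x <= 1 -> v x = v' x} ->
  forall x, 0 <= x <= 1 -> v x = v' x.
Proof.
move=> cv cv' vv x x01; apply: contrapT => nvv.
have c : (fun y => v y - v' y) @ within I01 (nbhs x) --> v x - v' x.
  have Ix : I01 x by rewrite /= in_itv.
  by apply: cvgB; [move/subspace_continuousP : cv|move/subspace_continuousP : cv'];
    apply.
have n0 : 0 < `|v x - v' x| by rewrite normr_gt0 subr_eq0; apply/eqP.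
have /nbhs_normP[e /= e0 He] : \forall y \near x, I01 y -> v y - v' y != 0.
  have H : \forall y \near nbhs x, I01 y ->
      `|v x - v' x - (v y - v' y)| < `|v x - v' x|.
    by move/cvgrPdist_lt : c => /(_ _ n0).
  apply: filterS H => y H Iy.
  by apply: contraTN (H Iy) => /eqP ->; rewrite subr0 ltxx.
have /andP[x0 x1] := x01.
(* The neighbourhood is cut down to [0, 1], since x may be an endpoint; an interval of positive
   length remains. *)
pose c0 := Num.max 0 (x - e); pose d0 := Num.min 1 (x + e).
have cd : c0 < d0.
  by rewrite /c0 /d0 gt_max !lt_min ltr01/=; apply/and3P; split; lra.
have N : mu.-negligible `]c0, d0[%classic.
  apply: negligibleS vv => y /=; rewrite in_itv/= /c0 /d0 gt_max lt_min.
  move=> /andP[/andP[y0 ye] /andP[y1 ye']] H.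
  have y01 : 0 <= y <= 1 by rewrite !ltW.
  have : v y - v' y != 0.
    apply: He; last by rewrite /= in_itv.
    by rewrite /= ltr_distlC; apply/andP; split; lra.
  by rewrite subr_eq0 => /eqP; apply; exact: H.
have mI : measurable (`]c0, d0[%classic : set (measurableTypeR R)).
  exact: measurable_itv.
have : mu `]c0, d0[%classic = 0%E := measure_negligible mI N.
rewrite lebesgue_measure_itv/= lte_fin cd => /eqP.
by rewrite -EFinB eqe subr_eq0 gt_eqF.
Qed.

Lemma has_trace_ae u u' x c : {ae mu, forall y, 0 <= y <= 1 -> u y = u' y} ->
  has_trace u x c -> has_trace u' x c.
Proof.
move=> uu [v [cr ci uv vx]]; exists v; split=> //.
apply: ae_imp2 uu uv => y uy vy y01; rewrite -uy// vy//.
Qed.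

Lemma has_trace_unique u x c c' : 0 <= x <= 1 ->
  has_trace u x c -> has_trace u x c' -> c = c'.
Proof.
move=> x01 [v [cr ci uv <-]] [v' [cr' ci' uv' <-]].
have vv : {ae mu, forall y, 0 <= y <= 1 -> v y = v' y}.
  by apply: ae_imp2 uv uv' => y uy vy y01; rewrite -uy// vy.
apply: complex_ext.
  apply: (continuous_ae_eq cr cr' _ x01).
  by apply: ae_imp vv => y H y01; rewrite H.
apply: (continuous_ae_eq ci ci' _ x01).
by apply: ae_imp vv => y H y01; rewrite H.
Qed.

Lemma has_trace_axis b (a : R -> R) x : continuous a ->
  has_trace (axis b a) x (axis b a x).
Proof.
move=> ca; exists (axis b a); split=> //; last by apply: aeW.
  by case: b; apply: continuous_subspaceT => //= y; exact: cvg_cst.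
by case: b; apply: continuous_subspaceT => //= y; exact: cvg_cst.
Qed.

End sobolev.

(** * Finite spans *)

Section finite_span.
Variables (R : realType) (G : graph).
Implicit Types (v w : vertex G) (e : edge G).

Definition finite_degree v :=
  finite_set [set e : edge G | tail e = v] /\
  finite_set [set e : edge G | head e = v].

Lemma counting_lty (T : choiceType) (A : set T) :
  (counting A < +oo :> \bar R)%E <-> finite_set A.
Proof.
rewrite /counting; case: asboolP => [fA|nfA]; split => //.
by rewrite ltry.
Qed.

Lemma counting_nonneg (T : choiceType) (A : set T) : (0 <= counting A :> \bar R)%E.
Proof. by rewrite /counting; case: ifP; rewrite ?lee_fin ?ler0n ?leey. Qed.

Lemma deg_lty v : (deg R v < +oo)%E <-> finite_degree v.
Proof.
split=> [fv|[/(counting_lty _).2 ft /(counting_lty _).2 fh]].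
  by split; apply/counting_lty; apply: le_lt_trans fv;
    rewrite /deg ?leeDl ?leeDr ?counting_nonneg.
exact: lte_add_pinfty.
Qed.

Lemma finite_spanP e e' : finite_span R e e' <->
  exists v s, edge_path e e' v s /\
    forall w, w \in v :: s -> finite_degree w.
Proof.
rewrite /finite_span/= /edge_dist; split.
  move=> /ereal_inf_lt[_ [v [s [p ->]]] lt_s]; exists v, s; split=> // w ws.
  apply/deg_lty; apply: le_lt_trans lt_s.
  rewrite (big_rem w ws)/= leeDl// sume_ge0// => u _.
  by rewrite /deg adde_ge0// counting_nonneg.
move=> [v [s [p fin]]].
apply: (@le_lt_trans _ _ (\sum_(w <- v :: s) deg R w)%E).
  by apply: ereal_inf_lbound; exists v, s.
rewrite big_seq; apply: lte_sum_pinfty => w /fin.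
by move/deg_lty.
Qed.

(** Such sets link the two implications: restriction to one of them preserves the form domain, and
    the edges almost covered by an invariant ideal form one. *)
Definition node_closed (S : set (edge G)) := forall v e e',
  finite_degree v -> incident v e -> incident v e' -> S e -> S e'.

Lemma node_closedC S : node_closed S -> node_closed (~` S).
Proof. by move=> cS v e e' fv ve ve' nSe Se'; apply: nSe; exact: (cS v e' e). Qed.

Lemma finite_span_closed S e e' : node_closed S -> finite_span R e e' ->
  S e -> S e'.
Proof.
move=> cS /finite_spanP[v [s [[ve le' ps] fin]]].
elim: s v e ve le' ps fin => [|w s IH] v e ve le' ps fin Se.
  by apply: cS Se; [exact: (fin v (mem_head _ _))|exact: ve|exact: le'].
move: ps => /= /andP[/asboolP[e1 vw] ps].
have fv : finite_degree v by apply: fin; rewrite mem_head.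
have Se1 : S e1.
  by apply: (cS v e e1) => //; case: vw => -[? ?]; [left|right].
apply: (IH w e1) => //; first by case: vw => -[? ?]; [right|left].
by move=> u us; apply: fin; rewrite in_cons us orbT.
Qed.

(** The finite span of an edge is empty when both its endpoints have infinite degree; adding e keeps
    the corresponding ideal nonzero. *)
Definition span1 e : set (edge G) := [set e' | e' = e \/ finite_span R e e'].

Lemma finite_span_self v e : finite_degree v -> incident v e ->
  forall e', incident v e' -> finite_span R e e'.
Proof.
move=> fv ve e' ve'; apply/finite_spanP; exists v, [::]; split=> //.
by move=> w; rewrite inE => /eqP->.
Qed.

Lemma span1_closed e : node_closed (span1 e).
Proof.
move=> u e1 e2 fu ue1 ue2 [E|].
  by right; apply: (finite_span_self fu _ ue2); rewrite -E.
move=> /finite_spanP[v [s [[ve le1 ps] fin]]]; right; apply/finite_spanP.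
(* Appending u to the path needs an edge from its last node to u. If the two nodes differ, e1 is
   such an edge; if they coincide, the path already ends at a node of e2. *)
have [lu|lu] := eqVneq (last v s) u.
  by exists v, s; split=> //; split=> //; rewrite lu.
exists v, (rcons s u); split; last first.
  move=> w; rewrite -rcons_cons mem_rcons in_cons => /predU1P[->//|]; exact: fin.
split=> //; first by rewrite last_rcons.
rewrite rcons_path ps/=; apply/asboolP; exists e1.
case: le1 ue1 => a [] b.
- by rewrite -a b eqxx in lu.
- by left.
- by right.
- by rewrite -a b eqxx in lu.
Qed.

Lemma finite_span_reflexive e e' : finite_span R e e' -> finite_span R e e.
Proof.
move=> /finite_spanP[v [s [[ve _ _] fin]]].
by apply: (finite_span_self (v := v)) => //; apply: fin; rewrite mem_head.
Qed.

Lemma finite_span_reflexive_r e e' : finite_span R e e' -> finite_span R e' e'.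
Proof.
move=> /finite_spanP[v [s [[_ le' _] fin]]].
by apply: (finite_span_self (v := last v s)) => //; apply: fin; rewrite mem_last.
Qed.

(** No path is reversed: if e were outside [span1 e1], the complement, again [node_closed], would
    contain everything reachable from e, including e1. That e1 lies in its own span follows from the
    last node of a path from e to e1. *)
Lemma finite_span_one_all e : finite_span R e = setT ->
  forall e', finite_span R e' = setT.
Proof.
move=> eT e1; have all e' : finite_span R e e' by rewrite eT.
have Se : span1 e1 e.
  apply: contrapT => nSe.
  have := finite_span_closed (node_closedC (span1_closed (e:=e1))) (all e1) nSe.
  by apply; left.
apply/seteqP; split=> // e2 _.
have [->|//] := finite_span_closed (span1_closed (e:=e1)) (all e2) Se.
exact: finite_span_reflexive_r (all e1).
Qed.

(* If e is not in its own finite span, then both its endpoints have infinite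
   degree, so there are other edges, none of which is in the finite span. *)
Lemma span1_full e : span1 e = setT -> finite_span R e = setT.
Proof.
move=> eT; suff ee : finite_span R e e.
  apply/seteqP; split=> // e' _; have : span1 e e' by rewrite eT.
  by move=> [->|].
apply: contrapT => nee.
have nfin : ~ finite_degree (tail e).
  by move=> f; apply: nee; apply: (finite_span_self f); left.
apply: nfin; split; apply: (@sub_finite_set _ _ [set e]);
  try exact: finite_set1;
  by move=> e' _; have : span1 e e' by [rewrite eT];
    move=> [->|/finite_span_reflexive/nee].
Qed.

End finite_span.

(** * Traces at nodes of infinite degree *)

Section trace_bound.
Variable R : realType.
Local Notation mu := (@lebesgue_measure R).
Local Notation I01 := [set` `[(0 : R), (1 : R)]].
Local Notation Re := (@complex.Re R).
Local Notation Im := (@complex.Im R).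
Implicit Types (f g : R -> R) (x y : R).

(** Here [s1] is a probability density supported in the interior of [0, 1]. The difference of two
    such steps is a test function, so the weak derivative compares the means of a function for the
    two densities. *)
Definition interior_step (s s1 s2 : R -> R) : Prop :=
  [/\ C2 s s1 s2, forall x, 0 <= s x <= 1, forall x, 0 <= s1 x &
    exists a b : R, [/\ 0 < a, b < 1, forall x, x <= a -> s x = 0 &
      forall x, b <= x -> s x = 1]].

Lemma endpoint_step x0 (d : R) : x0 = 0 \/ x0 = 1 -> 0 < d ->
  exists s s1 s2 : R -> R, interior_step s s1 s2 /\
    forall x, s1 x != 0 -> `|x - x0| < d.
Proof.
(* The transition takes place in [c, 2 c] or its mirror image at 1: d / 4 keeps it within distance d
   of x0, and 1 / 4 keeps it inside ]0, 1[. *)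
move=> x01 d0; pose c := Num.min (d / 4) (1 / 4).
have c0 : 0 < c by rewrite lt_min !divr_gt0.
have [cd c4] : c <= d / 4 /\ c <= 1 / 4 by rewrite !ge_min !lexx orbT.
have step (a b : R) : a < b -> 0 < a -> b < 1 -> `|a - x0| < d -> `|b - x0| < d ->
    exists s s1 s2 : R -> R, interior_step s s1 s2 /\
      forall x, s1 x != 0 -> `|x - x0| < d.
  move=> ab a0 b1 ad bd; have [s [s1 [s2 [C sa sb s10 [s01 s1a s1b]]]]] := smooth_step ab.
  exists s, s1, s2; split; first by split=> //; exists a, b.
  move=> x s1x; have ax : a < x by rewrite ltNge; apply: contra_neqN s1x => /s1a.
  have xb : x < b by rewrite ltNge; apply: contra_neqN s1x => /s1b.
  by move: ad bd; rewrite !ltr_distl => /andP[? ?] /andP[? ?]; apply/andP; split; lra.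
case: x01 step => -> step.
  by apply: (step c (2 * c)); rewrite ?subr0 ?gtr0_norm; lra.
apply: (step (1 - 2 * c) (1 - c)); try lra.
  by rewrite addrAC subrr sub0r normrN gtr0_norm; lra.
by rewrite addrAC subrr sub0r normrN gtr0_norm; lra.
Qed.

Lemma interior_step_test s s1 s2 t t1 t2 :
  interior_step s s1 s2 -> interior_step t t1 t2 ->
  (forall x, is_derive x 1 (fun x => s x - t x) (s1 x - t1 x)) /\
  test_function (fun x => s x - t x).
Proof.
move=> [Cs _ _ [a [b [a0 b1 sa sb]]]] [Ct _ _ [a' [b' [a0' b1' ta tb]]]].
have dst x : is_derive x 1 (fun x => s x - t x) (s1 x - t1 x).
  rewrite -mulN1r (_ : (fun x => _) = fun x => s x + -1 * t x).
    by apply: is_derive_add; [exact: (C2_f Cs)|apply: is_derive_scale; exact: (C2_f Ct)].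
  by apply/funext => y; rewrite mulN1r.
split=> //; apply: (test_functionP dst).
  by move=> x; apply: cvgB; [exact: (C2_cont Cs).2|exact: (C2_cont Ct).2].
exists (Num.min a a'), (Num.max b b'); split.
- by rewrite lt_min a0 a0'.
- by rewrite gt_max b1 b1'.
- move=> x; rewrite negb_and -!ltNge lt_min gt_max => /orP[|] /andP[/ltW h1 /ltW h2].
    by rewrite sa// ta// subrr.
  by rewrite sb// tb// subrr.
Qed.

Lemma le_Rintegral01 f g : mu.-integrable I01 (EFin \o f) ->
  mu.-integrable I01 (EFin \o g) -> (forall x, 0 <= x <= 1 -> f x <= g x) ->
  \int[mu]_(x in I01) f x <= \int[mu]_(x in I01) g x.
Proof.
by move=> mf mg fg; apply: le_Rintegral.
Qed.

Lemma Rintegral_interior_step s s1 s2 : interior_step s s1 s2 ->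
  \int[mu]_(x in I01) s1 x = 1.
Proof.
move=> [Cs _ _ [a [b [a0 b1 sa sb]]]].
have cs := (C2_cont Cs).1; have cs1 := (C2_cont Cs).2.
rewrite /Rintegral (@continuous_FTC2 _ s1 s 0 1)//.
- by rewrite sb ?(ltW b1)// sa ?(ltW a0)// sube0.
- exact: continuous_subspaceT.
- split=> [x _||].
  + by case: (C2_f Cs x).
  + exact/cvg_at_right_filter/cs.
  + exact/cvg_at_left_filter/cs.
- by move=> x _; rewrite (is_derive_derive1 (C2_f Cs)).
Qed.

Lemma RintegralZ01 (k : R) f : mu.-integrable I01 (EFin \o f) ->
  \int[mu]_(x in I01) (k * f x) = k * \int[mu]_(x in I01) f x.
Proof. by move=> If; rewrite RintegralZl. Qed.

Lemma Rintegral_cst01 (c : R) : \int[mu]_(x in I01) (cst c : R -> R) x = c.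
Proof.
transitivity (c * fine (mu I01)); last by rewrite mu_I01 mulr1.
by rewrite Rintegral_cst//; exact: measurable_I01.
Qed.

Lemma sqr_sub_le1 (a b : R) : 0 <= a <= 1 -> 0 <= b <= 1 -> (a - b) ^+ 2 <= 1.
Proof.
move=> /andP[a0 a1] /andP[b0 b1].
have ab : `|a - b| <= 1 by rewrite ler_norml; apply/andP; split; lra.
by rewrite -real_normK ?num_real// expr_le1.
Qed.

Lemma young (lam a b : R) : 0 < lam -> a * b <= lam * a ^+ 2 + lam^-1 * b ^+ 2.
Proof.
move=> lam0; rewrite -subr_ge0.
have -> : lam * a ^+ 2 + lam^-1 * b ^+ 2 - a * b =
    lam^-1 * ((lam * a - b / 2) ^+ 2 + 3 / 4 * b ^+ 2).
  by field; rewrite gt_eqF.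
by rewrite mulr_ge0 ?invr_ge0 ?(ltW lam0)// addr_ge0 ?sqr_ge0// mulr_ge0 ?sqr_ge0.
Qed.

Lemma trace_bound_comb (x A B P Q k C lam eta : R) : x - eta <= A - B ->
  A <= lam * P + k * C -> - B <= lam * Q + k ->
  x <= lam * (P + Q) + (k * C + k) + eta.
Proof. by rewrite mulrDr; lra. Qed.

(** The mean of f with a density [s1] concentrated near x0 approximates the trace. Passing from [s1]
    to a fixed density [t1] costs the integral of g (s - t), where |s - t| <= 1, and [young] bounds
    both terms. Hence K, the integral of t1^2 plus 1, depends neither on x0 nor on the functions,
    and a large [lam] makes K / lam small. *)
Lemma trace_bound : exists K : R, 0 < K /\
  forall (v f g : R -> R) x0, x0 = 0 \/ x0 = 1 ->
  {within I01, continuous v} -> L2r f -> L2r g ->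
  {ae mu, forall x, 0 <= x <= 1 -> f x = v x} ->
  (forall phi, test_function phi -> \int[mu]_(x in I01) (f x * derive1 phi x) =
    - (\int[mu]_(x in I01) (g x * phi x))) ->
  forall lam : R, 0 < lam -> v x0 <=
    lam * (\int[mu]_(x in I01) (f x ^+ 2) + \int[mu]_(x in I01) (g x ^+ 2)) + K / lam.
Proof.
have /smooth_step[t [t1 [t2 [Ct ta tb t10 [t01 _ _]]]]] : 1 / 3 < 2 / 3 :> R by lra.
have It : interior_step t t1 t2.
  by split=> //; exists (1 / 3), (2 / 3); split=> //; lra.
have ct1 := (C2_cont Ct).2; have Lt1 := L2r_cont ct1.
have [K KE] : exists K, K = \int[mu]_(x in I01) (t1 x ^+ 2) + 1 by eexists.
have K0 : 0 < K.
  by rewrite KE ltr_wpDl// Rintegral_ge0// => x _; exact: sqr_ge0.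
exists K; split=> // v f g x0 hx0 cv Lf Lg fv wfg lam lam0.
apply/ler_addgt0Pr => eta eta0.
have x01 : 0 <= x0 <= 1 by case: hx0 => ->; rewrite ?lexx ?ler01.
have [d d0 Hd] : exists2 d : R, 0 < d &
    forall x, 0 <= x <= 1 -> `|x - x0| < d -> v x0 - eta <= v x.
  have Ix : I01 x0 by rewrite /= in_itv.
  have cx : v @ within I01 (nbhs x0) --> v x0 by move/subspace_continuousP : cv; apply.
  have /nbhs_normP[d /= d0 Hd] : \forall y \near nbhs x0, I01 y -> `|v x0 - v y| < eta.
    by move/cvgrPdist_lt : cx => /(_ _ eta0).
  exists d => // x x01' xd; have : `|v x0 - v x| < eta.
    by apply: Hd; rewrite /= ?in_itv//= distrC.
  by rewrite ltr_norml => /andP[_]; lra.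
have [s [s1 [s2 [Is s1d]]]] := endpoint_step hx0 d0.
have [Cs s01 s10 _] := Is; have cs1 := (C2_cont Cs).2.
have Ls1 := L2r_cont cs1.
have [dphi Tphi] := interior_step_test Is It.
have [Lphi _] := test_L2r Tphi.
have Lv : L2r v := L2r_continuous cv.
have E : \int[mu]_(x in I01) (f x * s1 x) =
    \int[mu]_(x in I01) (f x * t1 x) - \int[mu]_(x in I01) (g x * (s x - t x)).
  have := wfg _ Tphi; rewrite (is_derive_derive1 dphi) => <-.
  rewrite -RintegralD//; [|exact: L2r_mul|exact: (L2r_mul Lf (L2rB Ls1 Lt1))].
  by apply: eq_Rintegral => x _; ring.
have Ev : \int[mu]_(x in I01) (f x * s1 x) = \int[mu]_(x in I01) (v x * s1 x).
  rewrite /Rintegral; congr fine; apply: ae_eq_integral; first exact: measurable_I01.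
  - exact: measurable_int (L2r_mul Lf Ls1).
  - exact: measurable_int (L2r_mul Lv Ls1).
  - by apply: (ae_imp _ fv) => x H; rewrite /= in_itv/= => /H ->.
have low : v x0 - eta <= \int[mu]_(x in I01) (v x * s1 x).
  have := RintegralZ01 (v x0 - eta) (L2r_integrable Ls1).
  rewrite (Rintegral_interior_step Is) mulr1 => <-.
  apply: le_Rintegral01.
  - exact: (L2r_integrable (L2rZ _ Ls1)).
  - exact: L2r_mul.
  - move=> x x01'; have [->|s1x] := eqVneq (s1 x) 0; first by rewrite !mulr0.
    by rewrite ler_wpM2r// Hd// s1d.
have up1 : \int[mu]_(x in I01) (f x * t1 x) <=
    lam * \int[mu]_(x in I01) (f x ^+ 2) + lam^-1 * \int[mu]_(x in I01) (t1 x ^+ 2).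
  rewrite -!RintegralZl//; [|exact: Lt1.2|exact: Lf.2].
  have i1 := integrableZl (@measurable_I01 R) lam Lf.2.
  have i2 := integrableZl (@measurable_I01 R) lam^-1 Lt1.2.
  rewrite -RintegralD//; apply: le_Rintegral01; first exact: L2r_mul.
    exact: (integrableD (@measurable_I01 R) i1 i2).
  by move=> x _; exact: young.
have up2 : - (\int[mu]_(x in I01) (g x * (s x - t x))) <=
    lam * \int[mu]_(x in I01) (g x ^+ 2) + lam^-1.
  rewrite -mulN1r.
  have -> : lam^-1 = \int[mu]_(x in I01) (cst lam^-1 : R -> R) x.
    exact/esym/Rintegral_cst01.
  have i1 := integrableZl (@measurable_I01 R) lam Lg.2.
  have i2 := L2r_integrable (L2r_cst lam^-1).
  rewrite -(RintegralZ01 _ (L2r_mul Lg Lphi)) -(RintegralZ01 _ Lg.2).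
  rewrite -RintegralD//.
  apply: le_Rintegral01.
  - by have := integrableZl (@measurable_I01 R) (-1) (L2r_mul Lg Lphi).
  - exact: (integrableD (@measurable_I01 R) i1 i2).
  - move=> x _ /=; rewrite mulN1r -mulrN (le_trans (young _ _ lam0))// lerD2l.
    rewrite -[leRHS]mulr1 ler_pM2l ?invr_gt0// sqrrN.
    exact: sqr_sub_le1.
rewrite -Ev E in low; clear - low up1 up2 KE.
have -> : K / lam = lam^-1 * \int[mu]_(x in I01) (t1 x ^+ 2) + lam^-1.
  by rewrite KE mulrDl mul1r mulrC.
exact: trace_bound_comb low up1 up2.
Qed.

End trace_bound.

Section infinite_degree.
Variables (R : realType) (G : graph).
Local Notation mu := (@lebesgue_measure R).
Local Notation I01 := [set` `[(0 : R), (1 : R)]].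
Local Notation Re := (@complex.Re R).
Local Notation Im := (@complex.Im R).

Lemma asum_infinite (u : edge G -> R) (A : set (edge G)) (c : R) :
  (forall e, 0 <= u e) -> asum u -> 0 < c -> (forall e, A e -> c <= u e) ->
  finite_set A.
Proof.
move=> u0 su c0 cu; apply: contrapT => nfA.
pose n := (Num.truncn (psum u / c)).+1.
have [B BA nB] := infinite_set_fset n nfA.
pose s := finmap.enum_fset B; have us : uniq s := finmap.fset_uniq B.
have : (\sum_(e \in [set` s]) (u e)%:E <= (psum u)%:E)%E.
  rewrite -psumK//; apply: ereal_sup_ubound; exists [set` s] => //.
rewrite -fsbig_seq// sumEFin lee_fin leNgt => /negP; apply.
have : psum u / c < n%:R by rewrite /n; exact: truncnS_gt.
rewrite ltr_pdivrMr// => /lt_le_trans; apply.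
rewrite (@le_trans _ _ (\sum_(e <- s) c))//.
  by rewrite big_const_seq count_predT iter_addr_0 -[leRHS]mulr_natl ler_wpM2r ?ler_nat// ltW.
by rewrite big_seq [leRHS]big_seq ler_sum// => e eB; apply: cu; exact: BA.
Qed.

Lemma half_bound (lam r z : R) : 0 < lam -> r <= lam * z + r / 2 -> r / (2 * lam) <= z.
Proof.
move=> lam0 h; have l2 : 0 < 2 * lam by rewrite mulr_gt0.
by rewrite (ler_pdivrMr _ _ l2) mulrCA [z * lam]mulrC; lra.
Qed.

Lemma trace_norm_bound : exists K : R, 0 < K /\
  forall (u g : R -> R[i]) (x0 : R) (c : R[i]), x0 = 0 \/ x0 = 1 ->
  L2_01 u -> L2_01 g -> weak_derivative u g -> has_trace u x0 c ->
  forall lam : R, 0 < lam ->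
  `|Re c| <= lam * (ip01 u u + ip01 g g) + K / lam /\
  `|Im c| <= lam * (ip01 u u + ip01 g g) + K / lam.
Proof.
have [K [K0 HK]] := trace_bound R; exists K; split=> //.
move=> u g x0 c hx0 Lu Lg ug [v [vr vi uv <-]] lam lam0.
have abs_bound (w f h : R -> R) : {within I01, continuous w} -> L2r f -> L2r h ->
    {ae mu, forall x, 0 <= x <= 1 -> f x = w x} ->
    (forall phi, test_function phi -> \int[mu]_(x in I01) (f x * derive1 phi x) =
      - (\int[mu]_(x in I01) (h x * phi x))) ->
    \int[mu]_(x in I01) (f x ^+ 2) <= ip01 u u ->
    \int[mu]_(x in I01) (h x ^+ 2) <= ip01 g g ->
    `|w x0| <= lam * (ip01 u u + ip01 g g) + K / lam.
  move=> cw Lf Lh fw wk fu hg.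
  have bd (z : R) : z <= lam * (\int[mu]_(x in I01) (f x ^+ 2) +
      \int[mu]_(x in I01) (h x ^+ 2)) + K / lam ->
      z <= lam * (ip01 u u + ip01 g g) + K / lam.
    by move=> /le_trans; apply; rewrite lerD2r ler_wpM2l ?(ltW lam0)// lerD.
  rewrite ler_norml lerNl; apply/andP; split; apply: bd; last first.
    exact: (HK w f h).
  have := @HK (fun x => - w x) (fun x => - f x) (fun x => - h x) x0 hx0 _ _ _ _ _ lam lam0.
  have sqN (p : R -> R) : \int[mu]_(x in I01) ((- p x) ^+ 2) = \int[mu]_(x in I01) (p x ^+ 2).
    by apply: eq_Rintegral => x _; rewrite sqrrN.
  rewrite !sqN; apply.
  - by move=> x; apply: cvgN; exact: cw.
  - exact: L2rN.
  - exact: L2rN.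
  - by apply: ae_imp fw => x H x01; rewrite H.
  - move=> phi Tphi; have [Lp Lp1] := test_L2r Tphi.
    under eq_Rintegral do rewrite mulNr -mulN1r.
    under [in RHS]eq_Rintegral do rewrite mulNr -mulN1r.
    rewrite (RintegralZ01 _ (L2r_mul Lf Lp1)) (RintegralZ01 _ (L2r_mul Lh Lp)).
    by rewrite wk// !mulN1r.
have le_re (z : R -> R[i]) : L2_01 z -> \int[mu]_(x in I01) (Re (z x) ^+ 2) <= ip01 z z.
  move=> Lz; have [zr _] := (L2_01P z).1 Lz.
  apply: le_Rintegral01; [exact: zr.2|exact: ip01_integrable|].
  by move=> x _; rewrite -!expr2 lerDl sqr_ge0.
have le_im (z : R -> R[i]) : L2_01 z -> \int[mu]_(x in I01) (Im (z x) ^+ 2) <= ip01 z z.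
  move=> Lz; have [_ zi] := (L2_01P z).1 Lz.
  apply: le_Rintegral01; [exact: zi.2|exact: ip01_integrable|].
  by move=> x _; rewrite -!expr2 lerDr sqr_ge0.
have [ur ui] := (L2_01P u).1 Lu; have [gr gi] := (L2_01P g).1 Lg.
split.
  apply: (abs_bound _ _ _ vr ur gr _ _ (le_re _ Lu) (le_re _ Lg)).
    by apply: ae_imp uv => x H x01 /=; rewrite H.
  by move=> phi /ug[].
apply: (abs_bound _ _ _ vi ui gi _ _ (le_im _ Lu) (le_im _ Lg)).
  by apply: ae_imp uv => x H x01 /=; rewrite H.
by move=> phi /ug[].
Qed.

(* If d v <> 0, every edge at v carries at least a fixed amount of H^1 energy. *)
Lemma infinite_degree_trace (psi : edge_fun R G) (d : vertex G -> R[i]) v :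
  H1 psi ->
  (forall e, has_trace (psi e) 0 (d (tail e)) /\ has_trace (psi e) 1 (d (head e))) ->
  ~ finite_degree v -> d v = 0.
Proof.
move=> [Hpsi Lpsi Ldpsi] tr nfv.
have [K [K0 HK]] := trace_norm_bound.
pose u e := ip01 (psi e) (psi e) + ip01 (derivF psi e) (derivF psi e).
have u0 e : 0 <= u e by rewrite addr_ge0 ?ip01_ge0.
have su : asum u by apply: asumD; exact: ip01_asum.
have bd e x0 : x0 = 0 \/ x0 = 1 -> has_trace (psi e) x0 (d v) ->
    forall lam : R, 0 < lam ->
    `|Re (d v)| <= lam * u e + K / lam /\ `|Im (d v)| <= lam * u e + K / lam.
  move=> hx0 tre; have [Ldw wd] := wderivP (Hpsi e).
  by apply: (HK _ _ x0) => //; case: (Hpsi e).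
have key (r : R) : 0 <= r -> (forall e x0, x0 = 0 \/ x0 = 1 ->
    has_trace (psi e) x0 (d v) -> forall lam : R, 0 < lam -> r <= lam * u e + K / lam) ->
    r = 0.
  rewrite le_eqVlt => /predU1P[//|r0] Hr; exfalso; apply: nfv.
  (* This choice makes K / lam equal to r / 2, leaving u e >= r / (2 lam) > 0 on every edge at v; a
     summable family allows this on finitely many edges only. *)
  pose lam := 2 * K / r; have lam0 : 0 < lam by rewrite divr_gt0// mulr_gt0.
  have c0 : 0 < r / (2 * lam) by rewrite divr_gt0// mulr_gt0.
  have low e x0 : x0 = 0 \/ x0 = 1 -> has_trace (psi e) x0 (d v) -> r / (2 * lam) <= u e.
    move=> hx0 /(Hr _ _ hx0)/(_ _ lam0).
    have -> : K / lam = r / 2 by rewrite /lam; field; rewrite !gt_eqF.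
    exact: half_bound.
  split; apply: (asum_infinite u0 su c0) => e /= ev.
    by apply: (low e 0); [left|rewrite -ev; case: (tr e)].
  by apply: (low e 1); [right|rewrite -ev; case: (tr e)].
apply: complex_ext => /=; apply/eqP; rewrite -normr_eq0; apply/eqP; apply: key => // e x0 hx0 tre lam lam0.
  by case: (bd _ _ hx0 tre _ lam0).
by case: (bd _ _ hx0 tre _ lam0).
Qed.

End infinite_degree.

(** * The semigroup associated with the form *)

#[local] Opaque snorm ipF.

Section form_semigroup.
Variables (R : realType) (G : graph).
Local Notation mu := (@lebesgue_measure R).
Local Notation I01 := [set` `[(0 : R), (1 : R)]].
Local Notation Re := (@complex.Re R).
Local Notation Im := (@complex.Im R).
Local Notation F := (edge_fun R G).
Local Notation N := (snorm (@ipF R G)).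
Local Notation P := (@L2_semi_inner R G).
Implicit Types f g h psi phi : F.

Lemma asum_finite (u : edge G -> R) (A : set (edge G)) : finite_set A ->
  (forall e, ~ A e -> u e = 0) -> asum u.
Proof.
move=> fA u0; rewrite /asum /summable.
rewrite (_ : esum _ _ = \esum_(e in A) `|(u e)%:E|)%E.
  by rewrite esum_fset// fsbig_finite//= sumEFin ltry.
rewrite [RHS]esum_mkcond; apply: eq_esum => e _ /=.
by case: ifPn => // /negP; rewrite inE => /u0 ->; rewrite normr0.
Qed.

Lemma L2_finite f (A : set (edge G)) : finite_set A ->
  (forall e, L2_01 (f e)) -> (forall e, ~ A e -> f e = fun=> 0) -> L2 f.
Proof.
move=> fA Lf f0; apply/L2E; split=> //.
by apply: (asum_finite fA) => e /f0 ->; exact: ip01_0.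
Qed.

Lemma dotL2_ip01 f g : dotL2 f g =
  Complex (sumE (fun e => ip01 (f e) (g e)))
          (sumE (fun e => ip01 (f e) (mulI (g e)))).
Proof.
rewrite /dotL2; congr Complex; congr sumE; apply/funext => e; last first.
  exact: Im_conj_ip01.
by apply: eq_Rintegral => x _; exact: Re_conj_mul.
Qed.

(* Functions that are constant near the nodes satisfy the Kirchhoff condition
   automatically. *)
Lemma smooth_form_operator b (a a1 a2 : edge G -> R -> R)
    (d : vertex G -> R[i]) (A : set (edge G)) :
  finite_set A ->
  (forall e, ~ A e -> [/\ a e = fun=> 0, a1 e = fun=> 0 & a2 e = fun=> 0]) ->
  (forall e, C2 (a e) (a1 e) (a2 e)) ->
  (forall e, test_function (a1 e)) ->
  (\esum_(v in [set: vertex G]) (abs2 (d v))%:E < +oo)%E ->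
  (forall e, axis b (a e) 0 = d (tail e) /\ axis b (a e) 1 = d (head e)) ->
  form_operator (fun e => axis b (a e)) (fun e => axis b (a2 e)).
Proof.
move=> fA supp C2a Ta1 sd tr; set psi : F := fun e => axis b (a e).
have La (c : edge G -> R -> R) : (forall e, continuous (c e)) ->
    forall e, L2_01 (axis b (c e)).
  by move=> cc e; apply/L2_01_axis/L2r_cont.
have ca e : continuous (a e) by exact: (C2_cont (C2a e)).1.
have ca1 e : continuous (a1 e) by exact: (C2_cont (C2a e)).2.
have ca2 e : continuous (a2 e) by exact: (C2_f2 (C2a e)).
have wd e : weak_derivative (psi e) (axis b (a1 e)).
  exact: weak_derivative_axis (C2_f (C2a e)) (ca1 e).
have Hpsi e : H1_01 (psi e).
  by split; [exact: La|exists (axis b (a1 e)); split=> //; exact: La].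
have wae e : {ae mu, forall x, 0 <= x <= 1 -> wderiv (psi e) x = axis b (a1 e) x}.
  by apply: wderiv_ae => //; exact: La.
have Lw e : L2_01 (wderiv (psi e)) by case: (wderivP (Hpsi e)).
have Lpsi : L2 psi.
  by apply: (L2_finite fA) => [|e /supp[ae _ _]]; [exact: La|rewrite /psi ae axis0].
have Ldpsi : L2 (derivF psi).
  apply/L2E; split=> //; apply: (asum_finite fA) => e /supp[_ a1e _].
  apply/(ip01_eq0 (Lw e)); apply: ae_imp (wae e) => x + x01 => /(_ x01) ->.
  by rewrite a1e axis0.
split.
  split; first by split.
  exists d; split=> // e; have [<- <-] := tr e.
  by split; apply: has_trace_axis.
exists (fun e => axis b (fun x => - a2 e x)); split.
- apply: (L2_finite fA) => [|e /supp[_ _ ->]].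
    by apply: La => e x; apply: cvgN; exact: ca2.
  by rewrite -(axis0 R b); congr axis; apply/funext => x; rewrite oppr0.
- move=> phi [[Hphi Lphi Ldphi] _]; rewrite /form !dotL2_ip01.
  have parts e u w : L2_01 u -> L2_01 w -> weak_derivative u w ->
      ip01 (derivF psi e) w = ip01 (axis b (fun x => - a2 e x)) u.
    move=> Lu Lw' uw; rewrite (ip01_ae _ _ _ (wae e))//; last exact: La.
    rewrite (ip01_axis_parts b (Ta1 e) Lu Lw' uw).
    by rewrite (is_derive_derive1 (C2_f1 (C2a e))).
  congr Complex; congr sumE; apply/funext => e;
    have [Lw' ww] := wderivP (Hphi e); have [Lu _] := Hphi e.
    exact: parts.
  by apply: parts; [exact: L2_01_mulI|exact: L2_01_mulI|exact: weak_derivative_mulI].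
- move=> e; apply: aeW => x _; rewrite /oppF; apply: complex_ext;
    by rewrite ?Re_opp ?Im_opp /axis; case: b {tr psi La wd Hpsi wae Lw Lpsi Ldpsi} => /=; rewrite ?opprK ?oppr0.
Qed.

Lemma test_function0 : test_function (fun=> 0 : R).
Proof.
have dz (x : R) : is_derive x 1 (fun=> 0 : R) 0 := is_derive_cst 0 x 1.
apply: (test_functionP dz) => [x|]; first exact: cvg_cst.
by exists (1 / 4), (1 / 2); split=> //; lra.
Qed.

Lemma C2c_form_operator e0 b (phi : R -> R) : C2c phi ->
  exists2 g, L2 g & form_operator (emb e0 (axis b phi) : F) g.
Proof.
move=> [[phi1 [phi2 C]] [c [d [c0 d1 supp]]]].
pose sel (f : R -> R) (e : edge G) : R -> R := if e == e0 then f else fun=> 0.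
have embE (p : R -> R) : emb e0 (axis b p) = fun e => axis b (sel p e).
  by apply/funext => e; rewrite /emb /sel; case: ifP => _; rewrite ?axis0.
have supp1 (x : R) : ~~ (c <= x <= d) -> phi1 x = 0.
  move=> xcd; have := C2_f C x => /@derive_val <-.
  have : is_derive x 1 phi 0.
    apply: (near_eq_is_derive _ (is_derive_cst 0 x 1)).
    move: xcd; rewrite negb_and -!ltNge => /orP[xc|dx]; near=> y; symmetry;
      apply: supp; rewrite negb_and -!ltNge.
      by apply/orP; left; near: y; exact: lt_nbhsl.
    by apply/orP; right; near: y; exact: lt_nbhsr.
  by move=> /@derive_val.
have Tphi1 : test_function phi1.
  apply: (test_functionP (C2_f1 C) (C2_f2 C)); exists c, d; split=> //.
exists (emb e0 (axis b phi2)).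
  by apply: L2_emb; apply: L2_01_axis; apply: L2r_cont; exact: (C2_f2 C).
rewrite !embE; apply: (@smooth_form_operator b _ (sel phi1) _ (fun=> 0) [set e0]).
- exact: finite_set1.
- move=> e /eqP/negbTE ee0.
  by rewrite /sel ee0.
- by move=> e; rewrite /sel; case: ifP => // _; exact: C2_cst.
- by move=> e; rewrite /sel; case: ifP => // _; exact: test_function0.
- by rewrite esum1 ?ltry// => v _; rewrite /abs2/= expr0n addr0.
- move=> e; have z0 : phi 0 = 0 by apply: supp; rewrite negb_and -!ltNge c0.
  have z1 : phi 1 = 0 by apply: supp; rewrite negb_and -!ltNge d1 orbT.
  have zz (p : R) : phi p = 0 -> axis b (sel phi e) p = 0.
    rewrite /sel; case: (e == e0) => p0; last by rewrite axis0.
    by apply: complex_ext; rewrite /axis p0; case: ifP.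
  by split; exact: zz.
Unshelve. all: by end_near. Qed.

Variable T : R -> F -> F.
Hypothesis T_semigroup : generates (@form_operator R G) T.

Lemma L2_snorm_cvg (u : R -> F) : (forall t, 0 < t -> L2 (u t)) ->
  (normL2 (u t) @[t --> 0^'+] --> (0 : R)) <-> (N (u t) @[t --> 0^'+] --> (0 : R)).
Proof.
move=> Lu; have E : {near (0 : R)^'+, (fun t => normL2 (u t)) =1 (fun t => N (u t))}.
  near=> t; apply: normL2E; apply: Lu; near: t; exact: nbhs_right_gt.
split; apply: cvg_trans; apply: near_eq_cvg; near=> t; [|symmetry];
  by near: t.
Unshelve. all: by end_near. Qed.

Lemma form_semigroup : semigroup (@L2 R G) (@ipF R G) T.
Proof.
have [ST _] := T_semigroup; split.
- exact: semigroup_L2 ST.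
- move=> t c f g t0 Lf Lg; apply/eqL2_snorm.
  + exact: (semigroup_L2 ST t0 (si_D P (si_Z P _ Lf) Lg)).
  + exact: (si_D P (si_Z P _ (semigroup_L2 ST t0 Lf)) (semigroup_L2 ST t0 Lg)).
  + exact: semigroup_linear ST _ _ _ _ t0 Lf Lg.
- move=> t t0; have [M TM] := semigroup_bounded ST t0; exists M => f Lf.
  by rewrite -!normL2E//; [exact: TM|exact: semigroup_L2 ST _ _ t0 Lf].
- move=> f Lf; apply/eqL2_snorm => //; last exact: semigroup0 ST _ Lf.
  exact: semigroup_L2 ST _ _ (lexx 0) Lf.
- move=> s t f s0 t0 Lf; have Lt := semigroup_L2 ST t0 Lf.
  apply/eqL2_snorm; last exact: semigroupD ST _ _ _ s0 t0 Lf.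
    exact: semigroup_L2 ST _ _ (addr_ge0 s0 t0) Lf.
  exact: semigroup_L2 ST _ _ s0 Lt.
- move=> f Lf; apply/L2_snorm_cvg => [t t0|]; last exact: semigroup_cvg ST _ Lf.
  by apply: (si_B P) => //; exact: semigroup_L2 ST _ _ (ltW t0) Lf.
Qed.

Lemma form_generatorP f g : L2 f -> L2 g ->
  form_operator f g <-> generator (@ipF R G) T f g.
Proof.
move=> Lf Lg; have [ST B] := T_semigroup; apply: iff_trans (B f g Lf Lg) _.
apply: L2_snorm_cvg => t t0.
by apply: (si_B P) => //; apply: (si_Z P); apply: (si_B P) => //;
  exact: semigroup_L2 ST _ _ (ltW t0) Lf.
Qed.

Lemma form_domain_dense f (eps : R) : L2 f -> 0 < eps ->
  exists2 g, domain (@L2 R G) (@ipF R G) T g & N (f - g) < eps.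
Proof.
move=> Lf; have S := form_semigroup.
suff [_ Wf] : L2 f /\ forall eps : R, 0 < eps ->
  exists2 g, domain (@L2 R G) (@ipF R G) T g & N (f - g) < eps by exact: Wf.
apply: (closed_subspace_dense (domain_closure P S Lf)) Lf => e b phi Cphi.
have Lp : L2 (emb e (axis b phi) : F).
  by apply/L2_emb/L2_01_axis; case: (test_L2r (C2c_test Cphi)).
have Lpp := si_B P Lp Lp; rewrite subrr in Lpp.
split; first exact: Lp.
move=> e' e0; exists (emb e (axis b phi)); last by rewrite subrr (snorm0 P Lpp).
split; first exact: Lp.
have [g Lg fg] := C2c_form_operator e b Cphi; exists g; first exact: Lg.
by apply/(form_generatorP Lp Lg).
Qed.

(** * Restriction to a set of edges *)

Section edge_projection.
Variable S : set (edge G).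

Definition edge_restrict f : F := fun e => if e \in S then f e else fun=> 0.

Lemma L2_restrict f : L2 f -> L2 (edge_restrict f).
Proof.
move=> /L2E[Lf sf]; apply/L2E; split=> [e|].
  by rewrite /edge_restrict; case: ifP => // _; exact: L2_01_0.
apply: asum_le sf => e; rewrite ger0_norm ?ip01_ge0// /edge_restrict.
by case: ifP => // _; rewrite ip01_0 ip01_ge0.
Qed.

Lemma restrictB f g : edge_restrict (f - g) = edge_restrict f - edge_restrict g.
Proof.
apply/funext => e; apply/funext => x; rewrite subFE /edge_restrict.
by case: ifP => // _; rewrite subrr.
Qed.

Lemma restrictZ (c : R) f : edge_restrict (c *: f) = c *: edge_restrict f.
Proof.
apply/funext => e; apply/funext => x; rewrite scaleFE /edge_restrict.
by case: ifP => // _; rewrite mulr0.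
Qed.

Lemma ip_restrict f g : ipF f (edge_restrict g) = ipF (edge_restrict f) g.
Proof.
congr sumE; apply/funext => e; rewrite /edge_restrict.
by case: ifP => // _; rewrite ip01C !ip01_0.
Qed.

Lemma restrict_idem f : edge_restrict (edge_restrict f) = edge_restrict f.
Proof. by apply/funext => e; rewrite /edge_restrict; case: (e \in S). Qed.

Lemma snorm_restrict f : L2 f -> N (edge_restrict f) <= N f.
Proof.
move=> Lf; have Lr := L2_restrict Lf; rewrite leNgt; apply/negP => lt_N.
have := le_trans (ler_norm _) (cauchy_schwarz P Lr Lf).
have := ip_restrict (edge_restrict f) f; rewrite restrict_idem => <-.
rewrite -(snorm_sq P Lr) expr2 leNgt ltr_pM2l ?lt_N//.
exact: le_lt_trans (snorm_ge0 _ _) lt_N.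
Qed.

Hypothesis form_dom_restrict : forall psi, form_dom psi -> form_dom (edge_restrict psi).

Lemma derivF_restrict psi : form_dom psi ->
  eqL2 (derivF (edge_restrict psi)) (edge_restrict (derivF psi)).
Proof.
move=> [[Hpsi _ _] _] e; rewrite /derivF /edge_restrict.
case: ifP => _; first by apply: aeW.
apply: wderiv_ae; [exact: L2_01_0|exact: L2_01_0|].
have dz (x : R) : is_derive x 1 (fun=> 0 : R) 0 := is_derive_cst 0 x 1.
have cz : continuous (fun _ : R => 0 : R) by move=> x; exact: cvg_cst.
by have := weak_derivative_axis false dz cz; rewrite axis0.
Qed.

(** Differentiation acts edge by edge and commutes with restriction, so both sides are minus the
    scalar product of the restricted derivative of f with the derivative of g. The restrictions of f
    and g may be inserted into the form because they stay in its domain. *)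
Lemma form_symmetric f g f' g' : L2 f -> L2 g -> L2 f' -> L2 g' ->
  generator (@ipF R G) T f f' -> generator (@ipF R G) T g g' ->
  ipF f' (edge_restrict g) = ipF f (edge_restrict g').
Proof.
move=> Lf Lg Lf' Lg' /(form_generatorP Lf Lf')[domf [k [Lk Hk fk]]].
move=> /(form_generatorP Lg Lg')[domg [l [Ll Hl gl]]].
have rf := form_dom_restrict domf; have rg := form_dom_restrict domg.
have Hk' := etrans (esym (Re_dotL2 _ _))
  (etrans (congr1 Re (Hk _ rg)) (Re_dotL2 _ _)).
have Hl' := etrans (esym (Re_dotL2 _ _))
  (etrans (congr1 Re (Hl _ rf)) (Re_dotL2 _ _)).
have Lrf := L2_restrict Lf; have Lrg := L2_restrict Lg.
have opp (u u' v : F) : L2 u -> L2 u' -> L2 v -> eqL2 u' (oppF u) ->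
    ipF u' v = - ipF u v.
  move=> Lu Lu' Lv uu; have LNu := si_N P Lu.
  have uu' : N (u' - - u) = 0 by apply/(eqL2_snorm Lu' LNu).
  by rewrite (eqv_ip P Lu' LNu Lv uu') -scaleN1r (si_ipZ P _ Lu Lv) mulN1r.
have [[_ _ Ldf] _] := domf; have [[_ _ Ldg] _] := domg.
have [[_ _ Ldrf] _] := rf; have [[_ _ Ldrg] _] := rg.
have Lrdf := L2_restrict Ldf; have Lrdg := L2_restrict Ldg.
have Ef := iffLR (eqL2_snorm Ldrf Lrdf) (derivF_restrict domf).
have Eg := iffLR (eqL2_snorm Ldrg Lrdg) (derivF_restrict domg).
rewrite (opp _ _ _ Lk Lf' Lrg fk) [RHS]ip_restrict (si_ipC P Lrf Lg').
rewrite (opp _ _ _ Ll Lg' Lrf gl) -Hk' -Hl'.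
have E1 : ipF (derivF f) (derivF (edge_restrict g)) =
    ipF (edge_restrict (derivF f)) (derivF g).
  apply: etrans (ip_restrict _ _); apply: etrans (si_ipC P Lrdg Ldf).
  exact: etrans (si_ipC P Ldf Ldrg) (eqv_ip P Ldrg Lrdg Ldf Eg).
have E2 : ipF (derivF g) (derivF (edge_restrict f)) =
    ipF (edge_restrict (derivF f)) (derivF g).
  exact: etrans (si_ipC P Ldg Ldrf) (eqv_ip P Ldrf Lrdf Ldg Ef).
exact: congr1 (etrans E1 (esym E2)).
Qed.

Lemma form_semigroup_symmetric (t : R) f g : 0 <= t -> L2 f -> L2 g ->
  ipF (T t f) (edge_restrict g) = ipF f (edge_restrict (T t g)).
Proof.
apply: (semigroup_symmetric P form_semigroup L2_restrict restrictB restrictZ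
  snorm_restrict form_symmetric) => f' e Lf' e0.
exact: form_domain_dense.
Qed.

End edge_projection.

End form_semigroup.

(** * The ideal of a finite span *)

Section span_ideal.
Variables (R : realType) (G : graph).
Local Notation mu := (@lebesgue_measure R).
Local Notation I01 := [set` `[(0 : R), (1 : R)]].
Local Notation Re := (@complex.Re R).
Local Notation Im := (@complex.Im R).
Local Notation F := (edge_fun R G).
Local Notation N := (snorm (@ipF R G)).
Local Notation P := (@L2_semi_inner R G).
Implicit Types f g h psi phi : F.

Lemma L2_01_complexZ (c : R[i]) (u : R -> R[i]) : L2_01 u -> L2_01 (fun x => c * u x).
Proof.
move=> Lu; have := L2_01D (L2_01Z (Re c) Lu) (L2_01Z (Im c) (L2_01_mulI Lu)).
congr L2_01; apply/funext => x; rewrite /mulI; case: c (u x) => a b [p q].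
by apply: complex_ext => /=; ring.
Qed.

Lemma ip01_complexZ (c : R[i]) (u : R -> R[i]) : L2_01 u ->
  ip01 (fun x => c * u x) (fun x => c * u x) = abs2 c * ip01 u u.
Proof.
move=> Lu; rewrite /ip01 -RintegralZl//; last exact: ip01_integrable.
apply: eq_Rintegral => x _; rewrite /abs2; case: c (u x) => a b [p q] /=; ring.
Qed.

Lemma L2_complexZ (c : R[i]) f : L2 f -> L2 (scaleF c f).
Proof.
move=> /L2E[Lf sf]; apply/L2E; split=> [e|]; first exact: L2_01_complexZ.
apply: (asum_le _ (asumZ (abs2 c) sf)) => e.
by rewrite ger0_norm ?ip01_ge0// -ip01_complexZ.
Qed.

Lemma L2_eqL2 f g : (forall e, L2_01 (f e)) -> L2 g -> eqL2 f g -> L2 f.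
Proof.
move=> Lf /L2E[Lg sg] fg; apply/L2E; split=> //; apply: asum_le sg => e.
rewrite ger0_norm ?ip01_ge0// (ip01_ae (Lf e) (Lg e) (Lf e) (fg e)) ip01C.
by rewrite (ip01_ae (Lf e) (Lg e) (Lg e) (fg e)).
Qed.

Lemma has_trace0 (x : R) : has_trace (fun=> 0 : R[i]) x 0.
Proof.
exists (fun=> 0); split=> //; first by move=> y; exact: cvg_cst.
  by move=> y; exact: cvg_cst.
exact: aeW.
Qed.

Lemma H1_01_0 : H1_01 (fun=> 0 : R[i]).
Proof.
split; first exact: L2_01_0.
exists (fun=> 0); split; first exact: L2_01_0.
have dz (x : R) : is_derive x 1 (fun=> 0 : R) 0 := is_derive_cst 0 x 1.
have cz : continuous (fun _ : R => 0 : R) by move=> x; exact: cvg_cst.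
by have := weak_derivative_axis false dz cz; rewrite axis0.
Qed.

Lemma form_dom_restrict (S : set (edge G)) psi : node_closed S ->
  form_dom psi -> form_dom (edge_restrict S psi).
Proof.
move=> cS dpsi; have [[Hpsi Lpsi Ldpsi] [d [sd tr]]] := dpsi.
have Hr e : H1_01 (edge_restrict S psi e).
  by rewrite /edge_restrict; case: ifP => // _; exact: H1_01_0.
split.
  split; [exact: Hr|exact: L2_restrict|].
  apply: L2_eqL2 (L2_restrict S Ldpsi) (derivF_restrict S dpsi).
  by move=> e; case: (wderivP (Hr e)).
(* The node values are kept wherever S is touched. There is no conflict at a node with edges both in
   S and outside: since S is [node_closed], its degree is infinite and d vanishes there. *)
pose d' v := if pselect (exists2 e, S e & incident v e) then d v else 0.
exists d'; split.
  apply: le_lt_trans sd; apply: le_esum => v _; rewrite lee_fin /d'.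
  by case: pselect => [?|?] //=; rewrite /abs2/= expr0n addr0 addr_ge0 ?sqr_ge0.
have trS v e : ~ S e -> incident v e -> d' v = 0.
  move=> nSe ve; rewrite /d'; case: pselect => [[e1 Se1 ve1]|] //=.
  apply: (infinite_degree_trace (And3 Hpsi Lpsi Ldpsi) tr) => fv.
  by apply: nSe; exact: (cS v e1).
have trT v e : S e -> incident v e -> d' v = d v.
  by move=> Se ve; rewrite /d'; case: pselect => [//|[]] /=; exists e.
move=> e; have [Se|/negP nSe] := boolP (e \in S).
  rewrite inE in Se; rewrite (trT _ e)//; last by left.
  rewrite (trT (head e) e)//; last by right.
  by rewrite /edge_restrict mem_set.
rewrite inE in nSe; rewrite (trS _ e)//; last by left.
rewrite (trS (head e) e)//; last by right.
by rewrite /edge_restrict memNset//; split; exact: has_trace0.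
Qed.

Definition component_ideal (S : set (edge G)) : set F :=
  [set f | L2 f /\ forall e, ~ S e -> {ae mu, forall x, 0 <= x <= 1 -> f e x = 0}].

Lemma component_closed_ideal S : closed_ideal (component_ideal S).
Proof.
split.
- by move=> f [].
- split=> [|e _]; last exact: aeW.
  by apply/L2E; split=> [e|]; [exact: L2_01_0|
    apply: (@asum_finite R G _ set0) => [|e _]; [exact: finite_set0|exact: ip01_0]].
- move=> f g [Lf f0] [Lg g0]; split; first exact: (si_D P Lf Lg).
  move=> e Se; apply: ae_imp2 (f0 _ Se) (g0 _ Se) => x + + x01.
  by rewrite /addF => -> // ->//; rewrite addr0.
- move=> c f [Lf f0]; split; first exact: L2_complexZ.
  move=> e Se; apply: ae_imp (f0 _ Se) => x + x01.
  by rewrite /scaleF => -> //; rewrite mulr0.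
- move=> f g [Lf f0] Lg gf; split; first exact: Lg.
  move=> e Se.
  apply: ae_imp2 (f0 _ Se) (gf e) => x + + x01 => -> // /(_ x01).
  by rewrite normr0 normr_le0 => /eqP.
- move=> f Lf apx; split; first exact: Lf.
  move=> e Se.
  have Lfe : L2_01 (f e) by case: Lf.
  apply/(ip01_eq0 Lfe)/eqP; rewrite eq_le ip01_ge0 andbT.
  apply/ler_addgt0Pl => eps eps0; rewrite addr0.
  have se0 : 0 < Num.sqrt eps by rewrite sqrtr_gt0.
  have [g [Lg g0]] := apx _ se0.
  have Lfg := si_B P Lf Lg; rewrite (normL2E Lfg) => fg.
  apply: (@le_trans _ _ (ipF (f - g) (f - g))); last first.
    rewrite -(snorm_sq P Lfg) -(sqr_sqrtr (ltW eps0)).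
    by apply: lerXn2r; [exact: snorm_ge0|exact: sqrtr_ge0|exact: ltW].
  apply: le_trans (ip01_le_ipF e Lfg).
  have Lfge : L2_01 ((f - g) e) by case: Lfg.
  have fge : {ae mu, forall x, 0 <= x <= 1 -> f e x = (f - g) e x}.
    apply: ae_imp (g0 _ Se) => x + x01; rewrite subFE => -> //.
    by rewrite subr0.
  by rewrite (ip01_ae Lfe Lfge Lfe fge) ip01C (ip01_ae Lfe Lfge Lfge fge).
Qed.

Variable T : R -> F -> F.
Hypothesis T_semigroup : generates (@form_operator R G) T.

(** Let Q be the restriction to the complement of S, so that Q f = 0. By symmetry the squared norm
    of Q T f is (T f | Q T f) = (f | Q T T f) = (Q f | T T f) = 0. *)
Lemma component_invariant S : node_closed S -> invariant T (component_ideal S).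
Proof.
move=> cS t f t0 [Lf f0]; have [ST _] := T_semigroup.
have LT := semigroup_L2 ST t0 Lf; split; first exact: LT.
move=> e Se.
have LTT := semigroup_L2 ST t0 LT.
pose S' := ~` S; have dom psi := @form_dom_restrict S' psi (node_closedC cS).
have LrT := L2_restrict S' LT.
have LrTT := L2_restrict S' LTT.
have sym := form_semigroup_symmetric T_semigroup dom t0 Lf LT.
have E0 : ipF f (edge_restrict S' (T t (T t f))) = 0.
  rewrite ip_restrict.
  have Lr := L2_restrict S' Lf.
  have r0 : N (edge_restrict S' f) = 0.
    apply/(snorm0_eqL2 Lr) => e'; rewrite /edge_restrict.
    by case: ifP => [|_]; [rewrite inE => /f0|exact: aeW].
  have := cauchy_schwarz P Lr LTT; rewrite r0 mul0r normr_le0 => /eqP.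
  by [].
have n0 : N (edge_restrict S' (T t f)) = 0.
  apply/eqP; rewrite -sqrf_eq0 (snorm_sq P LrT); apply/eqP.
  have -> := ip_restrict S' (edge_restrict S' (T t f)) (T t f).
  rewrite restrict_idem.
  exact: etrans (si_ipC P LrT LT) (etrans sym E0).
have /(_ e) := iffLR (snorm0_eqL2 LrT) n0.
by rewrite /edge_restrict mem_set.
Qed.

Lemma constant_not_ae0 (c : R) : c != 0 ->
  ~ {ae mu, forall x, 0 <= x <= 1 -> axis false (fun=> c) x = 0}.
Proof.
move=> c0 H; have Lc : L2_01 (axis false (fun=> c)).
  by apply: L2_01_axis; exact: L2r_cst.
have := iffRL (ip01_eq0 Lc) H; rewrite ip01_axis (Rintegral_cst01 (c ^+ 2)) => /eqP.
by rewrite expf_eq0 (negbTE c0) andbF.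
Qed.

Lemma irreducible_span (e0 : edge G) : irreducible T -> finite_span R e0 = setT.
Proof.
move=> irr; apply: span1_full; set S := span1 R e0.
have cS : node_closed S := @span1_closed R G e0.
have one1 : (1 : R) != 0 by exact: oner_neq0.
pose one e : F := emb e (axis false (fun=> 1)).
have Lone e : L2 (one e) by apply/L2_emb/L2_01_axis/L2r_cst.
case: (irr _ (component_closed_ideal S) (component_invariant cS)) => E.
  have : component_ideal S (one e0).
    split; first exact: Lone.
    move=> e Se; rewrite /one /emb; case: eqP => [ee|_]; last exact: aeW.
    by exfalso; apply: Se; left.
  by rewrite E => -[_ /(_ e0)]; rewrite /one /emb eqxx => /(constant_not_ae0 one1).
apply/seteqP; split=> // e _; apply: contrapT => Se.
have : component_ideal S (one e) by rewrite E; exact: Lone.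
by move=> [_ /(_ _ Se)]; rewrite /one /emb eqxx => /(constant_not_ae0 one1).
Qed.

End span_ideal.

(** * Supports of closed ideals *)

Section ideal_support.
Variables (R : realType) (G : graph).
Local Notation mu := (@lebesgue_measure R).
Local Notation I01 := [set` `[(0 : R), (1 : R)]].
Local Notation Re := (@complex.Re R).
Local Notation Im := (@complex.Im R).
Local Notation F := (edge_fun R G).
Local Notation N := (snorm (@ipF R G)).
Local Notation P := (@L2_semi_inner R G).
Implicit Types (f g h psi phi : F) (A B : set R).

Lemma normc_le (z w : R[i]) : (`|z| <= `|w|) = (abs2 z <= abs2 w).
Proof. by rewrite !normc_def lecR ler_sqrt// addr_ge0 ?sqr_ge0. Qed.

Lemma abs2_axis b (p : R -> R) x : abs2 (axis b p x) = p x ^+ 2.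
Proof. by rewrite /abs2 /axis; case: b; rewrite /= expr0n ?add0r ?addr0. Qed.

Lemma abs2M (c z : R[i]) : abs2 (c * z) = abs2 c * abs2 z.
Proof. by rewrite /abs2; case: c z => a b [p q] /=; ring. Qed.

Lemma abs2_real (c : R) : abs2 (real_complex R c) = c ^+ 2.
Proof. by rewrite /abs2/= expr0n addr0. Qed.

Lemma abs2_0 : abs2 (0 : R[i]) = 0.
Proof. by rewrite /abs2/= expr0n addr0. Qed.

Lemma abs2_ge0 (z : R[i]) : 0 <= abs2 z.
Proof. by rewrite addr_ge0 ?sqr_ge0. Qed.

Lemma abs2_eq0 (z : R[i]) : abs2 z = 0 -> z = 0.
Proof.
move=> /eqP; rewrite /abs2 paddr_eq0 ?sqr_ge0// !sqrf_eq0 => /andP[/eqP a /eqP b].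
exact: complex_ext.
Qed.

Lemma indic_range A x : 0 <= (\1_A x : R) <= 1.
Proof. by rewrite indicE; case: (x \in A); rewrite ?lexx ?ler01. Qed.

Definition measure01 A : R := \int[mu]_(x in I01) (\1_A x : R).

Lemma measure01E A : measurable A -> measure01 A = fine (mu (A `&` I01)).
Proof.
by move=> mA; rewrite /measure01 /Rintegral integral_indic//; exact: measurable_I01.
Qed.

Lemma measure01_le1 A : measurable A -> measure01 A <= 1.
Proof.
move=> mA; rewrite -[leRHS](@Rintegral_cst01 R 1); apply: le_Rintegral01.
- exact/L2r_integrable/L2r_indic.
- exact/L2r_integrable/L2r_cst.
- by move=> x _; have /andP[] := indic_range A x.
Qed.

Lemma measure01_sub A B : measurable A -> measurable B -> A `<=` B ->
  \int[mu]_(x in I01) ((\1_B x - \1_A x : R) ^+ 2) = measure01 B - measure01 A.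
Proof.
move=> mA mB AB; rewrite /measure01 -RintegralB//; last 2 first.
- exact/L2r_integrable/L2r_indic.
- exact/L2r_integrable/L2r_indic.
- apply: eq_Rintegral => x _; rewrite !indicE.
  have [xA|xA] := boolP (x \in A); last first.
    by case: (x \in B); rewrite subr0 ?expr1n ?expr0n.
  by rewrite (mem_set (AB _ (set_mem xA))) subrr expr0n.
Qed.

Lemma measure01_le A B : measurable A -> measurable B -> A `<=` B ->
  measure01 A <= measure01 B.
Proof.
move=> mA mB AB; rewrite -subr_ge0 -measure01_sub//.
by apply: Rintegral_ge0 => x _; exact: sqr_ge0.
Qed.

Lemma measure01_bigcup (A : nat -> set R) (eps : R) : (forall n, measurable (A n)) ->
  {homo A : m n / (m <= n)%N >-> m `<=` n} -> 0 < eps ->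
  exists n, measure01 (\bigcup_n A n) - measure01 (A n) < eps.
Proof.
move=> mA ndA eps0; have mU : measurable (\bigcup_n A n) by exact: bigcup_measurable.
have mI B : measurable B -> measurable (B `&` I01).
  by move=> mB; apply: measurableI => //; exact: measurable_I01.
have fin B : measurable B -> mu (B `&` I01) \is a fin_num.
  move=> mB; rewrite ge0_fin_numE//; apply: (@le_lt_trans _ _ (mu I01)).
    by apply: le_measure; rewrite ?inE//; exact: mI.
  by rewrite mu_I01 ltry.
have : (mu (A n `&` I01)) @[n --> \oo] --> mu (\bigcup_n A n `&` I01).
  rewrite setI_bigcupl; apply: nondecreasing_cvg_mu => [n||m n mn].
  - exact: (mI _ (mA n)).
  - by rewrite -setI_bigcupl; exact: (mI _ mU).
  - by apply/subsetPset; apply: setSI; exact: ndA.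
rewrite -(fineK (fin _ mU)) => /fine_cvg/cvgrPdist_lt/(_ _ eps0)[n _ /(_ n (leqnn n))].
rewrite /= => H; exists n; rewrite !measure01E//.
exact: le_lt_trans (ler_norm _) H.
Qed.

Lemma measure01_negligible A B : measurable A -> measurable B ->
  measure01 (A `|` B) <= measure01 B ->
  {ae mu, forall x, 0 <= x <= 1 -> A x -> B x}.
Proof.
move=> mA mB AB; have mAB := measurableU _ _ mA mB.
have LAB : L2_01 (axis false (fun x => \1_(A `|` B) x - \1_B x : R)).
  by apply: L2_01_axis; apply: L2rB; exact: L2r_indic.
have : ip01 (axis false (fun x => \1_(A `|` B) x - \1_B x : R))
    (axis false (fun x => \1_(A `|` B) x - \1_B x : R)) = 0.
  apply/eqP; rewrite eq_le ip01_ge0 andbT ip01_axis measure01_sub//.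
  by rewrite subr_le0.
move/(ip01_eq0 LAB); apply: ae_imp => x + x01 Ax => /(_ x01)[].
rewrite !indicE mem_set; last by left.
by case: (boolP (x \in B)) => [/set_mem//|_] /eqP; rewrite subr0 oner_eq0.
Qed.

Variable I : set F.
Hypothesis closedI : closed_ideal I.

Definition indicator e A : F := emb e (axis false (\1_A : R -> R)).

Lemma L2_indicator e A : measurable A -> L2 (indicator e A).
Proof. by move=> mA; exact/L2_emb/L2_01_axis/L2r_indic. Qed.

Lemma ideal_le f g : I f -> L2 g -> (forall e, {ae mu, forall x,
  0 <= x <= 1 -> abs2 (g e x) <= abs2 (f e x)}) -> I g.
Proof.
move=> If Lg gf; apply: (ideal_solid closedI If Lg) => e.
by apply: ae_imp (gf e) => x + x01; rewrite normc_le; exact.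
Qed.

Lemma ideal_le_emb e (u : R -> R[i]) f : I f -> L2_01 u ->
  (forall x, 0 <= x <= 1 -> abs2 (u x) <= abs2 (f e x)) -> I (emb e u).
Proof.
move=> If Lu uf; apply: (ideal_le If (L2_emb e Lu)) => e'; apply: aeW => x x01.
rewrite /emb; case: eqP => [->|_]; first exact: uf.
by rewrite abs2_0 abs2_ge0.
Qed.

Lemma ideal_indicatorU e A B : measurable A -> measurable B ->
  I (indicator e A) -> I (indicator e B) -> I (indicator e (A `|` B)).
Proof.
move=> mA mB IA IB; have mAB := measurableU _ _ mA mB.
apply: (ideal_le_emb (idealD closedI IA IB)); first exact/L2_01_axis/L2r_indic.
move=> x _; rewrite /addF /indicator /emb eqxx abs2_axis.
rewrite /abs2/= addr0 expr0n addr0 !indicE in_setU.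
by case: (x \in A); case: (x \in B) => /=; lra.
Qed.

Lemma ideal_indicator_bigcup e (A : nat -> set R) : (forall n, measurable (A n)) ->
  {homo A : m n / (m <= n)%N >-> m `<=` n} ->
  (forall n, I (indicator e (A n))) -> I (indicator e (\bigcup_n A n)).
Proof.
move=> mA ndA IA; have mU : measurable (\bigcup_n A n) by exact: bigcup_measurable.
have LU := L2_indicator e mU; apply: (ideal_closed closedI LU) => eps eps0.
have e20 : 0 < eps ^+ 2 by rewrite exprn_gt0.
have [n Hn] := measure01_bigcup mA ndA e20; exists (indicator e (A n)); first exact: IA.
have LA := L2_indicator e (mA n); rewrite (normL2E (si_B P LU LA)).
rewrite -embB snorm_emb -(ger0_norm (ltW eps0)) -sqrtr_sqr ltr_sqrt//.
have -> : (fun x => axis false (\1_(\bigcup_n0 A n0) : R -> R) x - axis false (\1_(A n) : R -> R) x) =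
    axis false (fun x => \1_(\bigcup_n0 A n0) x - \1_(A n) x : R).
  by apply/funext => x; apply: complex_ext => /=; rewrite ?subrr.
by rewrite ip01_axis measure01_sub//; exact: bigcup_sup.
Qed.

(** Exhaustion: sets of nearly maximal measure with indicator in I are united into one that attains
    the supremum. A further such set adds only a null set, since otherwise the union would exceed
    the supremum. *)
Lemma ideal_max_set e : exists U, [/\ measurable U, I (indicator e U) &
  forall A, measurable A -> I (indicator e A) ->
    {ae mu, forall x, 0 <= x <= 1 -> A x -> U x}].
Proof.
pose E := [set measure01 A | A in [set A | measurable A /\ I (indicator e A)]].
have supE : has_sup E.
  split; last by exists 1 => _ [A [mA _] <-]; exact: measure01_le1.
  exists (measure01 set0); exists set0 => //; split; first exact: measurable0.
  apply: (ideal_le_emb (ideal0 closedI)); first exact/L2_01_axis/L2r_indic/measurable0.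
  by move=> x _; rewrite abs2_axis indic0 expr0n abs2_ge0.
have /choice[A HA] : forall n : nat, exists A, [/\ measurable A, I (indicator e A) &
    sup E - n.+1%:R^-1 < measure01 A].
  move=> n; have n0 : 0 < n.+1%:R^-1 :> R by rewrite invr_gt0.
  by have [_ [A [mA IA] <-] lt] := sup_adherent n0 supE; exists A.
pose B n := \big[setU/set0]_(i < n.+1) A i.
have mB n : measurable (B n).
  by apply: bigsetU_measurable => i _; case: (HA i).
have IB n : I (indicator e (B n)).
  elim: n => [|n IH]; first by rewrite /B big_ord1; case: (HA 0%N).
  rewrite /B big_ord_recr; have [mA IA _] := HA n.+1.
  exact: (ideal_indicatorU (mB n) mA IH IA).
have ndB : {homo B : m n / (m <= n)%N >-> m `<=` n}.
  by move=> m n mn; apply: subset_bigsetU; rewrite ltnS.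
have mU : measurable (\bigcup_n B n) by exact: bigcup_measurable.
exists (\bigcup_n B n); split=> //; first exact: ideal_indicator_bigcup.
move=> C mC IC; apply: measure01_negligible => //.
apply: (@le_trans _ _ (sup E)).
  apply: ub_le_sup; first by case: supE.
  exists (C `|` \bigcup_n B n) => //; split; first exact: measurableU.
  by apply: ideal_indicatorU => //; exact: ideal_indicator_bigcup.
apply/ler_addgt0Pr => d d0; rewrite -lerBlDr.
have [n _ /(_ n (leqnn n)) /= nd] := near_infty_natSinv_lt (PosNum d0).
have [mA _ ltA] := HA n.
apply: (@le_trans _ _ (measure01 (A n))).
  by apply: ltW; apply: le_lt_trans ltA; rewrite lerB// ltW.
apply: measure01_le => //; apply: (@subset_trans _ (B n)); last exact: bigcup_sup.
by rewrite /B big_ord_recr; exact: subsetUr.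
Qed.

Lemma ideal_edge_support e : exists U, [/\ measurable U, I (indicator e U) &
  forall f, I f -> {ae mu, forall x, 0 <= x <= 1 -> f e x != 0 -> U x}].
Proof.
have [U [mU IU maxU]] := ideal_max_set e; exists U; split=> // f If.
(* The set where f is nonzero is exhausted by the sets where n |f| >= 1; their indicators are
   dominated by n f and lie in I by solidity. Measurability is known on [0, 1] only, hence the
   intersection below. *)
have /L2_01P[[mre _] [mim _]] : L2_01 (f e) by case: (ideal_L2 closedI If).
pose A (n : nat) := I01 `&` [set x | 1 <= n%:R ^+ 2 * abs2 (f e x)].
have mA n : measurable (A n).
  apply: (@measurable_fun_le _ _ _ I01 (fun=> 1)) => //.
  apply: measurable_funM => //; apply: measurable_funD; exact: measurable_funX.
have : {ae mu, forall x, forall n, 0 <= x <= 1 -> A n x -> U x}.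
  apply: ae_foralln => n; apply: maxU => //.
  apply: (ideal_le_emb (idealZ closedI (real_complex R n%:R) If)).
    exact/L2_01_axis/L2r_indic.
  move=> x x01; rewrite abs2_axis /scaleF abs2M abs2_real indicE.
  have [/set_mem[_ /= Ax]|_] := boolP (x \in A n); first by rewrite expr1n.
  by rewrite expr0n mulr_ge0 ?sqr_ge0 ?abs2_ge0.
apply: ae_imp => x H x01 fx; set z := abs2 (f e x).
have z0 : 0 < z.
  by rewrite lt_neqAle abs2_ge0 andbT eq_sym; apply: contra_neq fx => /abs2_eq0.
pose n := (Num.truncn z^-1).+1.
apply: (H n) => //; split; first by rewrite /= in_itv.
rewrite /= -/z -ler_pdivrMr// div1r (le_trans (ltW (truncnS_gt _)))//.
by rewrite -natrX ler_nat expnS expn1 leq_pmull.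
Qed.

Lemma ideal_support : exists U : edge G -> set R, forall e, [/\ measurable (U e),
  I (indicator e (U e)) &
  forall f, I f -> {ae mu, forall x, 0 <= x <= 1 -> f e x != 0 -> U e x}].
Proof. by have /choice[U HU] := ideal_edge_support; exists U. Qed.

End ideal_support.

(** * Multiplication by indicator functions of subsets of the edges *)

Section support_projection.
Variables (R : realType) (G : graph).
Local Notation mu := (@lebesgue_measure R).
Local Notation I01 := [set` `[(0 : R), (1 : R)]].
Local Notation Re := (@complex.Re R).
Local Notation Im := (@complex.Im R).
Local Notation F := (edge_fun R G).
Local Notation N := (snorm (@ipF R G)).
Local Notation P := (@L2_semi_inner R G).
Implicit Types (f g h psi phi : F).

Variable U : edge G -> set R.
Hypothesis mU : forall e, measurable (U e).

Definition proj f : F := fun e x => if x \in U e then f e x else 0.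

Lemma L2_01_proj f e : L2_01 (f e) -> L2_01 (proj f e).
Proof.
move=> /L2_01P[fr fi]; apply/L2_01P; split.
  have -> : Re \o proj f e = (\1_(U e) : R -> R) \* (Re \o f e).
    by apply/funext => x; rewrite /proj /= indicE; case: ifP; rewrite ?mul1r ?mul0r.
  apply: (L2r_le _ fr); first by apply: measurable_funM (fr.1); exact: measurable_indic.
  by move=> x _ /=; rewrite indicE; case: (_ \in _); rewrite ?mul1r ?mul0r ?normr0.
have -> : Im \o proj f e = (\1_(U e) : R -> R) \* (Im \o f e).
  by apply/funext => x; rewrite /proj /= indicE; case: ifP; rewrite ?mul1r ?mul0r.
apply: (L2r_le _ fi); first by apply: measurable_funM (fi.1); exact: measurable_indic.
by move=> x _ /=; rewrite indicE; case: (_ \in _); rewrite ?mul1r ?mul0r ?normr0.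
Qed.

Lemma L2_proj f : L2 f -> L2 (proj f).
Proof.
move=> /L2E[Lf sf]; apply/L2E; split=> [e|]; first exact: L2_01_proj.
apply: asum_le sf => e; rewrite ger0_norm ?ip01_ge0//.
apply: le_Rintegral01.
- exact: ip01_integrable (L2_01_proj (Lf e)) (L2_01_proj (Lf e)).
- exact: ip01_integrable.
- move=> x _; rewrite /proj; case: ifP => // _.
  by rewrite /= !mul0r addr0 addr_ge0// -expr2 sqr_ge0.
Qed.

Lemma projB f g : proj (f - g) = proj f - proj g.
Proof.
apply/funext => e; apply/funext => x; rewrite subFE /proj.
by case: ifP => // _; rewrite subrr.
Qed.

Lemma projD f g : proj (f + g) = proj f + proj g.
Proof.
apply/funext => e; apply/funext => x; rewrite addFE /proj.
by case: ifP => // _; rewrite addr0.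
Qed.

Lemma projZ (c : R) f : proj (c *: f) = c *: proj f.
Proof.
apply/funext => e; apply/funext => x; rewrite scaleFE /proj.
by case: ifP => // _; rewrite mulr0.
Qed.

Lemma ip_proj f g : ipF f (proj g) = ipF (proj f) g.
Proof.
congr sumE; apply/funext => e; apply: eq_Rintegral => x _; rewrite /proj.
by case: ifP => // _; rewrite /= !mulr0 !mul0r.
Qed.

Lemma proj_idem f : proj (proj f) = proj f.
Proof. by apply/funext => e; apply/funext => x; rewrite /proj; case: (x \in U e). Qed.

Lemma snorm_proj f : L2 f -> N (proj f) <= N f.
Proof.
move=> Lf; have Lr := L2_proj Lf; rewrite leNgt; apply/negP => lt_N.
have := le_trans (ler_norm _) (cauchy_schwarz P Lr Lf).
have := ip_proj (proj f) f; rewrite proj_idem => <-.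
rewrite -(snorm_sq P Lr) expr2 leNgt ltr_pM2l ?lt_N//.
exact: le_lt_trans (snorm_ge0 _ _) lt_N.
Qed.

End support_projection.

(** * The projection onto an invariant ideal *)

Section ideal_projection.
Variables (R : realType) (G : graph).
Local Notation mu := (@lebesgue_measure R).
Local Notation I01 := [set` `[(0 : R), (1 : R)]].
Local Notation Re := (@complex.Re R).
Local Notation Im := (@complex.Im R).
Local Notation F := (edge_fun R G).
Local Notation N := (snorm (@ipF R G)).
Local Notation P := (@L2_semi_inner R G).
Implicit Types (f g h psi phi : F).

Variables (I : set F) (U : edge G -> set R).
Hypothesis closedI : closed_ideal I.
Hypothesis mU : forall e, measurable (U e).
Hypothesis IU : forall e, I (indicator e (U e)).
Hypothesis maxU : forall e f, I f ->
  {ae mu, forall x, 0 <= x <= 1 -> f e x != 0 -> U e x}.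

Lemma proj_closed_subspace :
  closed_subspace (@L2 R G) (@ipF R G) (fun f => L2 f /\ I (proj U f)).
Proof.
split.
- have I0 := ideal0 closedI; split; first exact: ideal_L2 closedI _ I0.
  by rewrite (_ : proj U 0 = 0)//; apply/funext => e; apply/funext => x; rewrite /proj; case: ifP.
- move=> f g [Lf If] [Lg Ig]; split; first exact: (si_D P Lf Lg).
  by rewrite projD; exact: (idealD closedI If Ig).
- move=> c f [Lf If]; split; first exact: (si_Z P _ Lf).
  by rewrite projZ; exact: (idealZ closedI (real_complex R c) If).
- move=> f Lf apx; split; first exact: Lf.
  apply: (ideal_closed closedI (L2_proj mU Lf)) => eps eps0.
  have [g [[Lg Ig] _] fg] := apx _ eps0; exists (proj U g); first exact: Ig.
  have Lfg := si_B P Lf Lg.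
  have E : subF (proj U f) (proj U g) = proj U (f - g) by rewrite projB.
  rewrite E (normL2E (L2_proj mU Lfg)).
  exact: le_lt_trans (snorm_proj mU Lfg) fg.
Qed.

(** A continuous function cut down to U is dominated by its maximal modulus times the indicator of
    U, hence lies in I. Closedness of I and contractivity of [proj] extend this from test functions
    to L^2(G). *)
Lemma ideal_proj f : L2 f -> I (proj U f).
Proof.
move=> Lf; apply: (closed_subspace_dense proj_closed_subspace _ Lf).2.
move=> e b phi Cphi; have [[phi1 [phi2 C]] _] := Cphi.
have Lphi := (test_L2r (C2c_test Cphi)).1.
have Lemb : L2 (emb e (axis b phi) : F) by exact/L2_emb/L2_01_axis.
split; first exact: Lemb.
have csq : {within `[0, 1], continuous (fun x => phi x * phi x)}.
  by apply: continuous_subspaceT => x; apply: cvgM; exact: (C2_cont C).1.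
have [c _ phic] := EVT_max (@ler01 R) csq.
apply: (ideal_le closedI (idealZ closedI (real_complex R (phi c)) (IU e)) (L2_proj mU Lemb)).
move=> e'; apply: aeW => x x01; rewrite /proj /scaleF /indicator /emb abs2M abs2_real.
case: eqP => [->|_]; last by case: ifP => _; rewrite abs2_0 mulr0.
rewrite abs2_axis indicE; case: ifP => _; last by rewrite abs2_0 mulr_ge0 ?sqr_ge0.
by rewrite abs2_axis expr1n mulr1 !expr2 phic// in_itv.
Qed.

Lemma ideal_eq_proj f : I f -> eqL2 (proj U f) f.
Proof.
move=> If e; apply: ae_imp (maxU e If) => x H x01; rewrite /proj.
case: ifPn => // /negP xU; symmetry; apply/eqP; apply: contrapT => /negP /(H x01) Ux.
by apply: xU; exact: mem_set.
Qed.

Variable T : R -> F -> F.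
Hypothesis T_semigroup : generates (@form_operator R G) T.
Hypothesis TI : invariant T I.

(** The set of all edges is [node_closed], and restriction to it is the identity. *)
Lemma semigroup_selfadjoint (t : R) f g : 0 <= t -> L2 f -> L2 g ->
  ipF (T t f) g = ipF f (T t g).
Proof.
move=> t0 Lf Lg; have ST : node_closed [set: edge G] by [].
have rT h : edge_restrict setT h = h.
  by apply/funext => e; rewrite /edge_restrict mem_set.
have dom psi := @form_dom_restrict R G setT psi ST.
by have := form_semigroup_symmetric T_semigroup dom t0 Lf Lg; rewrite !rT.
Qed.

(* Invariance gives P T P = T P; taking adjoints, P T P = P T. *)
Lemma semigroup_proj (t : R) f : 0 <= t -> L2 f ->
  N (proj U (T t f) - T t (proj U f)) = 0.
Proof.
move=> t0 Lf; have LT h : L2 h -> L2 (T t h).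
  exact: (sg_D (form_semigroup T_semigroup) t0).
have Lp h : L2 h -> L2 (proj U h) by exact: L2_proj.
have stable h : L2 h -> N (proj U (T t (proj U h)) - T t (proj U h)) = 0.
  move=> Lh; have LTp := LT _ (Lp _ Lh).
  apply/(eqL2_snorm (Lp _ LTp) LTp); apply: ideal_eq_proj.
  by apply: TI => //; exact: ideal_proj.
(* With P the projection, [a1] to [a4] and [stable] give (P T f | k) = (f | T P k) = (f | P T P k) =
   (T P f | P k) = (T P f | k), so k is orthogonal to itself. *)
pose k := proj U (T t f) - T t (proj U f).
have L1 := Lp _ (LT _ Lf); have L2' := LT _ (Lp _ Lf).
have Lk : L2 k := si_B P L1 L2'.
suff k0 : ipF k k = 0.
  by apply/eqP; rewrite -sqrf_eq0 (snorm_sq P Lk); apply/eqP.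
have Lpk := Lp _ Lk; have LTpk := LT _ Lpk; have LpTpk := Lp _ LTpk.
have a1 : ipF (proj U (T t f)) k = ipF f (T t (proj U k)).
  exact: etrans (esym (ip_proj U (T t f) k)) (semigroup_selfadjoint t0 Lf Lpk).
have a2 : ipF f (T t (proj U k)) = ipF f (proj U (T t (proj U k))).
  apply: etrans (si_ipC P Lf LTpk) (etrans _ (si_ipC P LpTpk Lf)).
  exact: esym (eqv_ip P LpTpk LTpk Lf (stable _ Lk)).
have a3 : ipF f (proj U (T t (proj U k))) = ipF (T t (proj U f)) (proj U k).
  apply: etrans (ip_proj U f (T t (proj U k))) _.
  exact: esym (semigroup_selfadjoint t0 (Lp _ Lf) Lpk).
have a4 : ipF (T t (proj U f)) (proj U k) = ipF (T t (proj U f)) k.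
  apply: etrans (ip_proj U (T t (proj U f)) k) _.
  exact: (eqv_ip P (Lp _ L2') L2' Lk (stable _ Lf)).
have : ipF (proj U (T t f)) k = ipF (T t (proj U f)) k.
  exact: etrans a1 (etrans a2 (etrans a3 a4)).
move=> E; apply: etrans (ipBl P L1 L2' Lk) _.
by rewrite E subrr.
Qed.

Lemma generator_proj f g : L2 f -> L2 g -> generator (@ipF R G) T f g ->
  generator (@ipF R G) T (proj U f) (proj U g).
Proof.
move=> Lf Lg fg; have Lp h : L2 h -> L2 (proj U h) by exact: L2_proj.
apply: (cvg_dist_squeeze _ fg); near=> t.
have t0 : 0 < t by near: t; exact: nbhs_right_gt.
have LT h : L2 h -> L2 (T t h).
  exact: (sg_D (form_semigroup T_semigroup) (ltW t0)).
have LTf := LT _ Lf; have Lpf := Lp _ Lf; have LTpf := LT _ Lpf.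
have Lb := si_Z P t^-1 (si_B P LTf Lf); have La := si_Z P t^-1 (si_B P LTpf Lpf).
have Lbg := si_B P Lb Lg; have Lag := si_B P La (Lp _ Lg).
have LB := Lp _ Lbg; have Ld := si_B P LTpf (Lp _ LTf).
have AB : (t^-1 *: (T t (proj U f) - proj U f) - proj U g) -
    proj U (t^-1 *: (T t f - f) - g) = t^-1 *: (T t (proj U f) - proj U (T t f)).
  rewrite projB projZ projB opprB addrA subrK -scalerBr; congr (_ *: _).
  by rewrite opprB addrA subrK.
have E0 : N ((t^-1 *: (T t (proj U f) - proj U f) - proj U g) -
    proj U (t^-1 *: (T t f - f) - g)) = 0.
  rewrite AB (snormZ P _ Ld) (eqvC P (Lp _ LTf) LTpf) ?mulr0//.
  exact: (semigroup_proj (ltW t0) Lf).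
rewrite subr0 ger0_norm; last exact: snorm_ge0.
apply: le_trans (snorm_le P Lag LB) _; rewrite E0 add0r.
exact: snorm_proj.
Unshelve. all: by end_near. Qed.

Lemma form_dom_proj psi g : L2 psi -> L2 g -> form_operator psi g ->
  form_dom (proj U psi).
Proof.
move=> Lpsi Lg /(form_generatorP T_semigroup Lpsi Lg)/(generator_proj Lpsi Lg).
by move/(form_generatorP T_semigroup (L2_proj mU Lpsi) (L2_proj mU Lg)) => -[].
Qed.


End ideal_projection.

(** * Invariant ideals are trivial *)

Section zero_one.
Variable R : realType.
Local Notation mu := (@lebesgue_measure R).
Local Notation I01 := [set` `[(0 : R), (1 : R)]].

(** Starting at [n.+3] keeps the margins below 1 / 2, as the cut-off functions of [interior_bump]
    require. *)
Lemma ae_exhaustion (Q : R -> Prop) :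
  (forall n : nat, {ae mu, forall x,
    n.+3%:R^-1 <= x <= 1 - n.+3%:R^-1 -> Q x}) ->
  {ae mu, forall x, 0 <= x <= 1 -> Q x}.
Proof.
move=> /ae_foralln HQ.
have int : {ae mu, forall x : R, 0 <= x <= 1 -> 0 < x < 1} by exact: ae_interior.
apply: ae_imp2 HQ int => x HQ x01 /x01 /andP[x0 x1].
have m0 : 0 < Num.min x (1 - x) by rewrite lt_min x0 subr_gt0.
pose n := Num.truncn (Num.min x (1 - x))^-1.
have : n.+3%:R^-1 <= Num.min x (1 - x).
  rewrite -[leRHS]invrK lef_pV2 ?posrE ?invr_gt0//.
  by apply: (le_trans (ltW (truncnS_gt _))); rewrite ler_nat !ltnS -/n leqW.
by rewrite le_min => /andP[nx n1x]; apply: (HQ n); rewrite nx lerBrDr -lerBrDl.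
Qed.

Lemma interior_bump (d : R) : 0 < d -> d < 1 / 2 ->
  exists2 chi, C2c chi & forall x, d <= x <= 1 - d -> chi x = 1.
Proof.
move=> d0 d1; have /smooth_step[s [s1 [s2 [Cs sa sb _ _]]]] : d / 2 < d by lra.
have /smooth_step[t [t1 [t2 [Ct ta tb _ _]]]] : 1 - d < 1 - d / 2 by lra.
exists (fun x => s x * (1 + -1 * t x)); last first.
  by move=> x /andP[dx xd]; rewrite sb// ta// mulr0 addr0 mulr1.
split; first by do 2 eexists; exact: C2M Cs (C2D (C2_cst 1) (C2Z (-1) Ct)).
exists (d / 2), (1 - d / 2); split; [lra|lra|].
move=> x; rewrite negb_and -!ltNge => /orP[/ltW|/ltW] xd.
  by rewrite sa// mul0r.
by rewrite tb// mulr1 subrr mulr0.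
Qed.

(** The product v (chi - v) vanishes almost everywhere, hence everywhere by continuity. So v takes
    only the values 0 and 1 where chi = 1, and by the intermediate value theorem it is constant
    there. *)
Lemma continuous_cut (W : set R) (chi v : R -> R) (d : R) : 0 < d -> d < 1 / 2 ->
  continuous chi -> (forall x, d <= x <= 1 - d -> chi x = 1) ->
  {within I01, continuous v} ->
  {ae mu, forall x, 0 <= x <= 1 -> (if x \in W then chi x else 0) = v x} ->
  {ae mu, forall x, d <= x <= 1 - d -> W x} \/
  {ae mu, forall x, d <= x <= 1 - d -> ~ W x}.
Proof.
move=> d0 d1 cchi chi1 cv Wv.
have I x : d <= x <= 1 - d -> 0 <= x <= 1 by move=> /andP[? ?]; apply/andP; split; lra.
have dd : d <= d <= 1 - d by apply/andP; split; lra.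
have v01 : forall x : R, 0 <= x <= 1 -> v x * (chi x - v x) = 0.
  apply: (@continuous_ae_eq _ (fun x => v x * (chi x - v x)) (fun=> 0)).
  - move=> y; apply: cvgM; first exact: cv.
    by apply: cvgB; [apply: continuous_subspaceT; exact: cchi|exact: cv].
  - by move=> y; exact: cvg_cst.
  - apply: ae_imp Wv => y + y01 => /(_ y01) <-.
    by case: ifP => _; rewrite ?subrr ?mulr0 ?mul0r.
have val (x : R) : d <= x <= 1 - d -> v x = 0 \/ v x = 1.
  move=> xd; have /eqP := v01 _ (I _ xd); rewrite chi1// mulf_eq0 subr_eq0.
  by move=> /orP[/eqP|/eqP <-]; [left|right].
have cst (x : R) : d <= x <= 1 - d -> v x = v d.
  move=> xd; have /andP[dx xd1] := xd; apply/eqP/negPn/negP => vxd.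
  have half : Num.min (v d) (v x) <= 1 / 2 <= Num.max (v d) (v x).
    rewrite ge_min le_max.
    by case: (val _ dd) (val _ xd) vxd => -> [] ->; rewrite ?eqxx// => _;
      apply/andP; split; apply/orP; ((left; lra) || (right; lra)).
  have cdx : {within `[d, x], continuous v}.
    apply: continuous_subspaceW cv => y /=; rewrite !in_itv/= => /andP[dy yx].
    by apply/andP; split; lra.
  have [c] := IVT dx cdx half; rewrite in_itv/= => /andP[dc cx].
  have /val[->|->] : d <= c <= 1 - d by apply/andP; split; lra.
    by lra.
  by lra.
have cut (x : R) : 0 <= x <= 1 -> (0 <= x <= 1 -> (if x \in W then chi x else 0) = v x) ->
    d <= x <= 1 - d -> W x <-> v d = 1.
  move=> x01 /(_ x01) + xd; rewrite (cst _ xd) (chi1 _ xd).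
  case: ifPn => [/set_mem Wx <-//|/negP xW <-]; split=> [/mem_set//|/eqP].
  by rewrite eq_sym oner_eq0.
have [vd|vd] := val _ dd; [right|left]; apply: ae_imp Wv => x Hx xd.
  by move/(cut _ (I _ xd) Hx xd); rewrite vd => /eqP; rewrite eq_sym oner_eq0.
exact/(cut _ (I _ xd) Hx xd).
Qed.

End zero_one.

(** * From single edges to the whole graph *)

Section irreducibility.
Variables (R : realType) (G : graph).
Local Notation mu := (@lebesgue_measure R).
Local Notation I01 := [set` `[(0 : R), (1 : R)]].
Local Notation Re := (@complex.Re R).
Local Notation Im := (@complex.Im R).
Local Notation F := (edge_fun R G).
Local Notation N := (snorm (@ipF R G)).
Local Notation P := (@L2_semi_inner R G).
Implicit Types (f g h psi phi : F).

Lemma vertex_form_operator v : finite_degree v -> exists (psi g : F),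
  [/\ L2 psi, L2 g, form_operator psi g &
   forall e, (tail e = v -> has_trace (psi e) 0 1) /\
             (head e = v -> has_trace (psi e) 1 1)].
Proof.
move=> [fint finh]; pose A := [set e : edge G | tail e = v] `|` [set e | head e = v].
have fA : finite_set A by rewrite finite_setU.
(* The transition zones of s and t are disjoint and away from the ends. A loop at v thus carries
   both summands of [a], each equal to 1 at its own end and 0 at the other. *)
have /smooth_step[s [s1 [s2 [Cs sa sb _ [_ s1a s1b]]]]] : 1 / 5 < 2 / 5 :> R by lra.
have /smooth_step[t [t1 [t2 [Ct ta tb _ [_ t1a t1b]]]]] : 3 / 5 < 4 / 5 :> R by lra.
pose p e : R := (tail e == v)%:R; pose q e : R := (head e == v)%:R.
pose a e x := p e * (1 + -1 * s x) + q e * t x.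
pose a1 e x := p e * (0 + -1 * s1 x) + q e * t1 x.
pose a2 e x := p e * (0 + -1 * s2 x) + q e * t2 x.
have Ca e : C2 (a e) (a1 e) (a2 e).
  exact: C2D (C2Z _ (C2D (C2_cst 1) (C2Z (-1) Cs))) (C2Z _ Ct).
have supp e : ~ A e -> [/\ a e = fun=> 0, a1 e = fun=> 0 & a2 e = fun=> 0].
  move=> Ae; rewrite /a /a1 /a2 /p /q.
  have -> : (tail e == v) = false by apply/eqP => H; apply: Ae; left.
  have -> : (head e == v) = false by apply/eqP => H; apply: Ae; right.
  by split; apply/funext => x; rewrite !mul0r addr0.
have Ta1 e : test_function (a1 e).
  apply: (test_functionP (C2_f1 (Ca e)) (C2_f2 (Ca e))).
  exists (1 / 5), (4 / 5); split; [lra|lra|].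
  move=> x; rewrite negb_and -!ltNge /a1 => /orP[x1|x4].
    by rewrite s1a ?t1a ?mulr0 ?addr0//; lra.
  by rewrite s1b ?t1b ?mulr0 ?addr0//; lra.
pose d u : R[i] := real_complex R (u == v)%:R.
have sd : (\esum_(u in [set: vertex G]) (abs2 (d u))%:E < +oo)%E.
  apply: (@le_lt_trans _ _ (1%:E)); last exact: ltry.
  rewrite -(@esum_set1 _ _ v (fun=> 1%:E)) ?lee_fin// [leRHS]esum_mkcond.
  apply: le_esum => u _; rewrite abs2_real.
  have [->|uv] := eqVneq u v; first by rewrite mem_set// expr1n.
  by rewrite expr0n; case: ifP => _; rewrite lee_fin.
have a0 e : axis false (a e) 0 = d (tail e).
  rewrite /axis /a sa ?ta ?mulr0 ?addr0 ?mulr1//; lra.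
have a1' e : axis false (a e) 1 = d (head e).
  by rewrite /axis /a sb ?tb ?mulr1 ?subrr ?mulr0 ?add0r//; lra.
have LF (c : edge G -> R -> R) : (forall e, continuous (c e)) ->
    (forall e, ~ A e -> c e = fun=> 0) -> L2 (fun e => axis false (c e)).
  move=> cc c0; apply: (L2_finite fA) => [e|e /c0 ->].
    exact/L2_01_axis/L2r_cont.
  exact: axis0.
exists (fun e => axis false (a e)), (fun e => axis false (a2 e)); split.
- apply: LF => [e|e /supp[]//]; exact: (C2_cont (Ca e)).1.
- apply: LF => [e|e /supp[]//]; exact: (C2_f2 (Ca e)).
- apply: (smooth_form_operator fA supp Ca Ta1 sd) => e; split; [exact: a0|exact: a1'].
- move=> e; have ca := (C2_cont (Ca e)).1; split=> ev.
    by have := has_trace_axis false 0 ca; rewrite a0 ev /d eqxx.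
  by have := has_trace_axis false 1 ca; rewrite a1' ev /d eqxx.
Qed.

Variables (T : R -> F -> F).
Hypothesis T_semigroup : generates (@form_operator R G) T.

Section invariant_ideal.
Variables (I : set F) (U : edge G -> set R).
Hypothesis closedI : closed_ideal I.
Hypothesis TI : invariant T I.
Hypothesis mU : forall e, measurable (U e).
Hypothesis IU : forall e, I (indicator e (U e)).
Hypothesis maxU : forall e f, I f ->
  {ae mu, forall x, 0 <= x <= 1 -> f e x != 0 -> U e x}.

Let domP := form_dom_proj closedI mU IU maxU T_semigroup TI.

Let full e := {ae mu, forall x, 0 <= x <= 1 -> U e x}.
Let null e := {ae mu, forall x, 0 <= x <= 1 -> ~ U e x}.

(* The function 1_U chi has a continuous representative, with values 0 and 1
   where chi = 1. *)
Lemma cut_interval e (d : R) : 0 < d -> d < 1 / 2 ->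
  {ae mu, forall x, d <= x <= 1 - d -> U e x} \/
  {ae mu, forall x, d <= x <= 1 - d -> ~ U e x}.
Proof.
move=> d0 d1; have [chi Cchi chi1] := interior_bump d0 d1.
have [g Lg fg] := C2c_form_operator (G := G) e false Cchi.
have Lpsi : L2 (emb e (axis false chi) : F).
  exact/L2_emb/L2_01_axis/(test_L2r (C2c_test Cchi)).1.
have [_ [d' [_ /(_ e)[[v [vr _ uv _]] _]]]] := domP Lpsi Lg fg.
have [[chi' [chi'' C]] _] := Cchi.
apply: (continuous_cut d0 d1 (C2_cont C).1 chi1 vr).
apply: ae_imp uv => x + x01 => /(_ x01) <-; rewrite /proj /emb eqxx.
by case: ifP.
Qed.

Lemma not_full_null e : full e -> null e -> False.
Proof.
move=> fe ne; apply: (@constant_not_ae0 R 1); first exact: oner_neq0.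
by apply: ae_imp2 fe ne => x fx nx x01; case: (nx x01 (fx x01)).
Qed.

(** The alternative in [cut_interval] might depend on the margin. The intervals grow with the index,
    so once the null case fails at some n0 it fails for all larger indices, and the full case holds
    there and on all smaller intervals. *)
Lemma full_or_null e : full e \/ null e.
Proof.
have d_lt (n : nat) : 0 < n.+3%:R^-1 :> R /\ n.+3%:R^-1 < 1 / 2 :> R.
  split; first by rewrite invr_gt0.
  by rewrite div1r ltf_pV2 ?posrE// ltr_nat.
have [|/existsNP[n0 nn0]] := pselect (forall n : nat, {ae mu, forall x,
    n.+3%:R^-1 <= x <= 1 - n.+3%:R^-1 -> ~ U e x}).
  by move=> /ae_exhaustion; right.
left; apply: ae_exhaustion => n; pose m := maxn n n0.
have sub (k : nat) : (k <= m)%N -> forall x : R, k.+3%:R^-1 <= x <= 1 - k.+3%:R^-1 ->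
    m.+3%:R^-1 <= x <= 1 - m.+3%:R^-1.
  move=> km x /andP[h1 h2]; have : m.+3%:R^-1 <= k.+3%:R^-1 :> R.
    by rewrite lef_pV2 ?posrE// ler_nat.
  by move=> h3; rewrite (le_trans h3 h1) (le_trans h2)// lerB.
have [m0 m1] := d_lt m; have [H|H] := cut_interval e m0 m1.
  by apply: ae_imp H => x H /sub; rewrite leq_maxl => /(_ isT) /H.
by case: nn0; apply: ae_imp H => x H /sub; rewrite leq_maxr => /(_ isT) /H.
Qed.

Lemma full_node_closed : node_closed [set e | full e].
Proof.
move=> v e1 e2 fv v1 v2 /= f1; have [//|n2] := full_or_null e2; exfalso.
have [psi [g [Lpsi Lg fg tr]]] := vertex_form_operator fv.
have [_ [d [_ trd]]] := domP Lpsi Lg fg.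
(* An end of e1 located at v: psi has trace 1 there, whereas the node condition gives its projection
   the trace [d v], common to all edges at v. *)
have [x1 [x101 h1 k1]] : exists x : R, [/\ 0 <= x <= 1, has_trace (psi e1) x 1 &
    has_trace (proj U psi e1) x (d v)].
  case: v1 (tr e1) (trd e1) => <- [h h'] [k k'].
    by exists 0; split; [rewrite lexx ler01|exact: h|].
  by exists 1; split; [rewrite lexx ler01|exact: h'|].
have [x2 [x201 k2]] : exists x : R, 0 <= x <= 1 /\ has_trace (proj U psi e2) x (d v).
  case: v2 (trd e2) => <- [k k']; first by exists 0; rewrite lexx ler01.
  by exists 1; rewrite lexx ler01.
have e1E : {ae mu, forall x, 0 <= x <= 1 -> proj U psi e1 x = psi e1 x}.
  by apply: ae_imp f1 => x + x01 => /(_ x01) Ux; rewrite /proj mem_set.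
have e2E : {ae mu, forall x, 0 <= x <= 1 -> proj U psi e2 x = 0}.
  by apply: ae_imp n2 => x + x01 => /(_ x01) Ux; rewrite /proj memNset.
have d1 := has_trace_unique x101 (has_trace_ae e1E k1) h1.
have := has_trace_unique x201 (has_trace_ae e2E k2) (has_trace0 x2).
by rewrite d1 => /eqP; rewrite oner_eq0.
Qed.

Lemma invariant_ideal_trivial (e0 : edge G) : finite_span R e0 = setT ->
  I = [set f | L2 f /\ eqL2 f (fun _ _ => 0)] \/ I = [set f | L2 f].
Proof.
move=> spT; have sp e : finite_span R e0 e by rewrite spT.
have [f0|n0] := full_or_null e0.
  right; apply/seteqP; split=> f /=; first exact: ideal_L2 closedI f.
  move=> Lf; apply: (ideal_le closedI (ideal_proj closedI mU IU Lf) Lf) => e.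
  have fe : full e := finite_span_closed full_node_closed (sp e) f0.
  by apply: ae_imp fe => x + x01 => /(_ x01) Ux; rewrite /proj mem_set.
(* If e were full, the complement of the full edges, which is [node_closed] and contains e0, would
   still have to contain e. *)
have null_all e : null e.
  have [fe|//] := full_or_null e; exfalso.
  have nf : ~ full e0 by move=> /not_full_null; apply.
  by apply: (finite_span_closed (node_closedC full_node_closed) (sp e) nf).
left; apply/seteqP; split=> f /=.
  move=> If; split; first exact: ideal_L2 closedI f If.
  move=> e; apply: ae_imp2 (maxU e If) (null_all e) => x H nU x01.
  by apply/eqP/negPn/negP => /(H x01); exact: nU.
move=> [Lf f0]; apply: (ideal_le closedI (ideal0 closedI) Lf) => e.
by apply: ae_imp (f0 e) => x + x01 => ->.
Qed.

End invariant_ideal.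

Lemma span_irreducible (e0 : edge G) : finite_span R e0 = setT -> irreducible T.
Proof.
move=> sp I closedI TI; have [U HU] := ideal_support closedI.
apply: (@invariant_ideal_trivial I U closedI TI _ _ _ e0 sp).
- by move=> e; case: (HU e).
- by move=> e; case: (HU e).
- by move=> e f If; case: (HU e) => _ _; apply.
Qed.

End irreducibility.

Theorem theorem73 (R : realType) (G : graph)
    (T : R -> edge_fun R G -> edge_fun R G)
    (edge_nonempty : inhabited (edge G))
    (T_semigroup : generates (@form_operator R G) T) :
  (irreducible T <-> exists e : edge G, finite_span R e = [set: edge G]%classic) /\
  ((exists e : edge G, finite_span R e = [set: edge G]%classic) <->
   (forall e : edge G, finite_span R e = [set: edge G]%classic)).
Proof.
have [e0] := edge_nonempty; split; split.
- by move=> irr; exists e0; exact: irreducible_span T_semigroup e0 irr.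
- by move=> [e sp]; exact: (@span_irreducible R G T T_semigroup e sp).
- by move=> [e sp]; exact: finite_span_one_all sp.
- by move=> all; exists e0.
Qed.
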